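(* Let $d\ge 2$. Suppose the observation is $Y_1=X_1+\varepsilon_1\in\mathbb{R}^d$, where $X_1=C^{\star}+R^{\star}S(U_1)$ with $C^{\star}\in\mathbb{R}^d$, $R^{\star}\ge 0$, $U_1$ a random vector in $[0,1]^{d-1}$ with density $f^{\star}$, and $\varepsilon_1$ independent of $U_1$ with distribution $\mathbb{Q}^{\star}$. Assume (H1) and (H2). Then for any $\mathbb{Q}=\otimes_{j=1}^d\mathbb{Q}_j$ (with $\mathbb{Q}_j$ probability distributions on $\mathbb{R}$), any probability density $f$ on $[0,1]^{d-1}$, any $C\in\mathbb{R}^d$ and any $R\ge0$, we have $\mathbb{P}_{C,R,f,\mathbb{Q}}=\mathbb{P}_{C^{\star},R^{\star},f^{\star},\mathbb{Q}^{\star}}$ if and only if $R=R^{\star}$, $f=f^{\star}$, and there exists $m\in\mathbb{R}^d$ such that $C=C^{\star}+m$ and $\mathbb{Q}(\cdot)=\mathbb{Q}^{\star}(\cdot+m)$. If moreover $\mathbb{Q}$ and $\mathbb{Q}^{\star}$ have finite first moment and are centered, then $m=0$, i.e. $C=C^{\star}$ and $\mathbb{Q}=\mathbb{Q}^{\star}$.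
   Context: For $u=(u^{(1)},\dots,u^{(d-1)})\in[0,1]^{d-1}$, $S(u)\in\mathbb{R}^d$ is the point of the unit sphere with coordinates $S(u)^{(1)}=\cos(2\pi u^{(1)})$, $S(u)^{(2)}=\sin(2\pi u^{(1)})\cos(\pi u^{(2)})$, $S(u)^{(3)}=\sin(2\pi u^{(1)})\sin(\pi u^{(2)})\cos(\pi u^{(3)})$, ..., $S(u)^{(d-1)}=\sin(2\pi u^{(1)})\sin(\pi u^{(2)})\cdots\sin(\pi u^{(d-2)})\cos(\pi u^{(d-1)})$, $S(u)^{(d)}=\sin(2\pi u^{(1)})\sin(\pi u^{(2)})\cdots\sin(\pi u^{(d-2)})\sin(\pi u^{(d-1)})$ (for $d=2$, $S(u)=(\cos 2\pi u,\sin 2\pi u)$). (H1): the coordinates $\varepsilon_1^{(1)},\dots,\varepsilon_1^{(d)}$ of the noise are independent, so $\mathbb{Q}^{\star}=\otimes_{j=1}^d\mathbb{Q}^{\star}_j$ with $\mathbb{Q}^{\star}_j$ the law of $\varepsilon_1^{(j)}$. (H2): $U_1$ has a density $f^{\star}$ with respect to Lebesgue measure on $[0,1]^{d-1}$, and when $d>2$, $f^{\star}$ is positive on $(0,\gamma)^{d-1}$ for some $\gamma>0$. For a product distribution $\mathbb{Q}$ on $\mathbb{R}^d$, a probability density $f$ on $[0,1]^{d-1}$, $C\in\mathbb{R}^d$ and $R\ge0$, $\mathbb{P}_{C,R,f,\mathbb{Q}}$ denotes the law of $C+RS(U)+\varepsilon$ where $U$ has density $f$ and $\varepsilon\sim\mathbb{Q}$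 is independent of $U$.
   Formalization: The formal statement assumes R* > 0 instead of R* ≥ 0: for R* = 0 the equivalence fails, since with R = 0, C = C*, Q = Q* and any density f ≠ f* the two laws coincide. *)

(* Defs.v *)
From HB Require Import structures.
From mathcomp Require Import all_boot all_order all_algebra.
From mathcomp Require Import all_classical all_reals all_analysis.

Set Implicit Arguments.
Unset Strict Implicit.
Unset Printing Implicit Defensive.

Import Order.TTheory GRing.Theory Num.Theory.
Import numFieldNormedType.Exports.
Local Open Scope classical_set_scope.
Local Open Scope ring_scope.

Section model.
Variable R : realType.

(* points of R^n are n-tuples; n.-tuple R carries the product (Borel)
   sigma-algebra of the library (measure_tuple_display). *)
Definition tup (n : nat) (s : seq R) : n.-tuple R := [tuple nth 0 s i | i < n].
Definition vadd n (x y : n.-tuple R) : n.-tuple R := [tuple tnth x i + tnth y i | i < n].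
Definition vscale n (a : R) (x : n.-tuple R) : n.-tuple R := [tuple a * tnth x i | i < n].

Fixpoint iint (mus : seq ({measure set (measurableTypeR R) -> \bar R} * set R))
    (g : seq R -> \bar R) : \bar R :=
  if mus is (mu, D) :: mus' then
    (\int[mu]_(x in D) iint mus' (fun xs => g (x :: xs)))%E
  else g [::].

Definition cube n : set (n.-tuple R) := [set u | forall i, 0 <= tnth u i <= 1].
Definition cube_int n (g : n.-tuple R -> \bar R) : \bar R :=
  iint (nseq n ((@lebesgue_measure R : {measure set (measurableTypeR R) -> \bar R}), [set x : R | 0 <= x <= 1])) (fun s => g (tup n s)).

Definition is_density n (f : n.-tuple R -> R) : Prop :=
  [/\ measurable_fun (@cube n) f, (forall u, @cube n u -> 0 <= f u)
    & @cube_int n (fun u => (f u)%:E) = 1%E].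

(* equality of densities = equality of the probability measures they define
   (i.e. Lebesgue-a.e. equality on the cube) *)
Definition dens_eq n (f g : n.-tuple R -> R) : Prop :=
  forall A : set (n.-tuple R), measurable A ->
    @cube_int n (fun u => (f u * \1_A u)%:E) = @cube_int n (fun u => (g u * \1_A u)%:E).

Definition prodQ d (Q : 'I_d -> probability (measurableTypeR R) R) (A : set (d.-tuple R)) : \bar R :=
  iint [seq ((Q i : {measure set (measurableTypeR R) -> \bar R}), setT) | i <- enum 'I_d]
       (fun s => (\1_A (tup d s))%:E).

(* the parametrisation S : [0,1]^(d-1) -> unit sphere of R^d (0-indexed) *)
Definition Sph d (u : (d.-1).-tuple R) : d.-tuple R :=
  [tuple (let a l := nth 0 (val u) l in
          if (i : nat) == 0%N then cos (2 * pi * a 0%N)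
          else sin (2 * pi * a 0%N) * (\prod_(1 <= l < i) sin (pi * a l))
               * (if (i < d.-1)%N then cos (pi * a (i : nat)) else 1)) | i < d].

(* P_{C,Rad,f,Q}(B) : the law of C + Rad S(U) + eps, U with density f,
   eps ~ Q = (x)_j Q_j independent of U, evaluated at B ⊆ R^d. *)
Definition lawP d (C : d.-tuple R) (Rad : R) (f : (d.-1).-tuple R -> R)
    (Q : 'I_d -> probability (measurableTypeR R) R) (B : set (d.-tuple R)) : \bar R :=
  @cube_int (d.-1) (fun u =>
    ((f u)%:E * prodQ Q [set e | B (vadd C (vadd (vscale Rad (Sph u)) e))])%E).

Definition law_eq d (P1 P2 : set (d.-tuple R) -> \bar R) : Prop :=
  forall B : set (d.-tuple R), measurable B -> P1 B = P2 B.

Definition centered d (Q : 'I_d -> probability (measurableTypeR R) R) : Prop :=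
  forall j, (Q j).-integrable setT (fun x => x%:E) /\ (\int[Q j]_x x%:E = 0)%E.

End model.
Arguments cube {R} n.
Arguments cube_int {R} n g.
Arguments is_density {R} n f.
Arguments dens_eq {R} n f g.

(* Main.v *)
(** Absorb the centres into the noises and let [Z = R S(U)], [Z' = R' S(U')] be the
signals, with Laplace transforms [M], [M'] and marginals [M_j], [M'_j].  Equality of the
two laws and independence of the noise coordinates give, for characteristic functions near
[0] (where the noise does not vanish) and hence, the signals being bounded, for Laplace
transforms everywhere,
  [M(s) prod_j M'_j(s_j) = M'(s) prod_j M_j(s_j)].
Fix [j].  At a near-maximiser over [s_j = 0] of [ln M + ln M' - delta |s|^2] the
exponentially tilted coordinates other than the [j]-th have small variance, so on the sphere
the [j]-th one is nearly supported by two opposite points.  Letting [delta] tend to [0] shows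
that [M_j] and [M'_j] are proportional to transforms [m_j], [m'_j] of laws with at most two
atoms, whence [Z + B' = Z' + B] in law, with [B], [B'] finitely supported and independent of
the signals.  Spherical laws with a density in the angles charge neither hyperplanes nor a
sphere with another centre or radius, so restricting to one sphere gives [R = R'] and
[Z = Z'] in law; [S] is injective outside a null set, so the densities agree.  Finally the
characteristic function of a bounded signal is nonzero on a dense set, which identifies the
noise coordinates up to the shift of the centre. *)

Require Import Defs.
From HB Require Import structures.
From mathcomp Require Import all_boot all_order all_algebra.
From mathcomp Require Import all_classical all_reals all_analysis.
From mathcomp Require Import measurable_realfun ring lra complex.

Set Implicit Arguments.
Unset Strict Implicit.
Unset Printing Implicit Defensive.

Import Order.TTheory GRing.Theory Num.Theory.
Import numFieldNormedType.Exports.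
Local Open Scope classical_set_scope.
Local Open Scope ring_scope.

(** * Expectations of bounded functions *)

(** The noise need not have moments and its characteristic function may vanish, so it can be divided
    out only near frequency 0. Cross-multiplying with the one-coordinate identities removes it; what
    remains concerns bounded variables, whose Laplace transforms are finite and positive, so
    logarithms and quotients exist at every real point.

    Two atoms appear because fixing all coordinates but one on a sphere leaves two opposite values.
    Both signals must be concentrated by the same tilt [s]: only then do the other coordinates
    cancel in the quotient of the identity at [s + t e_j] by the identity at [s]. Hence the sum of
    the two logarithms is maximised, and [s_j = 0] keeps the tilt out of the [j]-th marginal. The
    near-maximisers may escape to infinity, so the limit is taken in the parameters of the two-point
    laws, which stay in a compact set.

    Transforms are compared through moments, in real variables: sines of small multiples give
    powers, power series give exponentials, and polynomials approximating a threshold give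
    distribution functions. *)

Section bounded_measurable.
Context d (T : measurableType d) (R : realType).
Implicit Types g h : T -> R.

(** Bounded everywhere rather than almost everywhere: integrability then holds for every probability
    at once, and no almost-everywhere side condition arises. *)
Definition bmf g := measurable_fun setT g /\ exists K : R, forall x, `|g x| <= K.

Lemma bmf_meas g : bmf g -> measurable_fun setT g. Proof. by case. Qed.

Lemma bmf_cst (c : R) : bmf (fun=> c).
Proof. by split; [exact: measurable_cst|exists `|c|]. Qed.

Lemma bmfD g h : bmf g -> bmf h -> bmf (fun x => g x + h x).
Proof.
move=> [mg [K gK]] [mh [L hL]]; split; first exact: measurable_funD.
by exists (K + L) => x; rewrite (le_trans (ler_normD _ _))// lerD.
Qed.

Lemma bmfM g h : bmf g -> bmf h -> bmf (fun x => g x * h x).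
Proof.
move=> [mg [K gK]] [mh [L hL]]; split; first exact: measurable_funM.
by exists (K * L) => x; rewrite normrM ler_pM.
Qed.

Lemma bmfZ (c : R) g : bmf g -> bmf (fun x => c * g x).
Proof. by move=> bg; apply: bmfM => //; exact: bmf_cst. Qed.

Lemma bmfN g : bmf g -> bmf (fun x => - g x).
Proof.
move=> bg; have := bmfZ (-1) bg.
by under [in X in X -> _]eq_fun do rewrite mulN1r.
Qed.

Lemma bmfB g h : bmf g -> bmf h -> bmf (fun x => g x - h x).
Proof. by move=> bg bh; apply: bmfD => //; exact: bmfN. Qed.

Lemma bmfX g n : bmf g -> bmf (fun x => g x ^+ n).
Proof.
move=> bg; elim: n => [|n ih].
  by under eq_fun do rewrite expr0; exact: bmf_cst.
by under eq_fun do rewrite exprS; exact: bmfM.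
Qed.

Lemma bmf_sum (I : Type) (r : seq I) (Q : pred I) (G : I -> T -> R) :
  (forall i, bmf (G i)) -> bmf (fun x => \sum_(i <- r | Q i) G i x).
Proof.
move=> bG; elim: r => [|i r ih].
  by under eq_fun do rewrite big_nil; exact: bmf_cst.
by under eq_fun do rewrite big_cons; case: (Q i) => //; exact: bmfD.
Qed.

Lemma bmf_prod (I : Type) (r : seq I) (G : I -> T -> R) :
  (forall i, bmf (G i)) -> bmf (fun x => \prod_(i <- r) G i x).
Proof.
move=> bG; elim: r => [|i r ih].
  by under eq_fun do rewrite big_nil; exact: bmf_cst.
by under eq_fun do rewrite big_cons; exact: bmfM.
Qed.

Lemma bmf_indic (A : set T) : measurable A -> bmf (\1_A : T -> R).
Proof.
move=> mA; split; first exact: measurable_indic.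
by exists 1 => x; rewrite indicE; case: (_ \in _); rewrite ?normr0 ?normr1.
Qed.

Lemma bmf_bool (f : T -> bool) : measurable_fun setT f -> bmf (fun x => (f x)%:R : R).
Proof.
move=> mf; split; last by exists 1 => x; case: (f x); rewrite ?normr0 ?normr1.
have -> : (fun x => (f x)%:R : R) = (fun x => if f x then 1 else 0).
  by apply/funext => x; case: (f x).
by apply: measurable_fun_ifT => //; exact: measurable_cst.
Qed.

Lemma bmf_abs g : bmf g -> bmf (fun x => `|g x|).
Proof.
move=> [mg [K gK]]; split; first exact: measurableT_comp.
by exists K => x; rewrite normr_id.
Qed.

Lemma bmf_expR g : bmf g -> bmf (fun x => expR (g x)).
Proof.
move=> [mg [K gK]]; split; first exact: measurableT_comp.
by exists (expR K) => x; rewrite ger0_norm ?expR_ge0// ler_expR (le_trans (ler_norm _)).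
Qed.

Lemma bmf_cos (f : T -> R) : measurable_fun setT f -> bmf (fun x => cos (f x)).
Proof.
move=> mf; split.
  by apply: measurableT_comp => //; apply: continuous_measurable_fun; exact: continuous_cos.
by exists 1 => x; rewrite ler_norml cos_geN1 cos_le1.
Qed.

Lemma bmf_sin (f : T -> R) : measurable_fun setT f -> bmf (fun x => sin (f x)).
Proof.
move=> mf; split.
  by apply: measurableT_comp => //; apply: continuous_measurable_fun; exact: continuous_sin.
by exists 1 => x; rewrite ler_norml sin_geN1 sin_le1.
Qed.

End bounded_measurable.

Lemma bmf_comp d d' (T : measurableType d) (T' : measurableType d') (R : realType)
    (f : T -> T') (g : T' -> R) :
  measurable_fun setT f -> bmf g -> bmf (fun x => g (f x)).
Proof.
move=> mf [mg [K gK]]; split; first exact: measurableT_comp.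
by exists K => x; exact: gK.
Qed.

Lemma cvg_eq_lim (R : realType) (u v : nat -> R) (a b : R) :
  (forall n, u n = v n) -> u n @[n --> \oo] --> a -> v n @[n --> \oo] --> b -> a = b.
Proof.
move=> /funext <- ua ub; exact: (cvg_unique _ ua ub).
Qed.

(** Real-valued, so that expectations enter ring identities directly. On [bmf] functions this is the
    true integral ([EFin_Ex]); elsewhere [Rintegral] may return its default value 0. *)
HB.lock Definition Ex d (T : measurableType d) (R : realType) (P : probability T R)
  (g : T -> R) : R := \int[P]_x g x.

Section expectation.
Context d (T : measurableType d) (R : realType) (P : probability T R).
Implicit Types g h : T -> R.

Lemma bmf_integrable g : bmf g -> P.-integrable setT (EFin \o g).
Proof.
move=> [mg [K gK]].
apply: (@le_integrable _ _ _ P setT measurableT _ (cst K%:E)) => //.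
- exact/measurable_EFinP.
- by move=> x _ /=; rewrite lee_fin (le_trans (gK x))// ler_norm.
- exact: finite_measure_integrable_cst.
Qed.

Lemma EFin_Ex g : bmf g -> (Ex P g)%:E = (\int[P]_x (g x)%:E)%E.
Proof.
move=> bg; rewrite Ex.unlock /Rintegral fineK//.
exact: (integrable_fin_num measurableT (bmf_integrable bg)).
Qed.

Lemma eq_Ex g h : (forall x, g x = h x) -> Ex P g = Ex P h.
Proof. by move=> gh; congr Ex; apply/funext. Qed.

Lemma ExD g h : bmf g -> bmf h -> Ex P (fun x => g x + h x) = Ex P g + Ex P h.
Proof. by move=> bg bh; rewrite Ex.unlock RintegralD//; exact: bmf_integrable. Qed.

Lemma ExB g h : bmf g -> bmf h -> Ex P (fun x => g x - h x) = Ex P g - Ex P h.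
Proof. by move=> bg bh; rewrite Ex.unlock RintegralB//; exact: bmf_integrable. Qed.

Lemma ExZ c g : bmf g -> Ex P (fun x => c * g x) = c * Ex P g.
Proof. by move=> bg; rewrite Ex.unlock RintegralZl//; exact: bmf_integrable. Qed.

Lemma ExZr c g : bmf g -> Ex P (fun x => g x * c) = Ex P g * c.
Proof. by move=> bg; rewrite Ex.unlock RintegralZr//; exact: bmf_integrable. Qed.

Lemma Ex_cst c : Ex P (fun=> c) = c.
Proof. by rewrite Ex.unlock Rintegral_cst//= probability_setT mulr1. Qed.

Lemma Ex_sum (I : Type) (r : seq I) (Q : pred I) (G : I -> T -> R) :
  (forall i, bmf (G i)) ->
  Ex P (fun x => \sum_(i <- r | Q i) G i x) = \sum_(i <- r | Q i) Ex P (G i).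
Proof.
move=> bG; elim: r => [|i r ih].
  by rewrite big_nil; under eq_Ex do rewrite big_nil; rewrite Ex_cst.
rewrite big_cons -ih; under eq_Ex do rewrite big_cons; case: (Q i) => //.
by rewrite ExD//; exact: bmf_sum.
Qed.

Lemma le_Ex g h : bmf g -> bmf h -> (forall x, g x <= h x) -> Ex P g <= Ex P h.
Proof. by move=> bg bh gh; rewrite Ex.unlock; apply: le_Rintegral => //; exact: bmf_integrable. Qed.

Lemma Ex_ge0 g : (forall x, 0 <= g x) -> 0 <= Ex P g.
Proof. by move=> g0; rewrite Ex.unlock; apply: Rintegral_ge0. Qed.

Lemma Ex_norm g K : bmf g -> (forall x, `|g x| <= K) -> `|Ex P g| <= K.
Proof.
move=> bg gK; rewrite ler_norml; apply/andP; split.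
  rewrite -(Ex_cst (- K)); apply: le_Ex => //; first exact: bmf_cst.
  by move=> x; have := gK x; rewrite ler_norml => /andP[].
rewrite -(Ex_cst K); apply: le_Ex => //; first exact: bmf_cst.
by move=> x; have := gK x; rewrite ler_norml => /andP[].
Qed.

Lemma prob_indic (A : set T) : measurable A -> P A = (\int[P]_x (\1_A x)%:E)%E.
Proof. by move=> mA; rewrite integral_indic// setIT. Qed.

Lemma Ex_indic (A : set T) : measurable A -> (Ex P \1_A)%:E = P A.
Proof.
move=> mA; rewrite EFin_Ex; last exact: bmf_indic.
by rewrite integral_indic// setIT.
Qed.

Lemma Ex_cvg (g_ : nat -> T -> R) g (K : R) :
  (forall n, measurable_fun setT (g_ n)) -> (forall n x, `|g_ n x| <= K) ->
  (forall x, g_ n x @[n --> \oo] --> g x) ->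
  Ex P (g_ n) @[n --> \oo] --> Ex P g.
Proof.
move=> mg gK gg.
have cE x : (g_ n x)%:E @[n --> \oo] --> (g x)%:E.
  by apply: cvg_EFin; [exact: nearW|exact: gg].
have mE n : measurable_fun setT (fun x => (g_ n x)%:E) by exact/measurable_EFinP.
have iK : P.-integrable setT (cst K%:E) by exact: finite_measure_integrable_cst.
have [ig _ cg] : [/\ P.-integrable setT (EFin \o g), _ & _] :=
  dominated_convergence measurableT mE (emeasurable_fun_cvg _ _ mE (fun x _ => cE x))
    (aeW P (fun x _ => cE x)) iK (aeW P (fun x n _ => gK n x)).
have fE := integrable_fin_num measurableT ig.
by rewrite Ex.unlock; apply: fine_cvg; rewrite /Rintegral fineK.
Qed.

End expectation.

Section product.
Context d1 d2 (T1 : measurableType d1) (T2 : measurableType d2) (R : realType).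
Variables (P1 : probability T1 R) (P2 : probability T2 R).
Implicit Types g : T1 * T2 -> R.

Lemma bmf_pair1 g x : bmf g -> bmf (fun y => g (x, y)).
Proof. by move=> bg; apply: (bmf_comp (pair1_measurable x) bg). Qed.

Lemma bmf_Ex g : bmf g -> bmf (fun x => Ex P2 (fun y => g (x, y))).
Proof.
move=> bg; split; last first.
  have [mg [K gK]] := bg; exists K => x.
  by apply: Ex_norm => //; exact: bmf_pair1.
rewrite Ex.unlock; apply: measurableT_comp => //.
exact: (measurable_fubini_F (bmf_integrable (P1 \x P2)%E bg)).
Qed.

Lemma Ex_prod g : bmf g -> Ex (P1 \x P2)%E g = Ex P1 (fun x => Ex P2 (fun y => g (x, y))).
Proof.
move=> bg; rewrite Ex.unlock /Rintegral -(integral12_prod_meas1 (bmf_integrable _ bg)).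
congr fine; apply: eq_integral => x _.
have := EFin_Ex P2 (bmf_pair1 x bg); rewrite Ex.unlock => ->.
by [].
Qed.

Lemma Ex_prodM (g : T1 -> R) (h : T2 -> R) : bmf g -> bmf h ->
  Ex (P1 \x P2)%E (fun z => g z.1 * h z.2) = Ex P1 g * Ex P2 h.
Proof.
move=> bg bh; rewrite Ex_prod; last by apply: bmfM; exact: bmf_comp.
by rewrite -ExZr//; apply: eq_Ex => x /=; rewrite ExZ.
Qed.

End product.

Section pushforward.
Context d1 d2 (T1 : measurableType d1) (T2 : measurableType d2) (R : realType).
Variables (P : probability T1 R) (f : T1 -> T2).
Hypothesis mf : measurable_fun setT f.

Lemma exists_pushforward : exists Q : probability T2 R,
  (forall A, measurable A -> Q A = P (f @^-1` A)) /\
  (forall g : T2 -> R, bmf g -> Ex Q g = Ex P (fun x => g (f x))) /\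
  (forall g : T2 -> \bar R, measurable_fun setT g -> (forall y, 0 <= g y)%E ->
     (\int[Q]_y g y = \int[P]_x g (f x))%E).
Proof.
pose mf' : {mfun T1 >-> T2} := HB.pack f (isMeasurableFun.Build _ _ _ _ _ mf).
exists (distribution P mf'); split => //; split.
  move=> g bg; rewrite Ex.unlock /Rintegral; congr fine.
  by rewrite integral_distribution//; [exact/measurable_EFinP/bmf_meas|exact/bmf_integrable/bmf_comp].
by move=> g mg g0; rewrite ge0_integral_distribution.
Qed.

End pushforward.

(** * Characteristic functions and moments *)

Section trigonometric_transfer.
Context d1 d2 (T1 : measurableType d1) (T2 : measurableType d2) (R : realType).
Variables (P1 : probability T1 R) (P2 : probability T2 R).
Variables (W1 : T1 -> R) (W2 : T2 -> R) (a1 a2 : R).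
Hypotheses (mW1 : measurable_fun setT W1) (mW2 : measurable_fun setT W2).

Lemma measurable_affine d (T : measurableType d) (W : T -> R) (t b : R) :
  measurable_fun setT W -> measurable_fun setT (fun x => t * W x + b).
Proof.
move=> mW; apply: measurable_funD => //; apply: measurable_funM => //.
Qed.

Lemma bmf_trig d (T : measurableType d) (W : T -> R) (t b l a : R) n :
  measurable_fun setT W ->
  bmf (fun x => cos (t * W x + b) * sin (l * W x + a) ^+ n).
Proof.
move=> mW; apply: bmfM; first exact/bmf_cos/measurable_affine.
exact/bmfX/bmf_sin/measurable_affine.
Qed.

(** [cos A * sin B] is half of [sin (A + B) - sin (A - B)]; writing each sine as a cosine delayed by
    [pi / 2] stays in the family [cos (t W + b)], with one power of the sine fewer. *)
Lemma Ex_trigS d (T : measurableType d) (P : probability T R) (W : T -> R)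
    (t b l a : R) n : measurable_fun setT W ->
  Ex P (fun x => cos (t * W x + b) * sin (l * W x + a) ^+ n.+1) =
  2^-1 * (Ex P (fun x => cos ((t + l) * W x + (b + a - pi / 2)) * sin (l * W x + a) ^+ n) -
          Ex P (fun x => cos ((t - l) * W x + (b - a - pi / 2)) * sin (l * W x + a) ^+ n)).
Proof.
move=> mW; rewrite -ExB; [|exact: bmf_trig|exact: bmf_trig].
rewrite -ExZ; last by apply: bmfB; exact: bmf_trig.
apply: eq_Ex => x; rewrite exprS mulrA.
have -> : (t + l) * W x + (b + a - pi / 2) = (t * W x + b) + (l * W x + a) - pi / 2 by ring.
have -> : (t - l) * W x + (b - a - pi / 2) = (t * W x + b) - (l * W x + a) - pi / 2 by ring.
move: (t * W x + b) (l * W x + a) => A B.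
by rewrite !cosBpihalf sinD sinB; field.
Qed.

(* [sin^n] is a trigonometric polynomial, so the hypothesis on an interval of frequencies
   passes to it; dividing by [l ^ n] and letting [l] tend to [0] will give moments. *)
Lemma trig_pow (t0 delta : R) :
  (forall t b, `|t - t0| < delta ->
    a1 * Ex P1 (fun x => cos (t * W1 x + b)) = a2 * Ex P2 (fun x => cos (t * W2 x + b))) ->
  forall n l a t b, `|t - t0| + n%:R * `|l| < delta ->
    a1 * Ex P1 (fun x => cos (t * W1 x + b) * sin (l * W1 x + a) ^+ n) =
    a2 * Ex P2 (fun x => cos (t * W2 x + b) * sin (l * W2 x + a) ^+ n).
Proof.
move=> H; elim=> [|n IH] l a t b tl.
  under eq_Ex do rewrite expr0 mulr1.
  under [X in _ = _ * X]eq_Ex do rewrite expr0 mulr1.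
  by apply: H; rewrite mul0r addr0 in tl.
(* Each sine factor removed moves the frequency by [|l|]; the margin in the hypothesis pays for
   exactly that. *)
have bound (s : R) : `|s| = `|l| -> `|(t + s) - t0| + n%:R * `|l| < delta.
  move=> sl; apply: le_lt_trans tl; rewrite -natr1 mulrDl mul1r.
  have := ler_normD (t - t0) s; rewrite sl.
  have -> : t + s - t0 = t - t0 + s by ring.
  lra.
rewrite !Ex_trigS// !(mulrCA _ 2^-1) !mulrBr.
rewrite IH; last exact: bound.
by congr (_ - 2^-1 * _); apply: IH; apply: bound; rewrite normrN.
Qed.

End trigonometric_transfer.

(** * Polynomial approximation of a threshold *)

Section elementary_limits.
Context (R : realType).
Implicit Types u x h : R.

Lemma bernoulli_ineq h n : 0 <= h -> 1 + n%:R * h <= (1 + h) ^+ n.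
Proof.
move=> h0; elim: n => [|n IH]; first by rewrite mul0r addr0 expr0.
rewrite exprS -natr1.
have : 0 <= n%:R * h * h by rewrite !mulr_ge0.
nra.
Qed.

Lemma bernoulli_ineqB h n : 0 <= h <= 1 -> 1 - n%:R * h <= (1 - h) ^+ n.
Proof.
move=> /andP[h0 h1]; elim: n => [|n IH]; first by rewrite mul0r subr0 expr0.
rewrite exprS -natr1.
have : 0 <= n%:R * h * h by rewrite !mulr_ge0.
nra.
Qed.

(** Write [x ^+ n] as [z ^+ n * (x / z) ^+ n] with [z] midway between [x] and 1: Bernoulli bounds
    [n%:R * z ^+ n], and the second factor decays geometrically. *)
Lemma cvg_nat_geometric x : 0 <= x < 1 -> n%:R * x ^+ n @[n --> \oo] --> (0 : R).
Proof.
move=> /andP[x0 x1]; pose z := (x + 1) / 2.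
have z0 : 0 < z by rewrite /z; lra.
have z1 : z < 1 by rewrite /z; lra.
have xz : x < z by rewrite /z; lra.
pose h := z^-1 - 1.
have h0 : 0 < h by rewrite /h subr_gt0 invf_gt1.
have nz n : n%:R * z ^+ n <= h^-1.
  rewrite -ler_pdivlMr ?exprn_gt0// -exprVn.
  have -> : z^-1 = 1 + h by rewrite /h; ring.
  rewrite ler_pdivlMl// mulrC; apply: le_trans (bernoulli_ineq n (ltW h0)); lra.
have g0 : (h^-1 * (x / z) ^+ n) @[n --> \oo] --> (0 : R).
  have lt : `|x / z| < 1.
    have q0 : 0 <= x / z by apply: divr_ge0 => //; exact: ltW.
    by rewrite ger0_norm// ltr_pdivrMr// mul1r.
  exact: (cvg_geometric h^-1 lt).
apply: (squeeze_cvgr _ (cvg_cst (0 : R)) g0); apply: nearW => n; apply/andP; split.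
  by rewrite mulr_ge0// exprn_ge0.
rewrite expr_div_n mulrA ler_pdivlMr ?exprn_gt0// -mulrA (mulrC (x ^+ n)) mulrA.
by rewrite ler_wpM2r ?exprn_ge0.
Qed.

(** If [u < 1/2], Bernoulli gives the lower bound [1 - n (2 u)^n]. If [u >= 1/2], put
    [y = 2^-n <= u^n] and [N = n 2^n]: then [(1 - y)^N <= 1 / (1 + y)^N <= 1 / (n + 1)], because
    [N y = n]. The factor [n] in the exponent forces the limit 0 at [u = 1/2] itself. *)
Lemma cvg_threshold u : 0 <= u <= 1 ->
  (1 - u ^+ n) ^+ (n * 2 ^ n) @[n --> \oo] --> ((u < 2^-1)%R%:R : R).
Proof.
move=> /andP[u0 u1].
have un n : 0 <= u ^+ n <= 1 by rewrite exprn_ge0//= exprn_ile1.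
have ub n : 0 <= (1 - u ^+ n) ^+ (n * 2 ^ n) <= 1.
  have /andP[? ?] := un n.
  by rewrite exprn_ge0 ?subr_ge0//= exprn_ile1 ?subr_ge0// lerBlDr lerDl.
case: ltP => uh; rewrite ?mulr1n ?mulr0n.
  have c : 1 - n%:R * (2 * u) ^+ n @[n --> \oo] --> (1 : R).
    rewrite -[X in _ --> X]subr0; apply: cvgB; first exact: cvg_cst.
    by apply: cvg_nat_geometric; lra.
  apply: (squeeze_cvgr _ c (cvg_cst (1 : R))); apply: nearW => n.
  have /andP[_ ->] := ub n; rewrite andbT.
  apply: le_trans (bernoulli_ineqB _ (un n)).
  by rewrite lerD2l lerN2 natrM natrX exprMn mulrA.
have c : n.+1%:R^-1 @[n --> \oo] --> (0 : R) by exact: cvg_harmonic.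
apply: (squeeze_cvgr _ (cvg_cst (0 : R)) c); apply: nearW => n.
have /andP[-> _] := ub n => /=.
set N := (n * 2 ^ n)%N; set y : R := 2^-1 ^+ n.
have y0 : 0 <= y by rewrite exprn_ge0.
have y1 : y <= 1 by rewrite exprn_ile1// ?invr_ge0// invf_le1 ?ler1n.
have yu : y <= u ^+ n by rewrite lerXn2r// ?nnegrE.
apply: (@le_trans _ _ ((1 - y) ^+ N)).
  have /andP[? ?] := un n.
  by rewrite lerXn2r ?nnegrE ?subr_ge0// lerD2l lerN2.
have Ny : N%:R * y = n%:R.
  by rewrite /N /y natrM natrX -mulrA -exprMn mulfV ?expr1n ?mulr1// pnatr_eq0.
have b := bernoulli_ineq N y0; rewrite Ny nat1r in b.
rewrite -[leRHS]mul1r ler_pdivlMr//.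
apply: (@le_trans _ _ ((1 - y) ^+ N * (1 + y) ^+ N)).
  by rewrite ler_wpM2l// exprn_ge0 ?subr_ge0.
rewrite -exprMn exprn_ile1//; nra.
Qed.

End elementary_limits.

Section threshold.
Context d1 d2 (T1 : measurableType d1) (T2 : measurableType d2) (R : realType).
Variables (P1 : probability T1 R) (P2 : probability T2 R) (I : finType).
Variables (u1 : I -> T1 -> R) (u2 : I -> T2 -> R).
Hypotheses (mu1 : forall i, measurable_fun setT (u1 i)) (mu2 : forall i, measurable_fun setT (u2 i)).
Hypotheses (u01 : forall i x, 0 <= u1 i x <= 1) (u02 : forall i x, 0 <= u2 i x <= 1).
Hypothesis mom : forall e : I -> nat,
  Ex P1 (fun x => \prod_i u1 i x ^+ e i) = Ex P2 (fun x => \prod_i u2 i x ^+ e i).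

Lemma bmf01 d (T : measurableType d) (u : T -> R) :
  measurable_fun setT u -> (forall x, 0 <= u x <= 1) -> bmf u.
Proof.
move=> mu u0; split => //; exists 1 => x; have /andP[? ?] := u0 x.
by rewrite ger0_norm.
Qed.

Let Ex_expand d (T : measurableType d) (P : probability T R) (u : I -> T -> R) n N :
  (forall i, bmf (u i)) ->
  Ex P (fun x => \prod_i (1 - u i x ^+ n) ^+ N) =
  \sum_(f : {ffun I -> 'I_N.+1}) (\prod_i ((-1) ^+ f i *+ 'C(N, f i))) *
    Ex P (fun x => \prod_i u i x ^+ (n * f i)).
Proof.
move=> bu; have b f : bmf (fun x => \prod_i u i x ^+ (n * f i)).
  by apply: bmf_prod => i; exact: bmfX.
under eq_bigr do rewrite -ExZ//; rewrite -Ex_sum; last by move=> f; exact: bmfZ.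
apply: eq_Ex => x; under eq_bigr do rewrite exprBn.
rewrite bigA_distr_bigA /=; apply: eq_bigr => f _; rewrite -big_split/=.
by apply: eq_bigr => i _; rewrite expr1n mulr1 -exprM mulrnAl.
Qed.

Let cvg_Ex_threshold d (T : measurableType d) (P : probability T R) (u : I -> T -> R) :
  (forall i, measurable_fun setT (u i)) -> (forall i x, 0 <= u i x <= 1) ->
  Ex P (fun x => \prod_i (1 - u i x ^+ n) ^+ (n * 2 ^ n)) @[n --> \oo] -->
  Ex P (fun x => \prod_i (u i x < 2^-1)%R%:R).
Proof.
move=> mu u0; have bu i : bmf (u i) by exact: bmf01.
apply: (Ex_cvg (K := 1)).
- move=> n; apply: bmf_meas; apply: bmf_prod => i; apply: bmfX; apply: bmfB.
    exact: bmf_cst.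
  exact: bmfX.
- move=> n x; rewrite normr_prod; apply: prodr_ile1 => i _.
  have /andP[? ?] := u0 i x; rewrite normr_ge0/= normrX exprn_ile1//.
  by rewrite ger0_norm ?subr_ge0 ?exprn_ile1// lerBlDr lerDl exprn_ge0.
- move=> x; apply: cvg_big => [|i _]; last exact: cvg_threshold.
  exact: mul_continuous.
Qed.

(** The polynomials of [cvg_threshold], one per variable, multiply out to a finite combination of
    the monomials in [mom]; dominated convergence then turns them into indicators. *)
Lemma Ex_threshold :
  Ex P1 (fun x => \prod_i (u1 i x < 2^-1)%R%:R) = Ex P2 (fun x => \prod_i (u2 i x < 2^-1)%R%:R).
Proof.
apply: (cvg_eq_lim _ (cvg_Ex_threshold mu1 u01) (cvg_Ex_threshold mu2 u02)) => n.
rewrite !Ex_expand; [|by move=> i; exact: bmf01..].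
by apply: eq_bigr => f _; rewrite mom.
Qed.

End threshold.

Section levy.
Context d1 d2 (T1 : measurableType d1) (T2 : measurableType d2) (R : realType).
Variables (P1 : probability T1 R) (P2 : probability T2 R).
Variables (W1 : T1 -> R) (W2 : T2 -> R).
Hypotheses (mW1 : measurable_fun setT W1) (mW2 : measurable_fun setT W2).
Hypothesis H : forall t b,
  Ex P1 (fun x => cos (t * W1 x + b)) = Ex P2 (fun x => cos (t * W2 x + b)).

(* [u < 1/2] iff [sin (l (W - a)) < 0], which tends to [W < a] as [l] tends to [0]. *)
Let u d (T : measurableType d) (W : T -> R) (l a : R) x := (1 + sin (l * W x + - (l * a))) / 2.

Let u01 d (T : measurableType d) (W : T -> R) (l a : R) x : 0 <= u W l a x <= 1.
Proof.
by rewrite /u; have := sin_le1 (l * W x + - (l * a)); have := sin_geN1 (l * W x + - (l * a)); lra.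
Qed.

Let mu d (T : measurableType d) (W : T -> R) (l a : R) :
  measurable_fun setT W -> measurable_fun setT (u W l a).
Proof.
move=> mW; apply: measurable_funM => //; apply: measurable_funD => //.
exact/bmf_meas/bmf_sin/measurable_affine.
Qed.

Let Ex_sin_pow l a n : Ex P1 (fun x => sin (l * W1 x + a) ^+ n) = Ex P2 (fun x => sin (l * W2 x + a) ^+ n).
Proof.
(* All frequencies are available here, so the radius is taken just above [n * |l|]; centre frequency
   0 reduces the cosine factor to 1. *)
have := @trig_pow _ _ _ _ _ P1 P2 W1 W2 1 1 mW1 mW2 0 (n%:R * `|l| + 1) _ n l a 0 0.
rewrite !mul1r => E.
transitivity (Ex P1 (fun x => cos (0 * W1 x + 0) * sin (l * W1 x + a) ^+ n)).
  by apply: eq_Ex => x; rewrite mul0r addr0 cos0 mul1r.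
rewrite E; last 2 first.
- by move=> t b _; rewrite !mul1r.
- by rewrite subr0 normr0 add0r ltrDl.
by apply: eq_Ex => x; rewrite mul0r addr0 cos0 mul1r.
Qed.

Let Ex_u_pow l a n : Ex P1 (fun x => u W1 l a x ^+ n) = Ex P2 (fun x => u W2 l a x ^+ n).
Proof.
have E d (T : measurableType d) (P : probability T R) (W : T -> R) :
    measurable_fun setT W -> Ex P (fun x => u W l a x ^+ n) =
    \sum_(i < n.+1) (2^-1 ^+ n *+ 'C(n, i)) * Ex P (fun x => sin (l * W x + - (l * a)) ^+ i).
  move=> mW.
  have b (i : nat) : bmf (fun x => sin (l * W x + - (l * a)) ^+ i).
    exact/bmfX/bmf_sin/measurable_affine.
  under eq_bigr do rewrite -ExZ//; rewrite -Ex_sum; last by move=> i; exact: bmfZ.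
  apply: eq_Ex => x; rewrite /u exprMn exprDn mulr_suml; apply: eq_bigr => i _.
  by rewrite expr1n mul1r mulrnAl mulrnAl mulrC.
by rewrite !E//; apply: eq_bigr => i _; rewrite Ex_sin_pow.
Qed.

Let Ex_sin_lt0 l a : Ex P1 (fun x => (sin (l * W1 x + - (l * a)) < 0)%R%:R) =
  Ex P2 (fun x => (sin (l * W2 x + - (l * a)) < 0)%R%:R).
Proof.
have := @Ex_threshold _ _ _ _ _ P1 P2 unit (fun=> u W1 l a) (fun=> u W2 l a)
  (fun=> mu l a mW1) (fun=> mu l a mW2) (fun=> u01 W1 l a) (fun=> u01 W2 l a).
have E d (T : measurableType d) (P : probability T R) (W : T -> R) :
    Ex P (fun x => (sin (l * W x + - (l * a)) < 0)%R%:R) =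
    Ex P (fun x => \prod_(i : unit) (u W l a x < 2^-1)%R%:R).
  apply: eq_Ex => x; rewrite (big_pred1 tt)/=; last by case.
  by congr (nat_of_bool _)%:R; rewrite /u; apply/idP/idP; lra.
rewrite !E; apply => e.
under eq_Ex => x do (rewrite (big_pred1 tt)/=; last by case).
under [RHS]eq_Ex => x do (rewrite (big_pred1 tt)/=; last by case).
exact: Ex_u_pow.
Qed.

Let cvg_sin_lt0 (w a : R) :
  ((sin (k.+1%:R^-1 * w + - (k.+1%:R^-1 * a)) < 0)%R%:R : R) @[k --> \oo] --> ((w < a)%R%:R : R).
Proof.
have c : k.+1%:R^-1 * w + - (k.+1%:R^-1 * a) @[k --> \oo] --> (0 : R).
  have -> : (0 : R) = 0 * w + - (0 * a) by ring.
  by apply: cvgD; [|apply: cvgN]; apply: cvgMr_tmp; exact: cvg_harmonic.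
have [c1 c2] : (\forall k \near \oo, k.+1%:R^-1 * w + - (k.+1%:R^-1 * a) < pi :> R) /\
    (\forall k \near \oo, - pi < k.+1%:R^-1 * w + - (k.+1%:R^-1 * a) :> R).
  split; [apply: (cvgr_lt 0)|apply: (cvgr_gt 0)] => //; rewrite ?oppr_lt0; exact: pi_gt0.
apply: cvg_near_cst; near=> k.
have h1 : k.+1%:R^-1 * w + - (k.+1%:R^-1 * a) < pi by near: k.
have h2 : - pi < k.+1%:R^-1 * w + - (k.+1%:R^-1 * a) by near: k.
congr (_%:R); congr nat_of_bool.
rewrite -mulrN -mulrDr in h1 h2 *.
have k0 : 0 < k.+1%:R^-1 :> R by rewrite invr_gt0.
have [wa|wa] := ltP w a.
  rewrite -oppr_gt0 -sinN; apply: sin_gt0_pi; rewrite ltrNl h2 andbT oppr_gt0.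
  by rewrite pmulr_rlt0// subr_lt0.
apply/negbTE; rewrite -leNgt; apply: sin_ge0_pi; rewrite (ltW h1) andbT.
by rewrite mulr_ge0 ?(ltW k0)// subr_ge0.
Unshelve. all: by end_near.
Qed.

(** Uniqueness without an inversion formula and without moments of [W]: at each fixed [l] only
    moments of a bounded function of [W] are compared, and for small [l] the angle [l (W - a)] lies
    in [(- pi, pi)], where the sign of its sine is that of [W - a]. *)
Lemma levy_lt (a : R) : Ex P1 (fun x => (W1 x < a)%R%:R) = Ex P2 (fun x => (W2 x < a)%R%:R).
Proof.
have c d (T : measurableType d) (P : probability T R) (W : T -> R) : measurable_fun setT W ->
    Ex P (fun x => (sin (k.+1%:R^-1 * W x + - (k.+1%:R^-1 * a)) < 0)%R%:R) @[k --> \oo] -->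
    Ex P (fun x => (W x < a)%R%:R).
  move=> mW; apply: (Ex_cvg (K := 1)).
  - move=> n; apply/bmf_meas/bmf_bool/measurable_fun_ltr => //.
    exact/bmf_meas/bmf_sin/measurable_affine.
  - by move=> n x; case: (_ < _)%R; rewrite ?normr1 ?normr0.
  - by move=> x; exact: cvg_sin_lt0.
by apply: (cvg_eq_lim _ (c _ _ P1 _ mW1) (c _ _ P2 _ mW2)) => n; exact: Ex_sin_lt0.
Qed.

End levy.

Section sine_quotient.
Context (R : realType).

Lemma norm_sin_le (y : R) : `|sin y| <= `|y|.
Proof.
wlog y0 : y / 0 < y => [H|].
  have [/H //|y0|<-] := ltgtP 0 y; last by rewrite sin0.
  by rewrite -(normrN y) -(normrN (sin y)) -sinN; apply: H; rewrite oppr_gt0.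
have [c _] : exists2 c : R, c \in `]0, y[ & sin y - sin 0 = cos c * (y - 0).
  by apply: MVT => //; apply: continuous_subspaceT; exact: continuous_sin.
rewrite sin0 !subr0 => ->; rewrite normrM ler_piMl//.
by rewrite ler_norml cos_geN1 cos_le1.
Qed.

Lemma cvg_sin_quotient (c w : R) : 0 < c ->
  sin (c / k.+1%:R * w) / (c / k.+1%:R) @[k --> \oo] --> w.
Proof.
move=> c0.
have D : is_derive (0 : R) 1 (@sin R) 1 by apply: is_derive_eq; rewrite cos0.
have c1 : h^-1 *: ((@sin R \o shift 0) (h *: 1) - sin 0) @[h --> 0^'] --> (1 : R).
  by rewrite -[X in _ --> X](@derive_val _ _ _ _ _ _ _ D); exact: (@ex_derive _ _ _ _ _ _ _ D).
have [->|w0] := eqVneq w 0.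
  by under eq_fun do rewrite mulr0 sin0 mul0r; exact: cvg_cst.
have l0 k : c / k.+1%:R != 0 by rewrite mulf_neq0 ?invr_eq0 ?pnatr_eq0 ?gt_eqF.
have /cvgr_dnbhsP/(_ (fun k => c / k.+1%:R * w)) := c1.
have u0 : (forall k, c / k.+1%:R * w != 0) /\ c / k.+1%:R * w @[k --> \oo] --> (0 : R).
  split; first by move=> k; rewrite mulf_neq0.
  rewrite -(mul0r w); apply: cvgMr_tmp; rewrite -(mulr0 c); apply: cvgMl_tmp.
  exact: cvg_harmonic.
move=> /(_ u0) /= /(@cvgMr_tmp _ _ _ _ _ _ w); rewrite mul1r.
apply: cvg_trans; apply: near_eq_cvg; apply: nearW => k /=.
rewrite addr0 sin0 subr0 /GRing.scale/= mulr1; field.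
by rewrite w0 andbT nat1r pnatr_eq0 (gt_eqF c0).
Qed.

End sine_quotient.

Section moments.
Context d1 d2 (T1 : measurableType d1) (T2 : measurableType d2) (R : realType).
Variables (P1 : probability T1 R) (P2 : probability T2 R).
Variables (W1 : T1 -> R) (W2 : T2 -> R) (a1 a2 : R).
Hypotheses (bW1 : bmf W1) (bW2 : bmf W2).

Lemma trig_moments (t0 delta : R) : 0 < delta ->
  (forall t b, `|t - t0| < delta ->
    a1 * Ex P1 (fun x => cos (t * W1 x + b)) = a2 * Ex P2 (fun x => cos (t * W2 x + b))) ->
  forall n b,
    a1 * Ex P1 (fun x => cos (t0 * W1 x + b) * W1 x ^+ n) =
    a2 * Ex P2 (fun x => cos (t0 * W2 x + b) * W2 x ^+ n).
Proof.
(* With this [c], [n * l k < delta] for every [k], so [trig_pow] never leaves the interval of known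
   frequencies. *)
move=> dl0 H n b; pose c := delta / n.+1%:R; pose l (k : nat) : R := c / k.+1%:R.
have c0 : 0 < c by rewrite divr_gt0.
have l0 k : 0 < l k by rewrite divr_gt0.
have cv d (T : measurableType d) (P : probability T R) (W : T -> R) : bmf W ->
    Ex P (fun x => (l k)^-1 ^+ n * (cos (t0 * W x + b) * sin (l k * W x + 0) ^+ n)) @[k --> \oo] -->
    Ex P (fun x => cos (t0 * W x + b) * W x ^+ n).
  move=> [mW [K WK]]; apply: (Ex_cvg (K := K ^+ n)).
  - by move=> k; apply/bmf_meas/bmfZ/bmf_trig.
  - move=> k x; rewrite mulrCA -exprMn normrM -[leRHS]mul1r ler_pM//.
      by rewrite ler_norml cos_geN1 cos_le1.
    rewrite normrX lerXn2r ?nnegrE//; first by rewrite (le_trans _ (WK x)).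
    rewrite addr0 normrM normfV (gtr0_norm (l0 k)) ler_pdivrMl//.
    apply: le_trans (norm_sin_le _) _; rewrite normrM (gtr0_norm (l0 k)).
    by rewrite ler_wpM2l// ltW.
  - move=> x; under eq_fun do rewrite mulrCA -exprMn addr0.
    apply: cvgMl_tmp.
    apply: (@cvg_comp _ _ _ (fun k => (l k)^-1 * sin (l k * W x)) (fun y => y ^+ n));
      last exact: exprn_continuous.
    by under eq_fun do rewrite mulrC; exact: cvg_sin_quotient.
apply: (cvg_eq_lim _ (cvgMl_tmp (cv _ _ P1 W1 bW1)) (cvgMl_tmp (cv _ _ P2 W2 bW2))) => k /=.
have bt := bmf_trig t0 b (l k) 0 n.
rewrite !ExZ; [|exact: bt bW2.1|exact: bt bW1.1].
rewrite mulrCA [RHS]mulrCA; congr (_ * _).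
apply: (trig_pow bW1.1 bW2.1 H); rewrite subrr normr0 add0r (gtr0_norm (l0 k)).
rewrite /l /c !mulrA !ltr_pdivrMr// -!natr1.
have k0 : 0 <= k%:R :> R by []; have n0 : 0 <= n%:R :> R by [].
have : 0 <= delta * k%:R by rewrite mulr_ge0// ltW.
have : 0 <= delta * k%:R * n%:R by rewrite !mulr_ge0// ltW.
lra.
Qed.

(** Coefficients dominated by those of the exponential bound all partial sums by [expR K], so the
    series may be summed under the expectation. It serves [expR], [cos] and [sin]. *)
Lemma series_moments (g1 : T1 -> R) (g2 : T2 -> R) (c : nat -> R) (F : R -> R) :
  bmf g1 -> bmf g2 -> (forall k, `|c k| <= k`!%:R^-1) ->
  (forall x, (\sum_(k < n) c k * x ^+ k) @[n --> \oo] --> F x) ->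
  (forall n, a1 * Ex P1 (fun x => g1 x * W1 x ^+ n) = a2 * Ex P2 (fun x => g2 x * W2 x ^+ n)) ->
  a1 * Ex P1 (fun x => g1 x * F (W1 x)) = a2 * Ex P2 (fun x => g2 x * F (W2 x)).
Proof.
move=> bg1 bg2 ck cF H.
have cv d (T : measurableType d) (P : probability T R) (W g : T -> R) : bmf W -> bmf g ->
    Ex P (fun x => g x * \sum_(k < n) c k * W x ^+ k) @[n --> \oo] -->
    Ex P (fun x => g x * F (W x)).
  move=> bW bg; have [mW [K WK]] := bW; have [mg [L gL]] := bg.
  apply: (Ex_cvg (K := L * expR K)).
  - move=> n; apply/bmf_meas/bmfM => //; apply: bmf_sum => k; apply: bmfZ; exact: bmfX.
  - move=> n x; rewrite normrM ler_pM//.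
    apply: (le_trans (ler_norm_sum _ _ _)).
    apply: (@le_trans _ _ (series (exp_coeff `|W x|) n)).
      rewrite /series/= big_mkord; apply: ler_sum => k _.
      by rewrite exp_coeffE normrM normrX ler_wpM2r// exprn_ge0.
    apply: (@le_trans _ _ (expR `|W x|)); last by rewrite ler_expR.
    rewrite /expR; apply: nondecreasing_cvgn_le; last exact: is_cvg_series_exp_coeff.
    by apply: nondecreasing_series => k _ _; exact: exp_coeff_ge0.
  - by move=> x; apply: cvgMl_tmp; exact: cF.
apply: (cvg_eq_lim _ (cvgMl_tmp (cv _ _ P1 _ _ bW1 bg1)) (cvgMl_tmp (cv _ _ P2 _ _ bW2 bg2))) => n /=.
have E d (T : measurableType d) (P : probability T R) (W g : T -> R) : bmf W -> bmf g ->
  Ex P (fun x => g x * \sum_(k < n) c k * W x ^+ k) = \sum_(k < n) c k * Ex P (fun x => g x * W x ^+ k).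
  move=> bW bg; have b k : bmf (fun x => g x * W x ^+ k) by apply: bmfM => //; exact: bmfX.
  under [RHS]eq_bigr do rewrite -ExZ//; rewrite -Ex_sum; last by move=> i; exact: bmfZ.
  by apply: eq_Ex => x; rewrite mulr_sumr; apply: eq_bigr => i _; rewrite mulrCA.
rewrite !E// !mulr_sumr; apply: eq_bigr => k _; rewrite mulrCA [RHS]mulrCA.
by rewrite H.
Qed.

End moments.

Section entire_series.
Context (R : realType).

Lemma cvg_exp_series (x : R) : (\sum_(k < n) k`!%:R^-1 * x ^+ k) @[n --> \oo] --> expR x.
Proof.
have c := is_cvg_series_exp_coeff x; rewrite exp_coeffE in c.
rewrite expRE.
by under eq_fun do rewrite -(big_mkord xpredT (fun k => k`!%:R^-1 * x ^+ k)).
Qed.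

Definition cosc k : R := (~~ odd k)%:R * (-1) ^+ k./2 / k`!%:R.
Definition sinc k : R := (odd k)%:R * (-1) ^+ k.-1./2 / k`!%:R.

Lemma cosc_le k : `|cosc k| <= k`!%:R^-1.
Proof.
rewrite /cosc normrM normfV normrM normrX normrN1 expr1n mulr1 !normr_nat.
by rewrite ler_piMl//; case: (odd k).
Qed.

Lemma sinc_le k : `|sinc k| <= k`!%:R^-1.
Proof.
rewrite /sinc normrM normfV normrM normrX normrN1 expr1n mulr1 !normr_nat.
by rewrite ler_piMl//; case: (odd k).
Qed.

Lemma cvg_cos_series (x : R) : (\sum_(k < n) cosc k * x ^+ k) @[n --> \oo] --> cos x.
Proof.
rewrite cos.unlock; have := @is_cvg_series_cos_coeff _ x.
rewrite cos_coeffE => c.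
by under eq_fun do rewrite -(big_mkord xpredT (fun k => cosc k * x ^+ k)).
Qed.

Lemma cvg_sin_series (x : R) : (\sum_(k < n) sinc k * x ^+ k) @[n --> \oo] --> sin x.
Proof.
rewrite sin.unlock; have := @is_cvg_series_sin_coeff _ x.
rewrite sin_coeffE => c.
by under eq_fun do rewrite -(big_mkord xpredT (fun k => sinc k * x ^+ k)).
Qed.

End entire_series.

(** Frequencies near 0 already determine all moments of a bounded variable, and the moments sum to
    its Laplace transform. The hypothesis is local because the noise can be cancelled only near
    0. *)
Lemma laplace_of_charfun d1 d2 (T1 : measurableType d1) (T2 : measurableType d2) (R : realType)
    (P1 : probability T1 R) (P2 : probability T2 R) (W1 : T1 -> R) (W2 : T2 -> R) (delta : R) :
  bmf W1 -> bmf W2 -> 0 < delta ->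
  (forall t b, `|t| < delta ->
    Ex P1 (fun x => cos (t * W1 x + b)) = Ex P2 (fun x => cos (t * W2 x + b))) ->
  Ex P1 (fun x => expR (W1 x)) = Ex P2 (fun x => expR (W2 x)).
Proof.
move=> bW1 bW2 dl0 H.
have M n : 1 * Ex P1 (fun x => 1 * W1 x ^+ n) = 1 * Ex P2 (fun x => 1 * W2 x ^+ n).
  have := @trig_moments _ _ _ _ _ P1 P2 _ _ 1 1 bW1 bW2 0 delta dl0 _ n 0.
  have E d (T : measurableType d) (P : probability T R) (W : T -> R) :
      Ex P (fun x => cos (0 * W x + 0) * W x ^+ n) = Ex P (fun x => 1 * W x ^+ n).
    by apply: eq_Ex => x; rewrite mul0r addr0 cos0.
  rewrite !E.
  by apply => t b; rewrite subr0 !mul1r; exact: H.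
have := @series_moments _ _ _ _ _ P1 P2 _ _ 1 1 bW1 bW2 _ _ (fun k => k`!%:R^-1) (@expR R)
  (bmf_cst _ 1) (bmf_cst _ 1) _ _ M.
have E d (T : measurableType d) (P : probability T R) (W : T -> R) :
    Ex P (fun x => 1 * expR (W x)) = Ex P (fun x => expR (W x)).
  by apply: eq_Ex => x; rewrite mul1r.
rewrite !mul1r !E; apply; last exact: cvg_exp_series.
by move=> k; rewrite ger0_norm.
Qed.

(* Otherwise all moments weighted by [cos (t0 W + b)] vanish; summing the cosine and sine
   series gives [E (cos^2 + sin^2) (t0 W) = 0]. *)
Lemma charfun_neq0 d (T : measurableType d) (R : realType) (P : probability T R) (W : T -> R)
    (t0 delta : R) : bmf W -> 0 < delta ->
  exists t, `|t - t0| < delta /\ exists b, Ex P (fun x => cos (t * W x + b)) != 0.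
Proof.
move=> bW dl0; apply: contrapT => N.
(* Vanishing is phrased as an equality with weights 1 and 0 on the same variable, so that the
   two-sided transfer lemmas apply. *)
have H t b : `|t - t0| < delta ->
    1 * Ex P (fun x => cos (t * W x + b)) = 0 * Ex P (fun x => cos (t * W x + b)).
  move=> td; rewrite mul1r mul0r; apply/eqP/negP => /negP E0.
  by apply: N; exists t; split => //; exists b.
have bW' : bmf (fun x => t0 * W x) by exact: bmfZ.
have M b n : 1 * Ex P (fun x => cos (t0 * W x + b) * (t0 * W x) ^+ n) =
    0 * Ex P (fun x => cos (t0 * W x + b) * (t0 * W x) ^+ n).
  have := @trig_moments _ _ _ _ _ P P _ _ 1 0 bW bW t0 delta dl0 H n b.
  rewrite !mul0r !mul1r => E; under eq_Ex do rewrite exprMn mulrCA.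
  rewrite ExZ ?E ?mulr0//; apply: bmfM; last exact: bmfX.
  exact/bmf_cos/measurable_affine/bmf_meas.
have bc b : bmf (fun x => cos (t0 * W x + b)) by exact/bmf_cos/measurable_affine/bmf_meas.
have c2 := @series_moments _ _ _ _ _ P P _ _ 1 0 bW' bW' _ _ _ _ (bc 0) (bc 0)
  (@cosc_le R) (@cvg_cos_series R) (M 0).
have s2 := @series_moments _ _ _ _ _ P P _ _ 1 0 bW' bW' _ _ _ _ (bc (- (pi / 2))) (bc (- (pi / 2)))
  (@sinc_le R) (@cvg_sin_series R) (M (- (pi / 2))).
have : Ex P (fun=> 1) = 0.
  move: c2 s2; rewrite !mul1r !mul0r => c2 s2.
  transitivity (Ex P (fun x => cos (t0 * W x + 0) * cos (t0 * W x)) +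
      Ex P (fun x => cos (t0 * W x - pi / 2) * sin (t0 * W x))); last by rewrite c2 s2 addr0.
  rewrite -ExD.
  - by apply: eq_Ex => x; rewrite addr0 cosBpihalf -!expr2 cos2Dsin2.
  - by apply: bmfM => //; exact/bmf_cos/bmf_meas.
  - by apply: bmfM => //; exact/bmf_sin/bmf_meas.
by rewrite Ex_cst => /eqP; rewrite oner_eq0.
Qed.

(** * Uniqueness of laws on tuples *)

Section tuple_uniqueness.
Context (R : realType) (n : nat).

Definition box (a : 'I_n -> R) : set (n.-tuple R) := [set x | forall i, tnth x i < a i].

Lemma measurable_box a : measurable (box a).
Proof.
have -> : box a = \bigcap_(i in [set: 'I_n]) ((fun x : n.-tuple R => tnth x i) @^-1` `]-oo, a i[).
  apply/seteqP; split=> x xa i; first by move=> _ /=; rewrite in_itv/= xa.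
  by have := xa i Logic.I; rewrite /= in_itv/=.
apply: fin_bigcap_measurable => // i _.
by rewrite -[X in measurable X]setTI; exact: measurable_tnth.
Qed.

Let G : set (set (n.-tuple R)) := range box.

Let measurable_tnth_G i : measurable_fun setT
  (fun x : g_sigma_algebraType G => tnth (x : n.-tuple R) i).
Proof.
apply: (measurability _ (RGenInftyO.measurableE R)) => _ [_ [a ->] <-].
rewrite setTI.
have -> : (fun x : n.-tuple R => tnth x i) @^-1` `]-oo, a[ =
    \bigcup_k box (fun j => if j == i then a else k%:R).
  apply/seteqP; split => [x /=|x [k _ /(_ i)]/=]; last by rewrite in_itv/= eqxx.
  rewrite in_itv/= => xa.
  exists (Num.trunc (\sum_j `|tnth x j|)).+1 => // j; case: eqP => [->//|_].
  apply: le_lt_trans (truncnS_gt _).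
  by rewrite (le_trans (ler_norm _))// (bigD1 j)//= lerDl sumr_ge0.
by apply: bigcup_measurable => k _; apply: sub_sigma_algebra; exists (fun j => if j == i then a else k%:R).
Qed.

Let measurable_G : @measurable _ (n.-tuple R) = <<s G >>.
Proof.
apply/seteqP; split => A mA.
  have := (iffRL (@measurable_fun_tnthP _ _ (g_sigma_algebraType G) R n id)) measurable_tnth_G.
  by move=> /(_ measurableT A mA); rewrite setTI.
by apply: smallest_sub mA => [|_ [a _ <-]]; [exact: sigma_algebra_measurable|exact: measurable_box].
Qed.

Lemma tuple_measure_unique (m1 m2 : probability (n.-tuple R) R) :
  (forall a, m1 (box a) = m2 (box a)) -> forall A, measurable A -> m1 A = m2 A.
Proof.
move=> H A mA.
apply: (measure_unique G (fun k => box (fun=> k%:R))) => //.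
- move=> _ _ [a _ <-] [b _ <-]; exists (fun i => Num.min (a i) (b i)) => //.
  apply/seteqP; split => [x xab|x [xa xb] i]; last by rewrite lt_min xa xb.
  by split=> i; have := xab i; rewrite lt_min => /andP[].
- by move=> k; exists (fun=> k%:R).
- apply/seteqP; split => // x _; exists (Num.trunc (\sum_j `|tnth x j|)).+1 => // j.
  apply: le_lt_trans (truncnS_gt _).
  by rewrite (le_trans (ler_norm _))// (bigD1 j)//= lerDl sumr_ge0.
- by move=> _ [a _ <-]; exact: H.
- move=> k; apply: (@le_lt_trans _ _ 1%E); last exact: ltry.
  by apply: probability_le1; exact: measurable_box.
Qed.

End tuple_uniqueness.

Lemma prodr_bool (R : realType) (I : finType) (b : I -> bool) :
  \prod_i (b i)%:R = ([forall i, b i])%:R :> R.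
Proof.
case: forallP => [H|/forallP]; first by rewrite big1// => i _; rewrite H.
rewrite negb_forall => /existsP[i /negbTE bi].
by rewrite (bigD1 i)//= bi mul0r.
Qed.

Lemma Ex_box d (T : measurableType d) (R : realType) (P : probability T R) n
    (X : T -> n.-tuple R) (a : 'I_n -> R) : measurable_fun setT X ->
  P (X @^-1` box a) = (Ex P (fun x => \prod_i (tnth (X x) i < a i)%R%:R))%:E.
Proof.
move=> mX; rewrite -Ex_indic; last first.
  by rewrite -[X in measurable X]setTI; apply: mX => //; exact: measurable_box.
congr EFin; apply: eq_Ex => x; rewrite prodr_bool indicE; congr (_%:R); congr nat_of_bool.
by apply/idP/idP; rewrite inE => /forallP.
Qed.

Definition dot (R : realType) n (s : 'I_n -> R) (x : n.-tuple R) : R := \sum_i s i * tnth x i.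

Definition bounded_tuple (R : realType) (T : Type) n (X : T -> n.-tuple R) :=
  exists K : R, forall x i, `|tnth (X x) i| <= K.

Lemma measurable_coord d (T : measurableType d) (R : realType) n (X : T -> n.-tuple R) i :
  measurable_fun setT X -> measurable_fun setT (fun x => tnth (X x) i).
Proof. by move=> /measurable_fun_tnthP; exact. Qed.

Lemma bmf_coord d (T : measurableType d) (R : realType) n (X : T -> n.-tuple R) i :
  measurable_fun setT X -> bounded_tuple X -> bmf (fun x => tnth (X x) i).
Proof.
by move=> mX [K XK]; split; [exact: measurable_coord|exists K => x; exact: XK].
Qed.

Lemma bmf_dot d (T : measurableType d) (R : realType) n (X : T -> n.-tuple R) s :
  measurable_fun setT X -> bounded_tuple X -> bmf (fun x => dot s (X x)).
Proof.
by move=> mX bX; apply: bmf_sum => i; apply: bmfZ; exact: bmf_coord.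
Qed.

Section laplace_uniqueness.
Context d1 d2 (T1 : measurableType d1) (T2 : measurableType d2) (R : realType) (n : nat).
Variables (P1 : probability T1 R) (P2 : probability T2 R).
Variables (X1 : T1 -> n.-tuple R) (X2 : T2 -> n.-tuple R).
Hypotheses (mX1 : measurable_fun setT X1) (mX2 : measurable_fun setT X2).
Hypotheses (bX1 : bounded_tuple X1) (bX2 : bounded_tuple X2).
Hypothesis H : forall s, Ex P1 (fun x => expR (dot s (X1 x))) = Ex P2 (fun x => expR (dot s (X2 x))).

Let Ex_monomial d (T : measurableType d) (P : probability T R) (X : T -> n.-tuple R)
    (b : R) (a : 'I_n -> R) (e : 'I_n -> nat) : measurable_fun setT X -> bounded_tuple X ->
  Ex P (fun x => \prod_i (expR (b * (tnth (X x) i - a i)) / 2) ^+ e i) =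
  (\prod_i (expR (- (b * a i)) / 2) ^+ e i) * Ex P (fun x => expR (dot (fun i => (e i)%:R * b) (X x))).
Proof.
move=> mX bX; rewrite -ExZ; last by apply: bmf_expR; exact: bmf_dot.
apply: eq_Ex => x; rewrite /dot expR_sum -big_split/=; apply: eq_bigr => i _.
rewrite !exprMn mulrAC; congr (_ * _).
rewrite -!expRM_natl -expRD; congr expR; ring.
Qed.

(** With [u_i = exp (b (X_i - a_i)) / 2], the event [X_i < a_i] is [u_i < 1/2], and joint moments of
    the [u_i] are, up to constants, Laplace transforms at multiples of [b]; [Ex_threshold]
    concludes. *)
Lemma laplace_unique A : measurable A -> P1 (X1 @^-1` A) = P2 (X2 @^-1` A).
Proof.
have [Q1 [Q1E _]] := exists_pushforward P1 mX1.
have [Q2 [Q2E _]] := exists_pushforward P2 mX2.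
move=> mA; rewrite -Q1E// -Q2E//; apply: tuple_measure_unique => // a.
rewrite Q1E ?Q2E; [|exact: measurable_box..].
rewrite !Ex_box//; congr EFin.
have [K1 XK1] := bX1; have [K2 XK2] := bX2.
pose K : R := `|K1| + `|K2| + (\sum_i `|a i|) + 1.
have ai i : `|a i| <= \sum_i `|a i| by rewrite (bigD1 i)//= lerDl sumr_ge0.
have K0 : 0 < K.
  by rewrite /K ltr_wpDl// !addr_ge0// sumr_ge0.
(* [K] dominates every [X_i - a_i], so [exp (b (X_i - a_i)) <= 2] and [u_i] stays in [[0, 1]]; the
   added 1 keeps [K] positive. *)
pose b := ln 2 / K.
have b0 : 0 < b by rewrite divr_gt0// ln_gt0// ltr1n.
pose u d (T : measurableType d) (X : T -> n.-tuple R) i x := expR (b * (tnth (X x) i - a i)) / 2.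
have uE d (T : measurableType d) (X : T -> n.-tuple R) i x :
    (u _ _ X i x < 2^-1) = (tnth (X x) i < a i).
  rewrite /u ltr_pdivrMr// mulVf ?pnatr_eq0// -[X in _ < X]expR0 ltr_expR.
  by rewrite pmulr_rlt0// subr_lt0.
have u01 d (T : measurableType d) (X : T -> n.-tuple R) i x :
    `|tnth (X x) i| <= `|K1| + `|K2| -> 0 <= u _ _ X i x <= 1.
  move=> XK; rewrite divr_ge0 ?expR_ge0//= ler_pdivrMr// mul1r.
  rewrite -[leRHS]lnK ?posrE// ler_expR -ler_pdivlMl// /b invf_div divfK ?gt_eqF ?ln_gt0 ?ltr1n//.
  by have := ai i; have := ler_norm (tnth (X x) i); have := ler_norm (- a i); rewrite normrN /K; lra.
have mu d (T : measurableType d) (X : T -> n.-tuple R) i : measurable_fun setT X ->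
    measurable_fun setT (u _ _ X i).
  move=> mX; apply: measurable_funM => //; apply: measurableT_comp => //.
  apply: measurable_funM => //; apply: measurable_funB => //; exact: measurable_coord.
have := @Ex_threshold _ _ _ _ _ P1 P2 'I_n (u _ _ X1) (u _ _ X2).
have E d (T : measurableType d) (P : probability T R) (X : T -> n.-tuple R) :
    Ex P (fun x => \prod_i (u _ _ X i x < 2^-1)%R%:R) = Ex P (fun x => \prod_i (tnth (X x) i < a i)%R%:R).
  by apply: eq_Ex => x; apply: eq_bigr => i _; rewrite uE.
rewrite !E.
apply => //.
- by move=> i; exact: mu.
- by move=> i; exact: mu.
- move=> i x; apply: (u01); by rewrite (le_trans (XK1 _ _))// (le_trans (ler_norm _))// lerDl.
- move=> i x; apply: (u01); by rewrite (le_trans (XK2 _ _))// (le_trans (ler_norm _))// lerDr.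
- by move=> e; rewrite !Ex_monomial// H.
Qed.

End laplace_uniqueness.

(** * Probabilities given by a density *)

Section density_measure.
Context d (T : measurableType d) (R : realType) (P : probability T R) (f : T -> \bar R).
Hypotheses (mf : measurable_fun setT f) (f0 : forall x, (0 <= f x)%E)
  (f1 : (\int[P]_x f x = 1)%E).

Let nu (A : set T) : \bar R := (\int[P]_(x in A) f x)%E.

Let nu0 : nu set0 = 0%E. Proof. exact: integral_set0. Qed.

Let nu_ge0 A : (0 <= nu A)%E. Proof. exact: integral_ge0. Qed.

Let nu_sigma_additive : semi_sigma_additive nu.
Proof.
move=> /= F mF tF mUF; apply: cvg_toP.
  apply: ereal_nondecreasing_is_cvgn => m n mn.
  by apply: lee_sum_nneg_natr => // k _ _; exact: integral_ge0.
by rewrite /nu ge0_integral_bigcup//=; exact: measurable_funTS.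
Qed.

HB.instance Definition _ := isMeasure.Build _ _ _ nu nu0 nu_ge0 nu_sigma_additive.

HB.instance Definition _ := @Measure_isProbability.Build _ _ R nu f1.

(** [f] agrees almost everywhere with the Radon-Nikodym derivative of [nu], since both have the same
    integral on every measurable set; change of variables then holds with [f] itself. *)
Lemma exists_density_measure : exists Q : probability T R,
  forall g, measurable_fun setT g -> (forall x, 0 <= g x)%E ->
    (\int[Q]_x g x = \int[P]_x (f x * g x))%E.
Proof.
exists nu => g mg g0.
have numu : nu `<< P.
  apply/null_content_dominatesP => A mA A0; apply: null_set_integral => //.
  exact: measurable_funTS.
rewrite -(Radon_Nikodym_SigmaFinite.change_of_variables numu)//.
have fi := Radon_Nikodym_SigmaFinite.f_integrable numu.
apply: ae_eq_integral => //.
- by apply: emeasurable_funM => //; exact: measurable_int fi.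
- exact: emeasurable_funM.
have : ae_eq P setT (Radon_Nikodym_SigmaFinite.f nu P) f.
  apply: integral_ae_eq => // E _ mE.
  by rewrite -(Radon_Nikodym_SigmaFinite.f_integral numu).
by apply: filterS => x /= /(_ Logic.I) ->; rewrite muleC.
Qed.

End density_measure.

(** * Complex characteristic functions and product laws *)

Section charfun.
Context (R : realType).

(** The expectation of [exp (i W)], kept as two real expectations. The frequency is part of [W], so
    scalar and vector frequencies share one definition. *)
Definition phi d (T : measurableType d) (P : probability T R) (W : T -> R) : R[i] :=
  (Ex P (fun x => cos (W x)) +i* Ex P (fun x => sin (W x)))%C.

Lemma phi_prod d1 d2 (T1 : measurableType d1) (T2 : measurableType d2)
    (P1 : probability T1 R) (P2 : probability T2 R) (W1 : T1 -> R) (W2 : T2 -> R) :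
  measurable_fun setT W1 -> measurable_fun setT W2 ->
  phi (P1 \x P2)%E (fun z => W1 z.1 + W2 z.2) = phi P1 W1 * phi P2 W2.
Proof.
move=> mW1 mW2; have c1 := bmf_cos mW1; have s1 := bmf_sin mW1.
have c2 := bmf_cos mW2; have s2 := bmf_sin mW2.
have b (g : T1 -> R) (h : T2 -> R) : bmf g -> bmf h ->
    bmf (fun z : T1 * T2 => g z.1 * h z.2).
  by move=> bg bh; apply: bmfM; [exact: (bmf_comp _ bg)|exact: (bmf_comp _ bh)].
rewrite /phi; apply/eqP; rewrite eq_complex /= -!Ex_prodM//.
apply/andP; split; apply/eqP.
  by rewrite -ExB; [apply: eq_Ex => z; rewrite cosD|exact: (b _ _ c1 c2)|exact: (b _ _ s1 s2)].
by rewrite -ExD; [apply: eq_Ex => z; rewrite sinD addrC|exact: (b _ _ c1 s2)|exact: (b _ _ s1 c2)].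
Qed.

Lemma phi_cst d (T : measurableType d) (P : probability T R) (c : R) :
  phi P (fun=> c) = (cos c +i* sin c)%C.
Proof. by rewrite /phi !Ex_cst. Qed.

Lemma phi0 d (T : measurableType d) (P : probability T R) (W : T -> R) :
  (forall x, W x = 0) -> phi P W = 1.
Proof. by move=> /funext ->; rewrite phi_cst cos0 sin0. Qed.

Lemma phi_shift d (T : measurableType d) (P : probability T R) (W : T -> R) c :
  measurable_fun setT W -> phi P (fun x => W x + c) = phi P W * (cos c +i* sin c)%C.
Proof.
move=> mW; have bc := bmf_cos mW; have bs := bmf_sin mW.
rewrite /phi; apply/eqP; rewrite eq_complex /= -!ExZr//.
rewrite -ExB -?ExD; [|by apply: bmfM => //; exact: bmf_cst..].
by apply/andP; split; apply/eqP; apply: eq_Ex => z; rewrite ?cosD ?sinD// addrC.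
Qed.

Lemma eq_phi d (T : measurableType d) (P : probability T R) (W W' : T -> R) :
  (forall x, W x = W' x) -> phi P W = phi P W'.
Proof. by move=> /funext ->. Qed.

(** Rotating by the phase [b] and taking real parts passes from complex identities, where products
    are easy, to the real family with all phases used by the transfer lemmas. *)
Lemma phi_cos d1 d2 (T1 : measurableType d1) (T2 : measurableType d2)
    (P1 : probability T1 R) (P2 : probability T2 R) (W1 : T1 -> R) (W2 : T2 -> R) b :
  measurable_fun setT W1 -> measurable_fun setT W2 -> phi P1 W1 = phi P2 W2 ->
  Ex P1 (fun x => cos (W1 x + b)) = Ex P2 (fun x => cos (W2 x + b)).
Proof.
move=> mW1 mW2 E; have := congr1 (fun z => z * (cos b +i* sin b)%C) E.
by rewrite /= -!phi_shift// => -[].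
Qed.

Lemma Ex_cos_cvg d (T : measurableType d) (P : probability T R) (W : T -> R) b
    (t_ : nat -> R) (t : R) : measurable_fun setT W -> t_ k @[k --> \oo] --> t ->
  Ex P (fun x => cos (t_ k * W x + b)) @[k --> \oo] --> Ex P (fun x => cos (t * W x + b)).
Proof.
move=> mW tt; apply: (Ex_cvg (K := 1)).
- by move=> k; apply/bmf_meas/bmf_cos/measurable_affine.
- by move=> k x; rewrite ler_norml cos_geN1 cos_le1.
- move=> x; apply: continuous_cvg; first exact: continuous_cos.
  by apply: cvgD; [exact: cvgMr_tmp|exact: cvg_cst].
Qed.

Lemma charfun_near0 d (T : measurableType d) (P : probability T R) (W : T -> R) :
  measurable_fun setT W -> exists2 delta : R, 0 < delta &
  forall t, `|t| < delta -> phi P (fun x => t * W x) != 0.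
Proof.
move=> mW; apply: contrapT => N.
have /choice[t_ tP] (k : nat) : exists t : R, `|t| < k.+1%:R^-1 /\ phi P (fun x => t * W x) = 0.
  apply: contrapT => Nk; apply: N; exists k.+1%:R^-1; first by rewrite invr_gt0.
  by move=> t tk; apply/eqP => t0; apply: Nk; exists t.
have t0 : t_ k @[k --> \oo] --> (0 : R).
  apply/cvgr0Pnorm_lt => e e0; have /cvgr0Pnorm_lt/(_ e e0) := @cvg_harmonic R.
  apply: filterS => k /=; rewrite ger0_norm//; apply: lt_trans; exact: (tP k).1.
have := @Ex_cos_cvg _ _ P _ 0 _ _ mW t0.
have E k : Ex P (fun x => cos (t_ k * W x + 0)) = 0.
  have [c _] := (tP k).2; under eq_Ex do rewrite addr0; exact: c.
under eq_fun do rewrite E.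
under eq_Ex do rewrite mul0r addr0 cos0.
rewrite Ex_cst => /(cvg_eq_lim (fun=> erefl) (cvg_cst (0 : R)))/eqP.
by rewrite eq_sym oner_eq0.
Qed.

Lemma law_Ex d1 d2 d' (T1 : measurableType d1) (T2 : measurableType d2) (T' : measurableType d')
    (P1 : probability T1 R) (P2 : probability T2 R) (X1 : T1 -> T') (X2 : T2 -> T') (g : T' -> R) :
  measurable_fun setT X1 -> measurable_fun setT X2 ->
  (forall A, measurable A -> P1 (X1 @^-1` A) = P2 (X2 @^-1` A)) -> bmf g ->
  Ex P1 (fun x => g (X1 x)) = Ex P2 (fun x => g (X2 x)).
Proof.
move=> mX1 mX2 H bg.
have [Q1 [Q1E [Q1x _]]] := exists_pushforward P1 mX1.
have [Q2 [Q2E [Q2x _]]] := exists_pushforward P2 mX2.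
rewrite -Q1x// -Q2x// Ex.unlock /Rintegral; congr fine; apply: eq_measure_integral => A mA _.
exact: (etrans (Q1E A mA) (etrans (H A mA) (esym (Q2E A mA)))).
Qed.

(** Realises a product of transforms as the transform of a single bounded variable, so that the
    one-dimensional [laplace_of_charfun] can be applied to products. *)
Lemma exists_indep_sum n (dd : 'I_n -> measure_display) (TT : forall j, measurableType (dd j))
    (PP : forall j, probability (TT j) R) (WW : forall j, TT j -> R) :
  (forall j, bmf (WW j)) ->
  exists (d : measure_display) (T : measurableType d) (P : probability T R) (W : T -> R),
    [/\ bmf W, forall l, phi P (fun x => l * W x) = \prod_j phi (PP j) (fun x => l * WW j x) &
        Ex P (fun x => expR (W x)) = \prod_j Ex (PP j) (fun x => expR (WW j x))].
Proof.
elim: n dd TT PP WW => [|n IH] dd TT PP WW bW.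
  exists _, bool, (dirac true), (fun=> 0); split.
  - exact: bmf_cst.
  - by move=> l; rewrite big_ord0; apply: phi0 => x; rewrite mulr0.
  - by rewrite big_ord0 expR0 Ex_cst.
have [d [T [P [W [bW' W1 W2]]]]] := IH _ _ (fun j => PP (lift ord0 j)) (fun j => WW (lift ord0 j))
  (fun j => bW (lift ord0 j)).
exists _, (TT ord0 * T)%type, (PP ord0 \x P)%E, (fun z => WW ord0 z.1 + W z.2); split.
- by apply: bmfD; [exact: (bmf_comp _ (bW ord0))|exact: (bmf_comp _ bW')].
- move=> l; rewrite big_ord_recl -W1 -phi_prod.
  + by apply: eq_phi => x; rewrite mulrDr.
  + by apply/bmf_meas/bmfZ.
  + by apply/bmf_meas/bmfZ.
- rewrite big_ord_recl -W2 -Ex_prodM; [|exact: bmf_expR..].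
  by apply: eq_Ex => x; rewrite expRD.
Qed.

End charfun.

Section product_tuple.
Context (R : realType).
Let mR := measurableTypeR R.

Lemma tupS n (x : R) (s : seq R) : tup n.+1 (x :: s) = [tuple of x :: tup n s].
Proof.
apply: eq_from_tnth => i; rewrite tnth_mktuple.
case: (unliftP ord0 i) => [j ->|->]; last by rewrite tnth0.
by rewrite tnthS tnth_mktuple.
Qed.

Lemma measurable_consR n : measurable_fun setT
  (fun z : mR * n.-tuple R => [tuple of z.1 :: z.2] : n.+1.-tuple R).
Proof.
by apply: (@measurable_cons _ _ (mR * n.-tuple R)%type R); [exact: measurable_fst|exact: measurable_snd].
Qed.

(** One induction covers both uses of [iint]: the noise, with [Q i] on the whole line, and the cube,
    with Lebesgue measure on [[0, 1]]. The hypothesis only asks that each pair of [F] integrate like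
    a probability. *)
Lemma exists_tuple_measure n (F : 'I_n -> {measure set mR -> \bar R} * set R)
    (Q : 'I_n -> probability mR R) :
  (forall i (h : mR -> \bar R), measurable_fun setT h -> (forall x, 0 <= h x)%E ->
     (\int[(F i).1]_(x in (F i).2) h x = \int[Q i]_x h x)%E) ->
  exists P : probability (n.-tuple R) R,
    (forall g : n.-tuple R -> \bar R, measurable_fun setT g -> (forall x, 0 <= g x)%E ->
      iint [seq F i | i <- enum 'I_n] (fun s => g (tup n s)) = (\int[P]_x g x)%E) /\
    (forall h : 'I_n -> mR -> R, (forall i, bmf (h i)) ->
      Ex P (fun x => \prod_i h i (tnth x i)) = \prod_i Ex (Q i) (h i)) /\
    (forall W : 'I_n -> mR -> R, (forall i, measurable_fun setT (W i)) ->
      phi P (fun x => \sum_i W i (tnth x i)) = \prod_i phi (Q i) (W i)).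
Proof.
elim: n F Q => [|n IH] F Q FQ.
  have t0 s : tup 0 s = [tuple] :> 0.-tuple R by exact: tuple0.
  exists (dirac ([tuple] : 0.-tuple R)); split; last split.
  - move=> g mg g0; rewrite integral_dirac// diracT mul1e.
    by rewrite (size0nil (size_enum_ord 0))/= t0.
  - by move=> h _; under eq_Ex do rewrite big_ord0; rewrite Ex_cst big_ord0.
  - by move=> W _; rewrite big_ord0; apply: phi0 => x; rewrite big_ord0.
have [P' [P'1 [P'2 P'3]]] := IH (fun i => F (lift ord0 i)) (fun i => Q (lift ord0 i))
  (fun i => FQ (lift ord0 i)).
have [P [_ [PEx Pint]]] := exists_pushforward (Q ord0 \x P')%E (@measurable_consR n).
exists P; split; last split.
- move=> g mg g0; rewrite enum_ordSl/= -map_comp.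
  rewrite Pint// fubini_tonelli1//; last exact: measurableT_comp mg (@measurable_consR n).
  case E0 : (F ord0) => [mu D] /=.
  pose k := (fun x : mR => \int[P']_t g [tuple of x :: t])%E.
  have mk : measurable_fun setT k.
    have := @measurable_fun_fubini_tonelli_F _ _ _ _ _ P'
      (fun z : mR * n.-tuple R => g [tuple of z.1 :: z.2]).
    by apply => //; exact: measurableT_comp mg (@measurable_consR n).
  have := FQ ord0 k mk; rewrite E0/= => <-; last by move=> x; exact: integral_ge0.
  apply: eq_integral => x _; rewrite /k -(P'1 (fun t => g [tuple of x :: t]))//.
    by congr iint; apply/funext => s /=; rewrite tupS.
  apply: measurableT_comp mg _.
  exact: (@measurable_cons _ _ (n.-tuple R) R (fun=> x) _ id).
- move=> h bh; rewrite PEx; last first.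
  apply: bmf_prod => i; apply: (bmf_comp _ (bh i)); exact: measurable_tnth.
rewrite big_ord_recl -P'2//.
rewrite -(Ex_prodM (Q ord0) P' (bh ord0)); last first.
  apply: bmf_prod => i; apply: (bmf_comp _ (bh (lift ord0 i))); exact: measurable_tnth.
by apply: eq_Ex => z /=; rewrite big_ord_recl tnth0; congr (_ * _); apply: eq_bigr => i _; rewrite tnthS.
- move=> W mW; rewrite big_ord_recl -P'3// -phi_prod//; last first.
    apply: measurable_sum => i; apply: (measurableT_comp (mW (lift ord0 i))); exact: measurable_tnth.
  have mS : measurable_fun setT (fun x : n.+1.-tuple R => \sum_i W i (tnth x i)).
    by apply: measurable_sum => i; apply: (measurableT_comp (mW i)); exact: measurable_tnth.
  rewrite /phi PEx ?(PEx (fun x => sin _)); [|exact: bmf_sin|exact: bmf_cos].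
  by congr (_ +i* _)%C; apply: eq_Ex => z /=; rewrite big_ord_recl tnth0; congr (_ (_ + _));
    apply: eq_bigr => i _; rewrite tnthS.
Qed.

Lemma exists_prodQ n (Q : 'I_n -> probability mR R) :
  exists P : probability (n.-tuple R) R,
    (forall A, measurable A -> prodQ Q A = P A) /\
    (forall h : 'I_n -> mR -> R, (forall i, bmf (h i)) ->
      Ex P (fun x => \prod_i h i (tnth x i)) = \prod_i Ex (Q i) (h i)) /\
    (forall W : 'I_n -> mR -> R, (forall i, measurable_fun setT (W i)) ->
      phi P (fun x => \sum_i W i (tnth x i)) = \prod_i phi (Q i) (W i)).
Proof.
have [//|P [P1 P2]] := @exists_tuple_measure n (fun i => (Q i : {measure set mR -> \bar R}, setT)) Q.
exists P; split => // A mA.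
have := P1 (fun x => (\1_A x)%:E); rewrite integral_indic// setIT => <- //.
exact/measurable_EFinP/measurable_indic.
Qed.

Lemma iint_nseq_eq n (mu : {measure set mR -> \bar R}) (D : set R) (g h : seq R -> \bar R) :
  (forall s, size s = n -> (forall x, x \in s -> D x) -> g s = h s) ->
  iint (nseq n (mu, D)) g = iint (nseq n (mu, D)) h.
Proof.
elim: n g h => [|n IH] g h gh /=; first exact: gh.
apply: eq_integral => x; rewrite inE => Dx; apply: IH => s ss sD; apply: gh => /=; first by rewrite ss.
by move=> y; rewrite inE => /orP[/eqP->|/sD].
Qed.

Lemma cube_int_eq n (g h : n.-tuple R -> \bar R) :
  (forall u, cube n u -> g u = h u) -> cube_int n g = cube_int n h.
Proof.
move=> gh; apply: iint_nseq_eq => s ss sD; apply: gh => i.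
by rewrite tnth_mktuple; apply: sD; rewrite mem_nth// ss.
Qed.

Lemma exists_uniform_cube n : exists P : probability (n.-tuple R) R,
  forall g : n.-tuple R -> \bar R, measurable_fun setT g -> (forall x, 0 <= g x)%E ->
    cube_int n g = (\int[P]_x g x)%E.
Proof.
pose D := [set x : R | 0 <= x <= 1].
pose F (i : 'I_n) := ((@lebesgue_measure R : {measure set mR -> \bar R}), D).
have [|P [P1 _]] := @exists_tuple_measure n F (fun=> uniform_prob (@ltr01 R)).
  move=> i h mh h0; rewrite integral_uniform// subr0 invr1 mul1e /=.
  by congr (\int[_]_(x in _) _)%E; apply/seteqP; split => x /=; rewrite in_itv.
exists P => g mg g0; rewrite -P1// /cube_int.
congr iint; rewrite -[in LHS](size_enum_ord n).
by elim: (enum 'I_n) => //= i s ->.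
Qed.

Lemma measurable_cube n : measurable (@cube R n).
Proof.
have -> : @cube R n = \bigcap_(i in [set: 'I_n]) ((fun x : n.-tuple R => tnth x i) @^-1` `[0, 1]).
  apply/seteqP; split=> x xa i; first by move=> _ /=; rewrite in_itv/= xa.
  by have := xa i Logic.I; rewrite /= in_itv/=.
apply: fin_bigcap_measurable => // i _.
by rewrite -[X in measurable X]setTI; exact: measurable_tnth.
Qed.

Lemma exists_density n (f : n.-tuple R -> R) : is_density n f ->
  exists PU : probability (n.-tuple R) R,
  [/\ (forall g : n.-tuple R -> \bar R, measurable_fun setT g -> (forall x, 0 <= g x)%E ->
        cube_int n (fun u => (f u)%:E * g u)%E = (\int[PU]_x g x)%E),
      PU (cube n) = 1%E &
      forall N, measurable N -> cube_int n (fun u => (\1_N u)%:E) = 0%E -> PU N = 0%E].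
Proof.
move=> [mf f0 f1]; have [P PE] := exists_uniform_cube n.
(* Measurability and sign of [f] are known on the cube only, so it is set to zero outside. *)
pose f' := (EFin \o f) \_ (cube n).
have mf' : measurable_fun setT f'.
  have -> : f' = fun x => if x \in cube n then (f x)%:E else 0%E.
    by apply/funext => x; rewrite /f' patchE.
  have pc : (fun x : n.-tuple R => x \in cube n) @^-1` [set true] = cube n.
    by apply/seteqP; split => x /=; [move/set_mem|move/mem_set].
  have mc : measurable_fun setT (fun x : n.-tuple R => x \in cube n).
    by apply: (measurable_fun_bool true); rewrite setTI pc; exact: (@measurable_cube n).
  apply: measurable_fun_if => //; rewrite setTI pc; exact/measurable_EFinP.
have f'0 x : (0 <= f' x)%E.
  by rewrite /f' patchE; case: ifPn => //; rewrite inE => /f0; rewrite lee_fin.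
have f'E g : cube_int n (fun u => (f u)%:E * g u)%E = cube_int n (fun u => f' u * g u)%E.
  by apply: cube_int_eq => u uc; rewrite /f' patchE mem_set.
have f'1 : (\int[P]_x f' x = 1)%E.
  by rewrite -PE// -f1; apply: cube_int_eq => u uc; rewrite /f' patchE mem_set.
have [PU PUE] := exists_density_measure mf' f'0 f'1.
exists PU; split.
- move=> g mg g0; rewrite PUE// f'E PE//; first exact: emeasurable_funM.
  by move=> x; exact: mule_ge0.
- rewrite prob_indic ?PUE//; last 2 first.
  + apply/measurable_EFinP; apply: measurable_indic; exact: (@measurable_cube n).
  + exact: (@measurable_cube n).
  rewrite -f'1; apply: eq_integral => x _; rewrite /f' patchE indicE.
  by case: ifPn; rewrite ?mule1 ?mule0.
- move=> N mN; rewrite PE//; last exact/measurable_EFinP/measurable_indic.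
  rewrite integral_indic// setIT => N0.
  rewrite prob_indic// PUE//; last exact/measurable_EFinP/measurable_indic.
  rewrite (eq_integral (f' \_ N)).
    by rewrite -integral_mkcond; apply: null_set_integral => //; exact: measurable_funTS.
  by move=> x _; rewrite patchE indicE; case: ifPn; rewrite ?mule1 ?mule0.
Qed.

End product_tuple.

Lemma dot_basis (R : realType) n (j : 'I_n) (c : R) (x : n.-tuple R) :
  dot (fun i => if i == j then c else 0) x = c * tnth x j.
Proof.
rewrite /dot (bigD1 j)//= eqxx big1 ?addr0// => i /negbTE ->.
by rewrite mul0r.
Qed.

(** * Elimination of the noise *)

Section deconvolution.
Context d1 d2 (T1 : measurableType d1) (T2 : measurableType d2) (R : realType) (n : nat).
Variables (P1 : probability T1 R) (P2 : probability T2 R).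
Variables (Z1 : T1 -> n.-tuple R) (Z2 : T2 -> n.-tuple R).
Hypotheses (mZ1 : measurable_fun setT Z1) (mZ2 : measurable_fun setT Z2).
Hypotheses (bZ1 : bounded_tuple Z1) (bZ2 : bounded_tuple Z2).
Variables (q1 q2 : 'I_n -> R -> R[i]).
Hypothesis H : forall t : 'I_n -> R,
  phi P1 (fun x => dot t (Z1 x)) * \prod_j q1 j (t j) =
  phi P2 (fun x => dot t (Z2 x)) * \prod_j q2 j (t j).
Hypotheses (q10 : forall j, q1 j 0 = 1) (q20 : forall j, q2 j 0 = 1).
Hypotheses
  (q1n : forall j, exists2 delta : R, 0 < delta & forall t, `|t| < delta -> q1 j t != 0)
  (q2n : forall j, exists2 delta : R, 0 < delta & forall t, `|t| < delta -> q2 j t != 0).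

(** A frequency vector supported by coordinate [j] leaves only that noise factor, the others being 1
    at frequency 0. *)
Lemma charfun_marginal j (c : R) :
  phi P1 (fun x => c * tnth (Z1 x) j) * q1 j c = phi P2 (fun x => c * tnth (Z2 x) j) * q2 j c.
Proof.
have qE (q : 'I_n -> R -> R[i]) : (forall j, q j 0 = 1) ->
    \prod_i q i (if i == j then c else 0) = q j c.
  move=> q0; rewrite (bigD1 j)//= eqxx big1 ?mulr1// => i /negbTE ->.
  by rewrite q0.
have := H (fun i => if i == j then c else 0); rewrite !qE//.
by under eq_phi do rewrite dot_basis; under [X in _ = X * _]eq_phi do rewrite dot_basis.
Qed.

Let exists_delta : exists2 delta : R, 0 < delta &
  forall j t, `|t| < delta -> q1 j t != 0 /\ q2 j t != 0.
Proof.
have /choice[dl dlP] j : exists delta : R, 0 < delta /\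
    forall t, `|t| < delta -> q1 j t != 0 /\ q2 j t != 0.
  have [a a0 aP] := q1n j; have [b b0 bP] := q2n j.
  exists (Num.min a b); rewrite lt_min a0 b0; split => // t.
  by rewrite lt_min => /andP[ta tb]; rewrite aP// bP.
exists (\big[Num.min/1]_j dl j).
  by apply/bigmin_gtP; split => // j _; exact: (dlP j).1.
move=> j t tj; apply: (dlP j).2; apply: lt_le_trans tj _.
exact: bigmin_le_cond.
Qed.

(** The joint identity is multiplied by the coordinate identities read backwards; both sides then
    carry the noise factor [Q1 * Q2], which is nonzero for frequencies near 0 and cancels. *)
Let charfun_cross : exists2 delta : R, 0 < delta & forall t, (forall j, `|t j| < delta) ->
  phi P1 (fun x => dot t (Z1 x)) * \prod_j phi P2 (fun x => t j * tnth (Z2 x) j) =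
  phi P2 (fun x => dot t (Z2 x)) * \prod_j phi P1 (fun x => t j * tnth (Z1 x) j).
Proof.
have [delta dl0 dlP] := exists_delta; exists delta => // t tdl.
set A1 := phi P1 _; set A2 := phi P2 _; set B2 := \prod_j _; set B1 := (X in _ = _ * X).
pose Q1 := \prod_j q1 j (t j); pose Q2 := \prod_j q2 j (t j).
have Q0 : Q1 * Q2 != 0.
  by rewrite mulf_neq0//; apply/prodf_neq0 => j _; have [] := dlP j _ (tdl j).
apply: (mulIf Q0).
have E1 : A1 * Q1 = A2 * Q2 by exact: H.
have E2 : B1 * Q1 = B2 * Q2.
  rewrite /B1 /B2 /Q1 /Q2 -!big_split/=; apply: eq_bigr => j _; exact: charfun_marginal.
transitivity ((A1 * Q1) * (B2 * Q2)); first by ring.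
by rewrite E1 -E2; ring.
Qed.

(** Each side is the Laplace transform, at 1, of a sum of two independent bounded variables: [dot s]
    of one signal, and a sum of independent copies of the scaled coordinates of the other. *)
Lemma laplace_cross (s : 'I_n -> R) :
  Ex P1 (fun x => expR (dot s (Z1 x))) * \prod_j Ex P2 (fun x => expR (s j * tnth (Z2 x) j)) =
  Ex P2 (fun x => expR (dot s (Z2 x))) * \prod_j Ex P1 (fun x => expR (s j * tnth (Z1 x) j)).
Proof.
have [delta dl0 dlP] := charfun_cross.
have b1 j : bmf (fun x => s j * tnth (Z1 x) j) by exact/bmfZ/bmf_coord.
have b2 j : bmf (fun x => s j * tnth (Z2 x) j) by exact/bmfZ/bmf_coord.
have c1 := bmf_dot s mZ1 bZ1; have c2 := bmf_dot s mZ2 bZ2.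
have [e2 [S2 [N2 [W2 [bW2 pW2 eW2]]]]] := exists_indep_sum (fun=> P2) b2.
have [e1 [S1 [N1 [W1 [bW1 pW1 eW1]]]]] := exists_indep_sum (fun=> P1) b1.
rewrite -eW1 -eW2 -Ex_prodM; [|exact: bmf_expR..].
rewrite -Ex_prodM; [|exact: bmf_expR..].
under eq_Ex do rewrite -expRD; under [RHS]eq_Ex do rewrite -expRD.
(* For [|t| < delta / S] every frequency [t * s j] is below [delta]; the added 1 covers [s = 0]. *)
pose S := (\sum_j `|s j|) + 1.
have S0 : 0 < S by rewrite ltr_wpDl// sumr_ge0.
have B1 : bmf (fun z : T1 * S2 => dot s (Z1 z.1) + W2 z.2).
  by apply: bmfD; [exact: (bmf_comp _ c1)|exact: (bmf_comp _ bW2)].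
have B2 : bmf (fun z : T2 * S1 => dot s (Z2 z.1) + W1 z.2).
  by apply: bmfD; [exact: (bmf_comp _ c2)|exact: (bmf_comp _ bW1)].
apply: (laplace_of_charfun (delta := delta / S)) => //; first by rewrite divr_gt0.
move=> t b tS; apply: phi_cos; [exact/bmf_meas/bmfZ..|].
under eq_phi do rewrite mulrDr; under [RHS]eq_phi do rewrite mulrDr.
rewrite (phi_prod P1 N2 (W1 := fun x => t * dot s (Z1 x)) (W2 := fun x => t * W2 x));
  [|exact/bmf_meas/bmfZ..].
rewrite (phi_prod P2 N1 (W1 := fun x => t * dot s (Z2 x)) (W2 := fun x => t * W1 x));
  [|exact/bmf_meas/bmfZ..].
rewrite pW1 pW2.
have dE (x : n.-tuple R) : t * dot s x = dot (fun j => t * s j) x.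
  by rewrite /dot mulr_sumr; apply: eq_bigr => j _; rewrite mulrA.
under eq_phi do rewrite dE; under [X in _ = X * _]eq_phi do rewrite dE.
under eq_bigr do under eq_phi do rewrite mulrA.
under [X in _ = _ * X]eq_bigr do under eq_phi do rewrite mulrA.
apply: dlP => j; rewrite normrM (le_lt_trans (y := `|t| * S))// -?ltr_pdivlMr//.
rewrite ler_wpM2l// /S (bigD1 j)//= -addrA lerDl addr_ge0// sumr_ge0//.
Qed.

End deconvolution.

(** * Exponential tilting on a sphere *)

Section exponential_inequalities.
Context (R : realType).
Implicit Types a b x y : R.

(** With [u = exp (y / 2)] and [v = exp (- y / 2)], the sum is [2 + (u - v)^2] because [u v = 1];
    and for [y >= 0], [u >= 1 + y / 2] and [v <= 1]. *)
Lemma expR_cosh_ge y : 2 + y ^+ 2 / 4 <= expR y + expR (- y).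
Proof.
wlog y0 : y / 0 <= y => [H|].
  have [/H //|/ltW y0] := leP 0 y.
  by have := H (- y); rewrite opprK sqrrN oppr_ge0 (addrC (expR (- y))); apply.
have := expR_ge1Dx (y / 2); have := expR_gt0 (y / 2); have := expR_gt0 (- (y / 2)).
have l1 : expR (- (y / 2)) <= 1 by rewrite -[leRHS]expR0 ler_expR; lra.
have -> : expR y = expR (y / 2) ^+ 2 by rewrite expr2 -expRD; congr expR; lra.
have -> : expR (- y) = expR (- (y / 2)) ^+ 2 by rewrite expr2 -expRD; congr expR; lra.
have : expR (y / 2) * expR (- (y / 2)) = 1 by rewrite -expRD subrr expR0.
move: (expR (y / 2)) (expR (- (y / 2))) l1 => u v l1 uv v0 u0 ul.
have d0 : y / 2 <= u - v by lra.
have : (y / 2) ^+ 2 <= (u - v) ^+ 2 by rewrite lerXn2r ?nnegrE//; lra.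
nra.
Qed.

Lemma expR_lip a b c : `|a| <= c -> `|b| <= c -> `|expR a - expR b| <= `|a - b| * expR c.
Proof.
wlog ab : a b / b <= a => [H ac bc|].
  have [/H|/ltW/H] := leP b a; first exact.
  by rewrite distrC (distrC b); apply.
move=> ac bc; rewrite ger0_norm ?subr_ge0 ?ler_expR// ger0_norm ?subr_ge0//.
have -> : expR a - expR b = expR a * (1 - expR (b - a)).
  by rewrite mulrBr mulr1 -expRD; congr (_ - expR _); ring.
rewrite mulrC ler_pM ?expR_ge0 ?subr_ge0//.
- by rewrite -[leRHS]expR0 ler_expR; lra.
- by have := expR_ge1Dx (b - a); lra.
- by rewrite ler_expR (le_trans (ler_norm _)).
Qed.

End exponential_inequalities.

Section near_maximiser.
Context (R : realType) (n : nat).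
Implicit Types s : 'I_n -> R.

Definition shift_at s j (c : R) : 'I_n -> R := fun i => s i + (if i == j then c else 0).

Lemma dot_shift s j c (x : n.-tuple R) : dot (shift_at s j c) x = dot s x + c * tnth x j.
Proof.
rewrite -dot_basis /dot -big_split/=; apply: eq_bigr => i _.
by rewrite /shift_at mulrDl.
Qed.

Lemma sum_sq_shift s j c :
  \sum_i (shift_at s j c i) ^+ 2 = \sum_i s i ^+ 2 + (2 * c * s j + c ^+ 2).
Proof.
rewrite (bigD1 j)//= [in RHS](bigD1 j)//= /shift_at eqxx.
rewrite (eq_bigr (fun i => s i ^+ 2)) => [|i /negbTE ->]; last by rewrite addr0.
by ring.
Qed.

(* The witness is a near-maximiser of [G - delta |s|^2] on the hyperplane [s j0 = 0]. *)
Lemma small_second_difference (G : ('I_n -> R) -> R) (K delta : R) (j0 : 'I_n) :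
  0 <= K -> 0 < delta -> (forall s, G s <= K * \sum_i `|s i|) ->
  exists s, s j0 = 0 /\ forall j, j != j0 ->
    G (shift_at s j 1) + G (shift_at s j (-1)) - 2 * G s <= 4 * delta.
Proof.
move=> K0 dl0 GK; pose H s := G s - delta * \sum_i s i ^+ 2.
pose A := [set H s | s in [set s | s j0 = 0]].
have supA : has_sup A.
  split; first by exists (H (fun=> 0)), (fun=> 0).
  exists (\sum_(i < n) K ^+ 2 / (4 * delta)) => _ [s _ <-].
  rewrite /H lerBlDr (le_trans (GK s))// !mulr_sumr -big_split/=.
  apply: ler_sum => i _.
  (* Completing the square bounds each coordinate's share of [G - delta |s|^2], so the supremum is
     finite. *)
  have : 0 <= (K - 2 * delta * `|s i|) ^+ 2 / (4 * delta) by rewrite divr_ge0 ?sqr_ge0 ?mulr_ge0 ?ltW.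
  rewrite -(real_normK (num_real (s i))).
  rewrite (_ : _ / _ = K ^+ 2 / (4 * delta) + delta * `|s i| ^+ 2 - K * `|s i|); first by rewrite subr_ge0.
  by field; rewrite gt_eqF.
have [_ [s s0 <-] Hs] := sup_adherent dl0 supA.
have ub s' : s' j0 = 0 -> H s' <= sup A.
  by move=> s'0; apply: sup_upper_bound => //; exists s'.
exists s; split => // j jj0.
have shj c : shift_at s j c j0 = 0 by rewrite /shift_at eq_sym (negbTE jj0) addr0.
(* A step of length 1 either way raises [H] by less than [delta], hence [2 * delta] in all; the
   second difference of [delta |s|^2] adds another [2 * delta]. *)
have := ub _ (shj 1); have := ub _ (shj (-1)); move: Hs.
rewrite /H !sum_sq_shift; nra.
Qed.

End near_maximiser.

Section weights.
Context d (T : measurableType d) (R : realType) (P : probability T R) (w : T -> R).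
Hypotheses (bw : bmf w) (w0 : forall x, 0 <= w x) (w1 : Ex P w = 1).

Let Ew (g : T -> R) := Ex P (fun x => w x * g x).

Let le_Ew g h : bmf g -> bmf h -> (forall x, g x <= h x) -> Ew g <= Ew h.
Proof.
by move=> bg bh gh; apply: le_Ex => [||x]; [exact: bmfM..|rewrite ler_wpM2l].
Qed.

Let EwD g h : bmf g -> bmf h -> Ew (fun x => g x + h x) = Ew g + Ew h.
Proof.
move=> bg bh; rewrite /Ew -ExD; [|exact: bmfM..].
by apply: eq_Ex => x; rewrite mulrDr.
Qed.

Let EwZ c g : bmf g -> Ew (fun x => c * g x) = c * Ew g.
Proof.
move=> bg; rewrite /Ew -ExZ; last exact: bmfM.
by apply: eq_Ex => x; rewrite mulrCA.
Qed.

Let Ew_cst c : Ew (fun=> c) = c.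
Proof. by rewrite /Ew ExZr// w1 mul1r. Qed.

Let EwB g h : bmf g -> bmf h -> Ew (fun x => g x - h x) = Ew g - Ew h.
Proof.
move=> bg bh; rewrite EwD//; last exact: bmfN.
by under [X in _ + X = _]eq_Ex do rewrite -mulN1r mulrCA; rewrite ExZ ?mulN1r//; exact: bmfM.
Qed.

Let Ew_sum (I : Type) (s : seq I) (Q : pred I) (G : I -> T -> R) : (forall i, bmf (G i)) ->
  Ew (fun x => \sum_(i <- s | Q i) G i x) = \sum_(i <- s | Q i) Ew (G i).
Proof.
move=> bG; rewrite /Ew -Ex_sum; last by move=> i; exact: bmfM.
by apply: eq_Ex => x; rewrite mulr_sumr.
Qed.

Definition wmean (Y : T -> R) := Ex P (fun x => w x * Y x).
Definition wvar (Y : T -> R) := Ex P (fun x => w x * (Y x - wmean Y) ^+ 2).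

(** Centring [Y] multiplies the two factors by [exp (- c)] and [exp c], which cancel. The centred
    factors [A], [B] are at least 1, so [A B >= A + B - 1], and [expR_cosh_ge] bounds [A + B] by the
    variance. *)
Lemma wvar_le_laplace Y : bmf Y ->
  1 + wvar Y / 4 <= Ex P (fun x => w x * expR (Y x)) * Ex P (fun x => w x * expR (- Y x)).
Proof.
move=> bY; set c := wmean Y.
have bYc : bmf (fun x => Y x - c) by apply: bmfB => //; exact: bmf_cst.
have m0 : Ew (fun x => Y x - c) = 0.
  by rewrite EwB ?Ew_cst ?subrr//; exact: bmf_cst.
pose A := Ew (fun x => expR (Y x - c)); pose B := Ew (fun x => expR (- (Y x - c))).
have bA : bmf (fun x => expR (Y x - c)) by exact: bmf_expR.
have bB : bmf (fun x => expR (- (Y x - c))) by apply/bmf_expR/bmfN.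
have A1 : 1 <= A.
  apply: le_trans (le_Ew (g := fun x => 1 + (Y x - c)) _ bA _).
  - by rewrite EwD ?m0 ?Ew_cst ?addr0//; exact: bmf_cst.
  - by apply: bmfD => //; exact: bmf_cst.
  - by move=> x; exact: expR_ge1Dx.
have B1 : 1 <= B.
  apply: le_trans (le_Ew (g := fun x => 1 - (Y x - c)) _ bB _).
  - by rewrite EwB ?m0 ?Ew_cst ?subr0//; exact: bmf_cst.
  - by apply: bmfB => //; exact: bmf_cst.
  - by move=> x; exact: expR_ge1Dx.
have AB : 2 + wvar Y / 4 <= A + B.
  rewrite -EwD//; apply: le_trans (le_Ew (g := fun x => 2 + 4^-1 * (Y x - c) ^+ 2) _ _ _).
  - rewrite EwD; [|exact: bmf_cst|by apply/bmfZ/bmfX].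
    by rewrite Ew_cst EwZ ?(mulrC 4^-1)//; exact: bmfX.
  - by apply: bmfD; [exact: bmf_cst|apply/bmfZ/bmfX].
  - exact: bmfD.
  - by move=> x; rewrite (mulrC 4^-1); exact: expR_cosh_ge.
have -> : Ex P (fun x => w x * expR (Y x)) = expR c * A.
  by rewrite -EwZ//; apply: eq_Ex => x; rewrite -expRD; congr (_ * expR _); ring.
have -> : Ex P (fun x => w x * expR (- Y x)) = expR (- c) * B.
  by rewrite -EwZ//; apply: eq_Ex => x; rewrite -expRD; congr (_ * expR _); ring.
have -> : expR c * A * (expR (- c) * B) = A * B.
  by rewrite mulrACA -expRD subrr expR0 mul1r.
nra.
Qed.

(** If the other coordinates stay near their means [c j], the sphere equation forces the [j0]-th
    near [rho] or [- rho], where [rho^2 = r^2 - sum c_j^2]; [p] is the weighted probability that it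
    is positive. The fourth power of [k] pays for two square roots: from squares to absolute values,
    and from [rho^2] to [rho]. *)
Lemma sphere_concentration n (Z : T -> n.-tuple R) (r : R) (j0 : 'I_n) (k : R) :
  (forall i, bmf (fun x => tnth (Z x) i)) -> 0 <= r ->
  (forall x, \sum_i tnth (Z x) i ^+ 2 = r ^+ 2) -> 0 < k ->
  (forall j, j != j0 -> wvar (fun x => tnth (Z x) j) <= k ^+ 4) ->
  exists p rho : R, [/\ 0 <= p <= 1, 0 <= rho <= r &
    forall t, `|Ex P (fun x => w x * expR (t * tnth (Z x) j0)) -
              (p * expR (t * rho) + (1 - p) * expR (- (t * rho)))| <=
      k * (`|t| * expR (`|t| * r) * (1 + 4 * r * n%:R))].
Proof.
move=> bZ r0 Zr k0 V.
have Zle x i : `|tnth (Z x) i| <= r.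
  rewrite -(ler_pXn2r (n := 2))// ?nnegrE// real_normK ?num_real// -(Zr x).
  by rewrite (bigD1 i)//= lerDl sumr_ge0// => j _; exact: sqr_ge0.
pose c j := wmean (fun x => tnth (Z x) j).
have cle j : `|c j| <= r.
  rewrite ler_norml -(Ew_cst (- r)) -{2}(Ew_cst r).
  have b (y : R) : bmf (fun _ : T => y) by exact: bmf_cst.
  by rewrite !le_Ew// => x; have := Zle x j; rewrite ler_norml => /andP[].
have c2 j : c j ^+ 2 <= Ew (fun x => tnth (Z x) j ^+ 2).
  have : 0 <= Ew (fun x => (tnth (Z x) j - c j) ^+ 2).
    by apply: Ex_ge0 => x; rewrite mulr_ge0// sqr_ge0.
  rewrite (_ : Ew _ = Ew (fun x => tnth (Z x) j ^+ 2 + (- (2 * c j) * tnth (Z x) j + c j ^+ 2))); last first.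
    by apply: eq_Ex => x; congr (_ * _); ring.
  rewrite EwD; [|exact: bmfX|by apply: bmfD; [exact: bmfZ|exact: bmf_cst]].
  rewrite EwD; [|exact: bmfZ|exact: bmf_cst].
  rewrite EwZ// Ew_cst (_ : Ew (fun x => tnth (Z x) j) = c j)//; nra.
pose r2 := r ^+ 2 - \sum_(j | j != j0) c j ^+ 2.
(* By [c2] each squared mean is at most the mean square, and the mean squares sum to at most
   [r ^+ 2]. *)
have r20 : 0 <= r2.
  rewrite subr_ge0; apply: (@le_trans _ _ (Ew (fun x => \sum_(j | j != j0) tnth (Z x) j ^+ 2))).
    rewrite Ew_sum; last by move=> j; exact: bmfX.
    exact: ler_sum.
  rewrite -(Ew_cst (r ^+ 2)); apply: le_Ew.
  - by apply: bmf_sum => j; exact: bmfX.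
  - exact: bmf_cst.
  - by move=> x; rewrite -(Zr x) [leRHS](bigD1 j0)//= lerDr sqr_ge0.
pose rho := Num.sqrt r2.
have rho0 : 0 <= rho by exact: sqrtr_ge0.
have rho2 : rho ^+ 2 = r2 by rewrite sqr_sqrtr.
have rhor : rho <= r.
  rewrite -(ler_pXn2r (n := 2))// ?nnegrE// rho2 /r2 gerBl sumr_ge0// => j _; exact: sqr_ge0.
pose pos x := 0 < tnth (Z x) j0.
pose p := Ew (fun x => (pos x)%:R).
have bpos : bmf (fun x => (pos x)%:R : R).
  by apply: bmf_bool; apply: measurable_fun_ltr => //; exact: bmf_meas.
have p0 : 0 <= p by apply: Ex_ge0 => x; rewrite mulr_ge0.
have p1 : p <= 1.
  rewrite -[leRHS](Ew_cst 1); apply: le_Ew => //; first exact: bmf_cst.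
  by move=> x; case: (pos x).
exists p, rho; rewrite p0 p1 rho0 rhor; split => // t.
pose D x : R := `| `|tnth (Z x) j0| - rho |.
have bD : bmf D by apply/bmf_abs/bmfB; [exact: bmf_abs|exact: bmf_cst].
have D0 x : 0 <= D x by exact: normr_ge0.
(* For [rho >= 0], [| |z| - rho | <= |z| + rho], so the squared distance is at most [|z^2 - rho^2|],
   which the sphere equation turns into deviations of the other coordinates. *)
have D2 x : D x ^+ 2 <= 2 * r * \sum_(j | j != j0) `|tnth (Z x) j - c j|.
  apply: (@le_trans _ _ `|tnth (Z x) j0 ^+ 2 - rho ^+ 2|).
    have -> : tnth (Z x) j0 ^+ 2 - rho ^+ 2 = (`|tnth (Z x) j0| - rho) * (`|tnth (Z x) j0| + rho).
      by rewrite -[X in X - _](real_normK (num_real (tnth (Z x) j0))); ring.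
    rewrite normrM expr2 ler_wpM2l ?normr_ge0// /D.
    by rewrite [leRHS]ger0_norm ?addr_ge0// (le_trans (ler_normB _ _))// normr_id (ger0_norm rho0).
  have -> : tnth (Z x) j0 ^+ 2 - rho ^+ 2 = \sum_(j | j != j0) (c j ^+ 2 - tnth (Z x) j ^+ 2).
    by rewrite rho2 /r2 -(Zr x) (bigD1 j0)//= sumrB; ring.
  rewrite mulr_sumr; apply: le_trans (ler_norm_sum _ _ _) _; apply: ler_sum => j _.
  have -> : c j ^+ 2 - tnth (Z x) j ^+ 2 = - ((tnth (Z x) j + c j) * (tnth (Z x) j - c j)) by ring.
  rewrite normrN normrM ler_wpM2r// (le_trans (ler_normD _ _))//.
  by have := Zle x j; have := cle j; lra.
(* The two square roots are linearised by [D <= k + D^2 / k] and [|y| <= k^2 + y^2 / k^2]. With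
   variances at most [k ^+ 4], each summand has mean at most [2 * k ^+ 2], whence the constant
   [4 * r * n]. *)
have Dk x : D x <= k + 2 * r / k * \sum_(j | j != j0) (k ^+ 2 + (tnth (Z x) j - c j) ^+ 2 / k ^+ 2).
  apply: (@le_trans _ _ (k + D x ^+ 2 / k)).
    have : 0 <= (D x - k) ^+ 2 / k + D x.
      by apply: addr_ge0 => //; apply: divr_ge0; [exact: sqr_ge0|exact: ltW].
    rewrite (_ : (D x - k) ^+ 2 / k + D x = k + D x ^+ 2 / k - D x) ?subr_ge0//.
    by field; rewrite gt_eqF.
  rewrite lerD2l (mulrAC (2 * r)) ler_pM2r ?invr_gt0//.
  apply: le_trans (D2 x) _; rewrite ler_wpM2l ?mulr_ge0//; apply: ler_sum => j _.
  move: (tnth (Z x) j - c j) => y.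
  have k2 : 0 < k ^+ 2 by rewrite exprn_gt0.
  rewrite -(real_normK (num_real y)).
  have : 0 <= (`|y| - k ^+ 2) ^+ 2 / k ^+ 2 + `|y|.
    by apply: addr_ge0 => //; apply: divr_ge0; [exact: sqr_ge0|exact: ltW].
  rewrite (_ : (`|y| - k ^+ 2) ^+ 2 / k ^+ 2 + `|y| = k ^+ 2 + `|y| ^+ 2 / k ^+ 2 - `|y|) ?subr_ge0//.
  by field; rewrite gt_eqF.
have bV j : bmf (fun x => (tnth (Z x) j - c j) ^+ 2) by apply/bmfX/bmfB => //; exact: bmf_cst.
have bS j : bmf (fun x => k ^+ 2 + (tnth (Z x) j - c j) ^+ 2 / k ^+ 2).
  by apply: bmfD; [exact: bmf_cst|apply: bmfM; [exact: bV|exact: bmf_cst]].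
have ED : Ew D <= k * (1 + 4 * r * n%:R).
  have bb : bmf (fun x => \sum_(j | j != j0) (k ^+ 2 + (tnth (Z x) j - c j) ^+ 2 / k ^+ 2)).
    exact: bmf_sum.
  apply: le_trans (le_Ew bD _ Dk) _; first by apply: bmfD; [exact: bmf_cst|exact: bmfZ].
  rewrite EwD; [|exact: bmf_cst|exact: bmfZ].
  rewrite Ew_cst EwZ// Ew_sum//.
  have Vj j : j != j0 -> Ew (fun x => k ^+ 2 + (tnth (Z x) j - c j) ^+ 2 / k ^+ 2) <= 2 * k ^+ 2.
    move=> jj0; rewrite EwD; [|exact: bmf_cst|by apply: bmfM; [exact: bV|exact: bmf_cst]].
    rewrite Ew_cst; under [X in _ + X]eq_Ex do rewrite mulrA.
    rewrite ExZr; last exact: bmfM.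
    have := V j jj0; rewrite /wvar -/(c j) => Vj.
    rewrite mulr_natl mulr2n lerD2l ler_pdivrMr ?exprn_gt0//.
    by apply: le_trans Vj _; rewrite -exprD.
  have S : \sum_(j | j != j0) Ew (fun x => k ^+ 2 + (tnth (Z x) j - c j) ^+ 2 / k ^+ 2) <=
      n%:R * (2 * k ^+ 2).
    apply: (@le_trans _ _ (\sum_(j | j != j0) 2 * k ^+ 2)); first exact: ler_sum.
    apply: (@le_trans _ _ (\sum_(j < n) 2 * k ^+ 2)).
      by rewrite [leRHS](bigD1 j0)//= lerDr mulr_ge0// sqr_ge0.
    by rewrite sumr_const card_ord [leRHS]mulr_natl.
  have -> : k * (1 + 4 * r * n%:R) = k + 2 * r / k * (n%:R * (2 * k ^+ 2)).
    by field; rewrite gt_eqF.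
  by rewrite lerD2l ler_wpM2l// divr_ge0 ?mulr_ge0// ltW.
(* The coordinate is replaced by [rho] or [- rho] according to its sign; the Lipschitz bound for the
   exponential makes the error proportional to [D]. *)
pose g x := (pos x)%:R * expR (t * rho) + (1 - (pos x)%:R) * expR (- (t * rho)).
have bg : bmf g.
  have b1 : bmf (fun x => 1 - (pos x)%:R : R) by apply: bmfB => //; exact: bmf_cst.
  by apply: bmfD; apply: bmfM => //; exact: bmf_cst.
have Eg : Ew g = p * expR (t * rho) + (1 - p) * expR (- (t * rho)).
  have b1 : bmf (fun x => 1 - (pos x)%:R : R) by apply: bmfB => //; exact: bmf_cst.
  have EwZr c' h : bmf h -> Ew (fun x => h x * c') = Ew h * c'.
    by move=> bh; rewrite mulrC -EwZ//; apply: eq_Ex => x; rewrite (mulrC c').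
  rewrite EwD; [|by apply: bmfM => //; exact: bmf_cst..].
  rewrite !EwZr//; congr (_ + _ * _); rewrite EwB ?Ew_cst//; exact: bmf_cst.
have be : bmf (fun x => expR (t * tnth (Z x) j0)) by apply/bmf_expR/bmfZ.
rewrite -Eg -EwB//.
have gD x : `|expR (t * tnth (Z x) j0) - g x| <= `|t| * expR (`|t| * r) * D x.
  have tZ : `|t * tnth (Z x) j0| <= `|t| * r by rewrite normrM ler_wpM2l.
  have tr : `|t * rho| <= `|t| * r by rewrite normrM ler_wpM2l// ger0_norm.
  rewrite /g /D mulrAC; case: (boolP (pos x)) => [Zp|].
    rewrite mul1r subrr mul0r addr0 (le_trans (expR_lip tZ tr))//.
    by rewrite -mulrBr normrM (gtr0_norm Zp).
  rewrite /pos -leNgt => Zn.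
  rewrite mul0r add0r subr0 mul1r (le_trans (expR_lip (b := - (t * rho)) tZ _)) ?normrN//.
  by rewrite opprK -mulrDr normrM (ler0_norm Zn) -opprD normrN.
have bDt : bmf (fun x => `|t| * expR (`|t| * r) * D x) by exact: bmfZ.
have bd : bmf (fun x => expR (t * tnth (Z x) j0) - g x) by exact: bmfB.
have le1 : `|Ew (fun x => expR (t * tnth (Z x) j0) - g x)| <= Ew (fun x => `|t| * expR (`|t| * r) * D x).
  rewrite ler_norml -mulN1r -EwZ//; apply/andP; split; apply: le_Ew => //.
  - exact: bmfZ.
  - by move=> x; rewrite mulN1r; have := gD x; rewrite ler_norml => /andP[].
  - by move=> x; have := gD x; rewrite ler_norml => /andP[].
apply: (le_trans le1); rewrite EwZ// mulrC [leRHS]mulrCA.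
by rewrite mulrC ler_wpM2l ?mulr_ge0 ?expR_ge0.
Qed.

End weights.

Section tilting.
Context d (T : measurableType d) (R : realType) (P : probability T R) (n : nat).
Variables (Z : T -> n.-tuple R) (r : R).
Hypotheses (mZ : measurable_fun setT Z) (r0 : 0 <= r)
  (Zr : forall x, \sum_i tnth (Z x) i ^+ 2 = r ^+ 2).
Implicit Types s : 'I_n -> R.

Lemma sphere_coord_le x i : `|tnth (Z x) i| <= r.
Proof.
rewrite -(ler_pXn2r (n := 2))// ?nnegrE// real_normK ?num_real// -(Zr x).
by rewrite (bigD1 i)//= lerDl sumr_ge0// => j _; exact: sqr_ge0.
Qed.

Lemma sphere_bounded : bounded_tuple Z.
Proof. by exists r => x i; exact: sphere_coord_le. Qed.

Definition mgf s : R := Ex P (fun x => expR (dot s (Z x))).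

Let bdot s : bmf (fun x => dot s (Z x)).
Proof. exact: bmf_dot mZ sphere_bounded. Qed.

Let dot_le s x : `|dot s (Z x)| <= r * \sum_i `|s i|.
Proof.
rewrite mulr_sumr; apply: le_trans (ler_norm_sum _ _ _) _; apply: ler_sum => i _.
by rewrite normrM mulrC ler_wpM2r// sphere_coord_le.
Qed.

Lemma mgf_gt0 s : 0 < mgf s.
Proof.
apply: (@lt_le_trans _ _ (Ex P (fun=> expR (- (r * \sum_i `|s i|))))).
  by rewrite Ex_cst expR_gt0.
apply: le_Ex; [exact: bmf_cst|exact: bmf_expR|move=> x].
by rewrite ler_expR; have := dot_le s x; rewrite ler_norml => /andP[].
Qed.

Lemma ln_mgf_le s : ln (mgf s) <= r * \sum_i `|s i|.
Proof.
rewrite -ler_expR lnK ?posrE ?mgf_gt0// -[leRHS](Ex_cst P).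
apply: le_Ex; [exact: bmf_expR|exact: bmf_cst|move=> x].
by rewrite ler_expR (le_trans (ler_norm _)).
Qed.

(** The density of the exponential tilt (Esscher transform) of the law of [Z] in direction [s]. *)
Definition tiltw s x := expR (dot s (Z x)) / mgf s.

Lemma bmf_tiltw s : bmf (tiltw s).
Proof. by apply: bmfM; [exact: bmf_expR|exact: bmf_cst]. Qed.

Lemma tiltw_ge0 s x : 0 <= tiltw s x.
Proof. by rewrite divr_ge0 ?expR_ge0// ltW// mgf_gt0. Qed.

Lemma Ex_tiltw s : Ex P (tiltw s) = 1.
Proof. by rewrite ExZr ?divff ?gt_eqF ?mgf_gt0//; exact: bmf_expR. Qed.

Lemma Ex_tiltw_expR s j c :
  Ex P (fun x => tiltw s x * expR (c * tnth (Z x) j)) = mgf (shift_at s j c) / mgf s.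
Proof.
rewrite -ExZr; last exact: bmf_expR.
by apply: eq_Ex => x; rewrite dot_shift expRD /tiltw mulrAC.
Qed.

Lemma wvar_ge0 s j : 0 <= wvar P (tiltw s) (fun x => tnth (Z x) j).
Proof. by apply: Ex_ge0 => x; rewrite mulr_ge0 ?sqr_ge0 ?tiltw_ge0. Qed.

(** Under the tilt, Laplace transforms of coordinate [j] at 1 and -1 are quotients of [mgf] at
    points shifted by one unit, so the logarithm of [wvar_le_laplace] is a second difference. *)
Lemma ln_wvar_le s j :
  ln (1 + wvar P (tiltw s) (fun x => tnth (Z x) j) / 4) <=
  ln (mgf (shift_at s j 1)) + ln (mgf (shift_at s j (-1))) - 2 * ln (mgf s).
Proof.
have M0 := mgf_gt0; have V0 := wvar_ge0 s j.
have := wvar_le_laplace (bmf_tiltw s) (tiltw_ge0 s) (Ex_tiltw s) (bmf_coord j mZ sphere_bounded).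
have -> : Ex P (fun x => tiltw s x * expR (tnth (Z x) j)) = mgf (shift_at s j 1) / mgf s.
  by rewrite -Ex_tiltw_expR; apply: eq_Ex => x; rewrite mul1r.
have -> : Ex P (fun x => tiltw s x * expR (- tnth (Z x) j)) = mgf (shift_at s j (-1)) / mgf s.
  by rewrite -Ex_tiltw_expR; apply: eq_Ex => x; rewrite mulN1r.
move=> le; have V4 : 0 < 1 + wvar P (tiltw s) (fun x => tnth (Z x) j) / 4.
  by apply: ltr_wpDr => //; exact: divr_ge0.
rewrite -ler_ln ?posrE// ?mulr_gt0 ?divr_gt0 ?invr_gt0// in le.
rewrite lnM ?posrE ?divr_gt0// !ln_div ?posrE// in le; lra.
Qed.

End tilting.

(** The Laplace transform at [t] of the law with mass [p] at [rho] and [1 - p] at [- rho]. *)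
Definition two_point (R : realType) (p rho t : R) : R :=
  p * expR (t * rho) + (1 - p) * expR (- (t * rho)).

Lemma cvg_two_point (R : realType) (T : Type) (F : set_system T) (FF : Filter F)
    (a b : T -> R) (p rho t : R) : a x @[x --> F] --> p -> b x @[x --> F] --> rho ->
  two_point (a x) (b x) t @[x --> F] --> two_point p rho t.
Proof.
move=> ap brho.
have tb : t * b x @[x --> F] --> t * rho by exact: cvgMl_tmp.
have cexp (c : T -> R) y : c x @[x --> F] --> y -> expR (c x) @[x --> F] --> expR y.
  by move=> cy; apply: continuous_cvg => //; exact: continuous_expR.
apply: cvgD; apply: cvgM => //; try exact: cexp.
  by apply: cvgB => //; exact: cvg_cst.
by apply: cexp; exact: cvgN.
Qed.

(** * Passage to the limit in the tilted laws *)

Section two_point_limit.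
Context d1 d2 (T1 : measurableType d1) (T2 : measurableType d2) (R : realType) (n : nat).
Variables (P1 : probability T1 R) (P2 : probability T2 R).
Variables (Z1 : T1 -> n.-tuple R) (Z2 : T2 -> n.-tuple R) (r1 r2 : R).
Hypotheses (mZ1 : measurable_fun setT Z1) (mZ2 : measurable_fun setT Z2).
Hypotheses (r10 : 0 <= r1) (r20 : 0 <= r2).
Hypotheses (Z1r : forall x, \sum_i tnth (Z1 x) i ^+ 2 = r1 ^+ 2)
  (Z2r : forall x, \sum_i tnth (Z2 x) i ^+ 2 = r2 ^+ 2).

(** The second difference of the sum of logarithms is small, and each of its two parts is
    nonnegative since it dominates some [ln (1 + v / 4)]; so both variances are small at one common
    [s]. *)
Lemma tilt_concentration (j0 : 'I_n) (k : R) : 0 < k ->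
  exists s, s j0 = 0 /\ exists p1 rho1 p2 rho2 : R,
  [/\ [/\ 0 <= p1 <= 1, 0 <= rho1 <= r1, 0 <= p2 <= 1 & 0 <= rho2 <= r2],
   (forall t, `|mgf P1 Z1 (shift_at s j0 t) / mgf P1 Z1 s - two_point p1 rho1 t| <=
      k * (`|t| * expR (`|t| * r1) * (1 + 4 * r1 * n%:R))) &
   (forall t, `|mgf P2 Z2 (shift_at s j0 t) / mgf P2 Z2 s - two_point p2 rho2 t| <=
      k * (`|t| * expR (`|t| * r2) * (1 + 4 * r2 * n%:R)))].
Proof.
move=> k0; have k40 : 0 < k ^+ 4 by rewrite exprn_gt0.
pose G s := ln (mgf P1 Z1 s) + ln (mgf P2 Z2 s).
(* [delta] is chosen so that [4 * delta] equals [ln (1 + v / 4)] at the target variance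
   [v = k ^+ 4]. *)
have dl0 : 0 < ln (1 + k ^+ 4 / 4) / 4.
  by rewrite divr_gt0// ln_gt0// ltrDl divr_gt0.
have GK s : G s <= (r1 + r2) * \sum_i `|s i| by rewrite mulrDl lerD// ln_mgf_le.
have [s [s0 sP]] := small_second_difference j0 (addr_ge0 r10 r20) dl0 GK.
exists s; split => //.
have V j : j != j0 -> wvar P1 (tiltw P1 Z1 s) (fun x => tnth (Z1 x) j) <= k ^+ 4 /\
    wvar P2 (tiltw P2 Z2 s) (fun x => tnth (Z2 x) j) <= k ^+ 4.
  move=> jj0; have := sP j jj0; rewrite /G (mulrC 4) divfK ?pnatr_eq0// => le.
  have V1 := ln_wvar_le P1 mZ1 r10 Z1r s j; have V2 := ln_wvar_le P2 mZ2 r20 Z2r s j.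
  have W1 := wvar_ge0 P1 mZ1 r10 Z1r s j; have W2 := wvar_ge0 P2 mZ2 r20 Z2r s j.
  have suf (v : R) : 0 <= v -> ln (1 + v / 4) <= ln (1 + k ^+ 4 / 4) -> v <= k ^+ 4.
    move=> v0; rewrite ler_ln ?posrE ?ltr_wpDr ?divr_ge0 ?(ltW k40)//.
    by rewrite lerD2l ler_pM2r// invr_gt0.
  have L1 : 0 <= ln (1 + wvar P1 (tiltw P1 Z1 s) (fun x => tnth (Z1 x) j) / 4).
    by apply: ln_ge0; rewrite lerDl divr_ge0.
  have L2 : 0 <= ln (1 + wvar P2 (tiltw P2 Z2 s) (fun x => tnth (Z2 x) j) / 4).
    by apply: ln_ge0; rewrite lerDl divr_ge0.
  move: L1 L2 V1 V2 le => L1 L2 V1 V2 le.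
  by split; apply: suf => //; lra.
have [p1 [rho1 [hp1 hr1 E1]]] := sphere_concentration (bmf_tiltw P1 mZ1 r10 Z1r s)
  (tiltw_ge0 P1 mZ1 r10 Z1r s) (Ex_tiltw P1 mZ1 r10 Z1r s)
  (fun i => bmf_coord i mZ1 (sphere_bounded r10 Z1r)) r10 Z1r k0 (fun j h => (V j h).1).
have [p2 [rho2 [hp2 hr2 E2]]] := sphere_concentration (bmf_tiltw P2 mZ2 r20 Z2r s)
  (tiltw_ge0 P2 mZ2 r20 Z2r s) (Ex_tiltw P2 mZ2 r20 Z2r s)
  (fun i => bmf_coord i mZ2 (sphere_bounded r20 Z2r)) r20 Z2r k0 (fun j h => (V j h).2).
exists p1, rho1, p2, rho2; split => // t.
  by rewrite -(Ex_tiltw_expR P1 mZ1 r10 Z1r); exact: E1.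
by rewrite -(Ex_tiltw_expR P2 mZ2 r20 Z2r); exact: E2.
Qed.

Hypothesis cross : forall s : 'I_n -> R,
  mgf P1 Z1 s * \prod_j Ex P2 (fun x => expR (s j * tnth (Z2 x) j)) =
  mgf P2 Z2 s * \prod_j Ex P1 (fun x => expR (s j * tnth (Z1 x) j)).

Let marg d (T : measurableType d) (P : probability T R) (Z : T -> n.-tuple R) j (t : R) :=
  Ex P (fun x => expR (t * tnth (Z x) j)).

(** The quotient of [cross] at the shifted point by [cross] at [s]: the marginals of the other
    coordinates cancel, and those of [j0] at [s] are 1 because [s j0 = 0]. *)
Let cross_ratio j0 s t : s j0 = 0 ->
  mgf P1 Z1 (shift_at s j0 t) / mgf P1 Z1 s * marg P2 Z2 j0 t =
  mgf P2 Z2 (shift_at s j0 t) / mgf P2 Z2 s * marg P1 Z1 j0 t.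
Proof.
move=> s0.
have M1 := mgf_gt0 P1 mZ1 r10 Z1r s; have M2 := mgf_gt0 P2 mZ2 r20 Z2r s.
have E d (T : measurableType d) (P : probability T R) (Z : T -> n.-tuple R) c :
    \prod_j Ex P (fun x => expR (shift_at s j0 c j * tnth (Z x) j)) =
    marg P Z j0 c * \prod_(j | j != j0) marg P Z j (s j).
  rewrite (bigD1 j0)//=; congr (_ * _).
    by rewrite /shift_at eqxx s0 add0r.
  by apply: eq_bigr => j /negbTE jj0; rewrite /shift_at jj0 addr0.
have m0 d (T : measurableType d) (P : probability T R) (Z : T -> n.-tuple R) : marg P Z j0 0 = 1.
  by rewrite /marg; under eq_Ex do rewrite mul0r expR0; rewrite Ex_cst.
have sh0 : shift_at s j0 0 = s.
  by apply/funext => i; rewrite /shift_at; case: ifP; rewrite addr0.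
have := cross (shift_at s j0 0); have := cross (shift_at s j0 t).
rewrite !E !m0 sh0 !mul1r.
set K1 := (X in _ = _ * (_ * X) -> _); set K2 := \prod_(j | _) _ => Et E0.
have K20 : K2 != 0.
  apply/prodf_neq0 => j _; rewrite gt_eqF// /marg.
  rewrite (_ : Ex _ _ = mgf P2 Z2 (fun i => if i == j then s j else 0)); first exact: mgf_gt0 mZ2 r20 Z2r _.
  by apply: eq_Ex => x; rewrite dot_basis.
apply: (mulIf K20); apply: (mulIf (lt0r_neq0 M2)); apply: (mulIf (lt0r_neq0 M1)).
transitivity (mgf P1 Z1 (shift_at s j0 t) * (marg P2 Z2 j0 t * K2) * mgf P2 Z2 s).
  by field; rewrite gt_eqF.
rewrite Et.
transitivity (mgf P2 Z2 (shift_at s j0 t) * marg P1 Z1 j0 t * (mgf P2 Z2 s * K1)); first by ring.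
by rewrite -E0; field; rewrite gt_eqF.
Qed.

(** For each [k] the tilted laws satisfy the identity up to an error of order [1 / (k + 1)]. Nothing
    is known about the convergence of the tilts, but the parameters of the two-point laws lie in a
    compact box. *)
Lemma two_point_marginal (j0 : 'I_n) : exists p1 rho1 p2 rho2 : R,
  [/\ 0 <= p1 <= 1, 0 <= p2 <= 1 &
  forall t, two_point p1 rho1 t * marg P2 Z2 j0 t = two_point p2 rho2 t * marg P1 Z1 j0 t].
Proof.
pose C (t r : R) : R := `|t| * expR (`|t| * r) * (1 + 4 * r * n%:R).
pose B (t : R) : R := C t r1 * `|marg P2 Z2 j0 t| + C t r2 * `|marg P1 Z1 j0 t|.
have /choice[v vP] (k : nat) : exists v : (R * R) * (R * R),
    [/\ [/\ 0 <= v.1.1 <= 1, 0 <= v.1.2 <= r1, 0 <= v.2.1 <= 1 & 0 <= v.2.2 <= r2] &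
     forall t, `|two_point v.1.1 v.1.2 t * marg P2 Z2 j0 t - two_point v.2.1 v.2.2 t * marg P1 Z1 j0 t|
       <= k.+1%:R^-1 * B t].
  have k0 : 0 < k.+1%:R^-1 :> R by rewrite invr_gt0.
  have [s [s0 [p1 [rho1 [p2 [rho2 [hp E1 E2]]]]]]] := tilt_concentration j0 k0.
  exists ((p1, rho1), (p2, rho2)); split => //= t.
  have cr := cross_ratio t s0.
  move: (E1 t) (E2 t) cr; rewrite -/(C t r1) -/(C t r2).
  move: (mgf P1 _ _ / _) (mgf P2 _ _ / _) => u1 u2 h1 h2 cr.
  have -> : two_point p1 rho1 t * marg P2 Z2 j0 t - two_point p2 rho2 t * marg P1 Z1 j0 t =
    (u2 - two_point p2 rho2 t) * marg P1 Z1 j0 t - (u1 - two_point p1 rho1 t) * marg P2 Z2 j0 t.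
    by rewrite !mulrBl cr; ring.
  rewrite (le_trans (ler_normB _ _))// !normrM addrC.
  have -> : k.+1%:R^-1 * B t = k.+1%:R^-1 * C t r1 * `|marg P2 Z2 j0 t| +
      k.+1%:R^-1 * C t r2 * `|marg P1 Z1 j0 t| by rewrite mulrDr !mulrA.
  by apply: lerD; apply: ler_wpM2r.
pose A : set ((R * R) * (R * R)) := (`[0, 1] `*` `[0, r1]) `*` (`[0, 1] `*` `[0, r2]).
have cA : compact A.
  by apply: compact_setX; apply: compact_setX; exact: segment_compact.
have FA : \forall k \near \oo, A (v k).
  apply: nearW => k; have [[a b c e] _] := vP k.
  by split; split; rewrite /= in_itv.
(* The cluster point is fixed before [t], so a single choice of parameters serves all [t]. *)
have [w [[[w1 w2] [w3 w4]] cl]] := cA (v @ \oo) _ FA.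
exists w.1.1, w.1.2, w.2.1, w.2.2; move: w1 w3; rewrite /= !in_itv/= => w1 w3.
split => // t; apply/eqP; rewrite -subr_eq0; apply/negPn/negP => ne.
pose Phi (x : (R * R) * (R * R)) :=
  two_point x.1.1 x.1.2 t * marg P2 Z2 j0 t - two_point x.2.1 x.2.2 t * marg P1 Z1 j0 t.
have cPhi : Phi x @[x --> w] --> Phi w.
  apply: cvgB; apply: cvgMr_tmp; apply: cvg_two_point.
  - by apply: (@cvg_comp _ _ _ fst fst _ (nbhs w.1)); exact: cvg_fst.
  - by apply: (@cvg_comp _ _ _ fst snd _ (nbhs w.1)); [exact: cvg_fst|exact: cvg_snd].
  - by apply: (@cvg_comp _ _ _ snd fst _ (nbhs w.2)); [exact: cvg_snd|exact: cvg_fst].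
  - by apply: (@cvg_comp _ _ _ snd snd _ (nbhs w.2)); exact: cvg_snd.
have e0 : 0 < `|Phi w| / 2 by rewrite divr_gt0// normr_gt0.
have U1 : nbhs w [set x | `|Phi x| > `|Phi w| / 2].
  by apply: (cvgr_gt `|Phi w| (cvg_norm cPhi)); rewrite ltr_pdivrMr// mulr_natr mulr2n ltrDl normr_gt0.
(* A nonzero value at [w] would persist near [w], whereas along the sequence the values tend to
   0. *)
have U2 : \forall k \near \oo, `|Phi (v k)| <= `|Phi w| / 2.
  have c0 : k.+1%:R^-1 * B t @[k --> \oo] --> (0 : R).
    by rewrite -(mul0r (B t)); apply: cvgMr_tmp; exact: cvg_harmonic.
  have U3 : \forall k \near \oo, k.+1%:R^-1 * B t < `|Phi w| / 2 by exact: (cvgr_lt 0 c0).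
  apply: filterS U3 => k /= Bk.
  by apply: le_trans (ltW Bk); exact: (vP k).2.
by have [x [/= h1 h2]] := cl [set x | `|Phi x| <= `|Phi w| / 2] _ U2 U1; move: h2; rewrite ltNge h1.
Qed.

End two_point_limit.

(** * Spherical coordinates and null sets *)

Section spherical_coordinates.
Context (R : realType).
Implicit Types (th c : nat -> R).

(** The angles form an infinite sequence, already scaled, so that lowering the dimension is the
    shift [th \o succn]. *)
Definition sph N th i : R :=
  (\prod_(0 <= l < i) sin (th l)) * (if (i < N)%N then cos (th i) else 1).

Lemma sphS N th i : sph N.+1 th i.+1 = sin (th 0%N) * sph N (th \o succn) i.
Proof.
by rewrite /sph big_nat_recl// ltnS /= mulrA.
Qed.

Lemma sph0 N th : sph N.+1 th 0 = cos (th 0%N).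
Proof. by rewrite /sph big_geq// mul1r. Qed.

Lemma sum_sph N th c : \sum_(i < N.+2) c i * sph N.+1 th i =
  c 0%N * cos (th 0%N) + sin (th 0%N) * \sum_(i < N.+1) c i.+1 * sph N (th \o succn) i.
Proof.
rewrite big_ord_recl /= sph0 mulr_sumr; congr (_ + _); apply: eq_bigr => i _.
by rewrite /bump /= add1n sphS mulrCA.
Qed.

Lemma sum_sph_sq N th : \sum_(i < N.+1) sph N th i ^+ 2 = 1.
Proof.
elim: N th => [|N IH] th.
  by rewrite big_ord_recl big_ord0 addr0 /sph big_geq// mul1r expr1n.
rewrite big_ord_recl /= sph0.
under eq_bigr do rewrite /bump /= add1n sphS exprMn.
by rewrite -mulr_sumr IH mulr1 cos2Dsin2.
Qed.

Lemma sphD N th j i : (j <= N)%N ->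
  sph N th (j + i) = (\prod_(0 <= l < j) sin (th l)) * sph (N - j) (th \o addn j) i.
Proof.
move=> jN; rewrite /sph (big_cat_nat (n := j)) ?leq_addr//= -mulrA; congr (_ * _).
rewrite ltn_subRL; congr (_ * _).
by rewrite -[X in \prod_(X <= _ < _) _]add0n big_addn addKn; apply: eq_bigr => l _; rewrite addnC.
Qed.

(** By [sphD], the coordinates from [j] on are the product of the first [j] sines times a full unit
    vector of lower dimension. *)
Lemma sum_sph_sq_tail N th j : (j <= N)%N ->
  \sum_(i < N.+1 | (j <= i)%N) sph N th i ^+ 2 = (\prod_(0 <= l < j) sin (th l)) ^+ 2.
Proof.
move=> jN.
rewrite -(big_mkord (fun i => j <= i)%N (fun i => sph N th i ^+ 2)).
rewrite (big_cat_nat (n := j)) ?(leqW jN)//= big_nat_cond big_pred0 ?add0r; last first.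
  by move=> i; apply/negbTE/negP => /andP[/andP[_ h1] h2]; move: h1; rewrite ltnNge h2.
rewrite -{1}(add0n j) big_addn big_mkord subSn//.
transitivity (\sum_(i < (N - j).+1) sph N th (i + j) ^+ 2).
  by apply: eq_bigl => i; rewrite leq_addl.
rewrite (eq_bigr (fun i : 'I_(N - j).+1 =>
    (\prod_(0 <= l < j) sin (th l)) ^+ 2 * sph (N - j) (th \o addn j) i ^+ 2)) => [|i _];
  last by rewrite addnC sphD// exprMn.
by rewrite -mulr_sumr sum_sph_sq mulr1.
Qed.

End spherical_coordinates.

Section null_sets.
Context (R : realType).
Let leb := (@lebesgue_measure R : {measure set (measurableTypeR R) -> \bar R}).
Let I01 := [set x : R | 0 <= x <= 1].

(** Suited to inner integrals of unknown measurability: every subset of a finite set is measurable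
    and null, so the restriction of [h] to it is measurable whatever [h] is. *)
Lemma integral_finite_support (F : set R) (h : R -> \bar R) : finite_set F ->
  (forall x, 0 <= h x)%E -> (forall x, I01 x -> ~ F x -> h x = 0%E) ->
  (\int[leb]_(x in I01) h x = 0)%E.
Proof.
move=> finF h0 hF.
have mF (A : set R) : A `<=` F -> measurable (A : set (measurableTypeR R)).
  move=> AF; apply: countable_measurable => //.
  exact/finite_set_countable/(sub_finite_set AF).
have cF (A : set R) : A `<=` F -> countable A.
  by move=> AF; exact/finite_set_countable/(sub_finite_set AF).
transitivity (\int[leb]_(x in I01 `&` F) h x)%E.
  rewrite integral_mkcond [RHS]integral_mkcond; apply: eq_integral => x _.
  rewrite !patchE; case: (asboolP (I01 x)) => xI; last first.
    by rewrite !memNset// => -[].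
  case: (asboolP (F x)) => xF; first by rewrite !mem_set.
  rewrite mem_set// memNset; first exact: hF.
  by move=> [].
apply: null_set_integral.
- by apply: mF => x [].
- by move=> _ Y mY; apply: mF => x [[]].
- by apply: countable_lebesgue_measure0; apply: cF => x [].
Qed.

(** On [[0, pi]] the arccosine gives the only candidate; when the angle covers a full circle, the
    reflection [x -> 1 - x] gives a second one. *)
Lemma finite_cos_fiber (a y : R) : a = pi \/ a = 2 * pi ->
  finite_set [set x | 0 <= x <= 1 /\ cos (a * x) = y].
Proof.
move=> ha; have p0 := pi_gt0 R.
apply: (@sub_finite_set _ _ ([set acos y / a] `|` [set 1 - acos y / a])); last first.
  by rewrite finite_setU; split; exact: finite_set1.
move=> x [/andP[x0 x1] cx].
have a0 : 0 < a by case: ha => ->; lra.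
have [xp|xp] := leP (a * x) pi.
  left => /=; rewrite -cx cosK; last by rewrite in_itv/= xp mulr_ge0// ltW.
  by rewrite mulrC mulKf// gt_eqF.
right => /=; case: ha => aE; first by move: xp; rewrite aE; nra.
have -> : acos y = a * (1 - x).
  rewrite -cx; have -> : cos (a * x) = cos (a * (1 - x)).
    have -> : a * (1 - x) = - (a * x) + pi *+ 2 by rewrite aE mulr2n; ring.
    by rewrite cosD2pi cosN.
  rewrite cosK// in_itv/=; apply/andP; split; first by rewrite mulr_ge0 ?subr_ge0 ?(ltW a0).
  by move: xp; rewrite mulrBr mulr1 aE; lra.
by rewrite mulrC mulKf ?gt_eqF//; ring.
Qed.

Lemma finite_trig_level (a al be k : R) : a = pi \/ a = 2 * pi -> al != 0 \/ be != 0 ->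
  finite_set [set x | 0 <= x <= 1 /\ al * cos (a * x) + be * sin (a * x) = k].
Proof.
move=> ha hab; set A := (X in finite_set X).
have q0 : 0 < al ^+ 2 + be ^+ 2.
  by case: hab => /eqP ne; have := sqr_ge0 al; have := sqr_ge0 be; nra.
have [->|[x' [x'01 x'k]]] : A = set0 \/ A !=set0.
- by apply/or_comm; have [|/nonemptyPn] := pselect (A !=set0); [left|right].
- exact: finite_set0.
(* Eliminating the sine leaves a quadratic equation for the cosine. Given one solution, with cosine
   [y'], Vieta's formula names the other root [z]. *)
pose y' := cos (a * x'); pose z := 2 * al * k / (al ^+ 2 + be ^+ 2) - y'.
apply: (@sub_finite_set _ _ ([set x | 0 <= x <= 1 /\ cos (a * x) = y'] `|`
  [set x | 0 <= x <= 1 /\ cos (a * x) = z])); last first.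
  by rewrite finite_setU; split; exact: finite_cos_fiber.
move=> x [x01 xk].
have quad t : al * cos (a * t) + be * sin (a * t) = k ->
    (al ^+ 2 + be ^+ 2) * cos (a * t) ^+ 2 - 2 * al * k * cos (a * t) = be ^+ 2 - k ^+ 2.
  have := cos2Dsin2 (a * t); move: (cos _) (sin _) => C S CS h; nra.
have := quad _ xk; have := quad _ x'k; rewrite -/y' => E1 E2.
have [e|ne] := eqVneq (cos (a * x)) y'; first by left.
right; split => //; rewrite /z.
apply: (mulIf (lt0r_neq0 q0)); rewrite mulrBl divfK ?gt_eqF//.
have : (cos (a * x) - y') * ((al ^+ 2 + be ^+ 2) * (cos (a * x) + y') - 2 * al * k) = 0 by nra.
move/eqP; rewrite mulf_eq0 subr_eq0 (negbTE ne)/= => /eqP; nra.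
Qed.

Lemma iint_eq0 n (g : seq R -> \bar R) : (forall s, size s = n -> g s = 0%E) ->
  iint (nseq n (leb, I01)) g = 0%E.
Proof.
move=> g0; rewrite (@iint_nseq_eq _ _ _ _ _ (fun=> 0%E)); last by move=> s sn _; exact: g0.
by elim: n {g0} => //= n IH; under eq_integral do rewrite IH; rewrite integral0.
Qed.

Lemma iint_ge0 n (g : seq R -> \bar R) : (forall s, 0 <= g s)%E -> (0 <= iint (nseq n (leb, I01)) g)%E.
Proof.
elim: n g => //= n IH g g0; apply: integral_ge0 => x _; exact: IH.
Qed.

(** Integrate over the first angle last. If a later coefficient is nonzero, then off the finitely
    many zeros of the first sine the inner set is a hyperplane section of lower dimension, at level
    [(k - c 0 cos) / sin]. Otherwise the equation only involves the first cosine. Each [a l] may be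
    either scale because after one step the leading scale is [pi]. *)
Lemma hyperplane_null N (a c : nat -> R) (k : R) :
  (forall l, a l = pi \/ a l = 2 * pi) -> (exists2 i, (i < N.+2)%N & c i != 0) ->
  iint (nseq N.+1 (leb, I01)) (fun s =>
    ((\sum_(i < N.+2) c i * sph N.+1 (fun l => a l * nth 0 s l) i == k)%R%:R)%:E) = 0%E.
Proof.
elim: N a c k => [|N IH] a c k ha [i iN ci].
  rewrite /=; apply: (@integral_finite_support
    [set x | 0 <= x <= 1 /\ c 0%N * cos (a 0%N * x) + c 1%N * sin (a 0%N * x) = k]).
  - apply: finite_trig_level => //; case: i iN ci => [|[|//]] _; [by left|by right].
  - by move=> x; rewrite lee_fin.
  - move=> x x01 nF; rewrite sum_sph/= big_ord_recl big_ord0 addr0 /sph big_geq//= mul1r mulr1.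
    by case: eqP => // h; exfalso; apply: nF; split => //; rewrite -h; ring.
have E g : iint (nseq N.+2 (leb, I01)) g =
    (\int[leb]_(x in I01) iint (nseq N.+1 (leb, I01)) (fun xs => g (x :: xs)))%E by [].
rewrite E.
have [[i' i'N ci']|tail0] := pselect (exists2 i, (i < N.+2)%N & c i.+1 != 0).
  apply: (@integral_finite_support [set x | 0 <= x <= 1 /\ 0 * cos (a 0%N * x) + 1 * sin (a 0%N * x) = 0]).
  - by apply: finite_trig_level => //; right; exact: oner_neq0.
  - by move=> x; apply: (@iint_ge0 N.+1) => s; rewrite lee_fin.
  - move=> x x01 nF.
    have sx : sin (a 0%N * x) != 0.
      by apply/eqP => s0; apply: nF; split => //; rewrite s0; ring.
    have := IH (a \o succn) (c \o succn) ((k - c 0%N * cos (a 0%N * x)) / sin (a 0%N * x))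
      (fun l => ha l.+1) (ex_intro2 _ _ i' i'N ci').
    move=> <-; apply: (@iint_nseq_eq R N.+1) => s sn _; rewrite sum_sph /=.
    congr (_%:R%:E); congr nat_of_bool.
    rewrite eq_sym [in RHS]eq_sym; apply/eqP/eqP => [->|<-].
      by rewrite addrC addKr mulrC mulKf.
    by field.
have c0 : c 0%N != 0.
  case: i iN ci => // i iN ci; exfalso; apply: tail0; by exists i.
apply: (@integral_finite_support
    [set x | 0 <= x <= 1 /\ c 0%N * cos (a 0%N * x) + 0 * sin (a 0%N * x) = k]).
- by apply: finite_trig_level => //; left.
- by move=> x; apply: (@iint_ge0 N.+1) => s; rewrite lee_fin.
- move=> x x01 nF; apply: (@iint_eq0 N.+1) => s sn; rewrite sum_sph /= big1 => [|j _].
    rewrite mulr0 addr0; case: eqP => // h; exfalso; apply: nF; split => //.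
    by rewrite -h; ring.
  have [->|cj] := eqVneq (c j.+1) 0; first by rewrite mul0r.
  by exfalso; apply: tail0; exists j.
Qed.

End null_sets.

(** * Matching two spherical laws *)

Section two_point_vector.
Context (R : realType).

(** The law lives on the line, as [exists_prodQ] requires: a Bernoulli variable is read as 0 or 1,
    and [be] decodes it at [1/2]. *)
Lemma exists_two_point (p rho : R) : 0 <= p <= 1 ->
  exists (Q : probability (measurableTypeR R) R) (be : R -> R), [/\ bmf (be : measurableTypeR R -> R),
    (forall h : R -> R, (forall x, 0 <= h x) ->
      Ex Q (fun x => h (be x)) = p * h rho + (1 - p) * h (- rho)) &
    exists b0, 0 < Ex Q (fun x => (be x == b0)%R%:R)].
Proof.
move=> p01; pose f (b : bool) : measurableTypeR R := b%:R.
have mf : measurable_fun setT f by [].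
have [Q [_ [QE _]]] := exists_pushforward (bernoulli_prob p) mf.
pose be (x : R) : R := if x < 2^-1 then - rho else rho.
have bbe : bmf (be : measurableTypeR R -> R).
  split; last first.
    by exists `|rho| => x; rewrite /be; case: ifP => _; rewrite ?normrN.
  apply: measurable_fun_ifT; try exact: measurable_cst.
  by apply: measurable_fun_ltr => //; exact: measurable_cst.
have E (h : R -> R) : (forall x, 0 <= h x) -> Ex Q (fun x => h (be x)) = p * h rho + (1 - p) * h (- rho).
  move=> h0; rewrite QE; last first.
    split; last first.
      exists (h rho + h (- rho)) => x; rewrite ger0_norm// /be.
      by case: ifP => _; rewrite ?lerDl ?lerDr.
    have -> : (fun x => h (be x)) = (fun x => if x < 2^-1 then h (- rho) else h rho).
      by apply/funext => x; rewrite /be; case: ifP.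
    apply: measurable_fun_ifT; try exact: measurable_cst.
    by apply: measurable_fun_ltr => //; exact: measurable_cst.
  rewrite Ex.unlock /Rintegral integral_bernoulli_prob//; last by move=> b; rewrite lee_fin.
  rewrite /f /be /= invr_gt0 ltr0n /=.
  by rewrite ltNge invf_le1 ?ler1n//= -!EFinM -EFinD.
exists Q, be; split => //.
have ind b0 x : 0 <= ((x == b0)%R%:R : R) by [].
have [p0|p0] := ltP 0 p.
  exists rho; rewrite (E (fun y => (y == rho)%R%:R))// eqxx mulr1.
  by rewrite ltr_wpDr// mulr_ge0// subr_ge0; case/andP: p01.
exists (- rho); rewrite (E (fun y => (y == - rho)%R%:R))// eqxx mulr1.
have -> : p = 0 by apply/eqP; rewrite eq_le p0; case/andP: p01.
by rewrite mul0r add0r subr0.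
Qed.

Lemma exists_two_point_vector n (p rho : 'I_n -> R) : (forall j, 0 <= p j <= 1) ->
  exists (P : probability (n.-tuple R) R) (B : n.-tuple R -> n.-tuple R),
  [/\ measurable_fun setT B, bounded_tuple B,
    (forall s, Ex P (fun x => expR (dot s (B x))) = \prod_j two_point (p j) (rho j) (s j)) &
    exists b0, 0 < Ex P (fun x => (B x == b0)%R%:R)].
Proof.
move=> p01.
have /choice[Q QP] j := exists_two_point (rho j) (p01 j).
have /choice[be beP] := QP.
have /choice[b0 b0P] j : exists b, 0 < Ex (Q j) (fun x => (be j x == b)%R%:R) by case: (beP j).
have [P [_ [PE _]]] := exists_prodQ Q.
exists P, (fun x => [tuple be j (tnth x j) | j < n]).
have bB j : bmf (fun x : n.-tuple R => be j (tnth x j)).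
  by have [b _ _] := beP j; apply: (bmf_comp _ b); exact: measurable_tnth.
split.
- apply/measurable_fun_tnthP => j.
  rewrite (_ : _ \o _ = fun x : n.-tuple R => be j (tnth x j)); first exact: bmf_meas (bB j).
  by apply/funext => x /=; rewrite tnth_mktuple.
- have /choice[K KP] j : exists K : R, forall x, `|be j x| <= K by have [[_ []]] := beP j; eauto.
  exists (\sum_j `|K j|) => x i; rewrite tnth_mktuple (le_trans (KP _ _))// (le_trans (ler_norm _))//.
  by rewrite (bigD1 i)//= lerDl sumr_ge0.
- move=> s; transitivity (Ex P (fun x => \prod_j expR (s j * be j (tnth x j)))).
    apply: eq_Ex => x; rewrite /dot expR_sum; apply: eq_bigr => j _.
    by rewrite tnth_mktuple.
  rewrite (PE (fun j x => expR (s j * be j x))); last first.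
    by move=> j; apply/bmf_expR/bmfZ; have [] := beP j.
  apply: eq_bigr => j _; have [_ Eb _] := beP j.
  rewrite (Eb (fun y => expR (s j * y))); last by move=> x; exact: expR_ge0.
  by rewrite /two_point mulrN.
- exists [tuple b0 j | j < n].
  have -> : Ex P (fun x => ([tuple be j (tnth x j) | j < n] == [tuple b0 j | j < n])%R%:R) =
      Ex P (fun x => \prod_j (be j (tnth x j) == b0 j)%R%:R).
    apply: eq_Ex => x; rewrite prodr_bool; congr (_%:R); congr nat_of_bool.
    apply/eqP/forallP => [h j|h]; last first.
      by apply: eq_from_tnth => j; rewrite !tnth_mktuple; exact/eqP.
    by have := congr1 (fun t => tnth t j) h; rewrite !tnth_mktuple => ->.
  rewrite (PE (fun j x => (be j x == b0 j)%R%:R)); first by apply: prodr_gt0.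
  move=> j; apply: bmf_bool; have [[mbe _] _ _] := beP j.
  by apply: measurable_fun_eqr => //; exact: measurable_cst.
Qed.

End two_point_vector.

Section sphere_matching.
Context d1 d2 (T1 : measurableType d1) (T2 : measurableType d2) (R : realType) (n : nat).
Variables (P1 : probability T1 R) (P2 : probability T2 R).
Variables (Z1 : T1 -> n.+1.-tuple R) (Z2 : T2 -> n.+1.-tuple R) (r1 r2 : R).
Hypotheses (mZ1 : measurable_fun setT Z1) (mZ2 : measurable_fun setT Z2).
Hypotheses (r10 : 0 <= r1) (r20 : 0 < r2).
Hypotheses (Z1r : forall x, \sum_i tnth (Z1 x) i ^+ 2 = r1 ^+ 2)
  (Z2r : forall x, \sum_i tnth (Z2 x) i ^+ 2 = r2 ^+ 2).

Definition null_hyperplanes d (T : measurableType d) (P : probability T R) m (Z : T -> m.-tuple R) :=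
  forall (c : 'I_m -> R) (k : R), (exists i, c i != 0) -> Ex P (fun x => (dot c (Z x) == k)%R%:R) = 0.

(** For [r1 = 0] the signal is a point and does charge hyperplanes; [sphere_matching] has to exclude
    that case before using [N1]. *)
Hypotheses (N1 : 0 < r1 -> null_hyperplanes P1 Z1) (N2 : null_hyperplanes P2 Z2).
Hypothesis cross : forall s : 'I_n.+1 -> R,
  mgf P1 Z1 s * \prod_j Ex P2 (fun x => expR (s j * tnth (Z2 x) j)) =
  mgf P2 Z2 s * \prod_j Ex P1 (fun x => expR (s j * tnth (Z1 x) j)).

Definition pr d (T : measurableType d) (P : probability T R) m (X : T -> m.-tuple R)
    (A : set (m.-tuple R)) : R :=
  Ex P (fun x => \1_A (X x)).

Lemma EFin_pr d (T : measurableType d) (P : probability T R) m (X : T -> m.-tuple R) A :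
  measurable_fun setT X -> measurable A -> (pr P X A)%:E = P (X @^-1` A).
Proof.
move=> mX mA; rewrite -Ex_indic//.
by rewrite -[X in measurable X]setTI; exact: mX.
Qed.

Lemma measurable_vadd d (T : measurableType d) m (X Y : T -> m.-tuple R) :
  measurable_fun setT X -> measurable_fun setT Y -> measurable_fun setT (fun x => vadd (X x) (Y x)).
Proof.
move=> mX mY; apply/measurable_fun_tnthP => i.
rewrite (_ : _ \o _ = fun x => tnth (X x) i + tnth (Y x) i); last first.
  by apply/funext => x /=; rewrite tnth_mktuple.
by apply: measurable_funD; exact: measurable_coord.
Qed.

Lemma dot_vadd m (s : 'I_m -> R) (x y : m.-tuple R) : dot s (vadd x y) = dot s x + dot s y.
Proof.
by rewrite /dot -big_split; apply: eq_bigr => i _; rewrite tnth_mktuple mulrDr.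
Qed.

Let cross_two_point : exists p1 rho1 p2 rho2 : 'I_n.+1 -> R,
  [/\ forall j, 0 <= p1 j <= 1, forall j, 0 <= p2 j <= 1 &
   forall s, mgf P1 Z1 s * \prod_j two_point (p2 j) (rho2 j) (s j) =
             mgf P2 Z2 s * \prod_j two_point (p1 j) (rho1 j) (s j)].
Proof.
have /choice[p1 H1] := two_point_marginal mZ1 mZ2 r10 (ltW r20) Z1r Z2r cross.
have /choice[rho1 H2] := H1; have /choice[p2 H3] := H2; have /choice[rho2 H4] := H3.
exists p1, rho1, p2, rho2; split.
- by move=> j; have [] := H4 j.
- by move=> j; have [] := H4 j.
move=> s; pose M1 := \prod_j Ex P1 (fun x => expR (s j * tnth (Z1 x) j)).
pose M2 := \prod_j Ex P2 (fun x => expR (s j * tnth (Z2 x) j)).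
have M10 : M1 != 0.
  apply/prodf_neq0 => j _.
  rewrite (_ : Ex _ _ = mgf P1 Z1 (fun i => if i == j then s j else 0)).
    by rewrite gt_eqF// (mgf_gt0 P1 mZ1 r10 Z1r).
  by apply: eq_Ex => x; rewrite dot_basis.
have E : (\prod_j two_point (p1 j) (rho1 j) (s j)) * M2 = (\prod_j two_point (p2 j) (rho2 j) (s j)) * M1.
  by rewrite -!big_split/=; apply: eq_bigr => j _; have [_ _ ->] := H4 j.
apply: (mulIf M10); rewrite -mulrA -E.
have := cross s; rewrite -/M1 -/M2 => C.
by rewrite mulrCA C mulrCA mulrA.
Qed.

Definition Sset m (b : m.-tuple R) (r : R) : set (m.-tuple R) :=
  [set y | \sum_i (tnth y i - tnth b i) ^+ 2 = r ^+ 2].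

Lemma measurable_Sset m (b : m.-tuple R) r : measurable (Sset b r).
Proof.
pose g (y : m.-tuple R) : R := \sum_i (tnth y i - tnth b i) ^+ 2.
have mg : measurable_fun setT g.
  apply: measurable_sum => i; apply: measurable_funX.
  by apply: measurable_funB => //; exact: measurable_tnth.
rewrite (_ : Sset b r = g @^-1` [set r ^+ 2]) //.
by rewrite -[X in measurable X]setTI; exact: mg.
Qed.

Lemma vaddNE m (x b b' : m.-tuple R) i : tnth (vadd x b) i - tnth b' i = tnth x i + (tnth b i - tnth b' i).
Proof. by rewrite tnth_mktuple addrA. Qed.

(** With [de = b - b'], the equation [|Z + de|^2 = r'^2] reads [r^2 + 2 de . Z + |de|^2 = r'^2] on
    the sphere of [Z]: a hyperplane if [de] is nonzero, a contradiction between radii if it is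
    zero. *)
Lemma sphere_null d (T : measurableType d) (P : probability T R) m (Z : T -> m.-tuple R) (r r' : R)
    (b b' : m.-tuple R) (A : set (m.-tuple R)) : measurable_fun setT Z -> measurable A ->
  (forall x, \sum_i tnth (Z x) i ^+ 2 = r ^+ 2) -> 0 <= r -> 0 <= r' ->
  null_hyperplanes P Z -> b != b' \/ r != r' ->
  A `<=` Sset b' r' -> pr P (fun x => vadd (Z x) b) A = 0.
Proof.
move=> mZ mA Zr r0 r'0 N H AS.
pose de i := tnth b i - tnth b' i.
have sumE x : \sum_i (tnth (vadd (Z x) b) i - tnth b' i) ^+ 2 =
    r ^+ 2 + (2 * dot de (Z x) + \sum_i de i ^+ 2).
  rewrite -(Zr x) /dot mulr_sumr -!big_split/=; apply: eq_bigr => i _.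
  by rewrite vaddNE /de; ring.
have mX : measurable_fun setT (fun x => vadd (Z x) b) by exact: measurable_vadd.
have bA : bmf (fun x => \1_A (vadd (Z x) b) : R) by apply: (bmf_comp mX); exact: bmf_indic.
have [bb|bb] := eqVneq b b'.
  have rr : r != r' by case: H => //; rewrite bb eqxx.
  rewrite /pr -[RHS](Ex_cst P 0); apply: eq_Ex => x; rewrite indicE memNset// => /AS.
  rewrite /Sset /= sumE (_ : dot de _ = 0); last first.
    by rewrite /dot big1// => i _; rewrite /de bb subrr mul0r.
  rewrite big1 ?mulr0 ?addr0; last by move=> i _; rewrite /de bb subrr expr0n.
  by move/eqP; rewrite eqrXn2// (negbTE rr).
have [i di] : exists i, de i != 0.
  apply: contrapT => /forallNP h; move/eqP: bb; apply; apply: eq_from_tnth => i.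
  by have /negP := h i; rewrite negbK subr_eq0 => /eqP.
have bd k : bmf (fun x => (dot de (Z x) == k)%R%:R : R).
  apply: bmf_bool; apply: measurable_fun_eqr => //.
  by apply: measurable_sum => j; apply: measurable_funM => //; exact: measurable_coord.
pose k := (r' ^+ 2 - r ^+ 2 - \sum_i de i ^+ 2) / 2.
apply/eqP; rewrite eq_le; apply/andP; split; last by apply: Ex_ge0 => x; rewrite indicE.
rewrite -(N de k); last by exists i.
apply: le_Ex => // x; rewrite indicE; case: (boolP (_ \in _)) => // /set_mem/AS.
rewrite /Sset /= sumE => e; suff -> : dot de (Z x) == k by [].
by apply/eqP; rewrite /k -e; field.
Qed.

Lemma sphere_self d (T : measurableType d) (P : probability T R) m (Z : T -> m.-tuple R) (r : R)
    (b : m.-tuple R) A :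
  (forall x, \sum_i tnth (Z x) i ^+ 2 = r ^+ 2) ->
  pr P (fun x => vadd (Z x) b) (A `&` Sset b r) = pr P (fun x => vadd (Z x) b) A.
Proof.
move=> Zr; apply: eq_Ex => x; rewrite !indicE in_setI (_ : _ \in Sset b r) ?andbT//.
apply/mem_set; rewrite /Sset /= -(Zr x); apply: eq_bigr => i _.
by rewrite vaddNE subrr addr0.
Qed.

Let pr_mix d dB (T : measurableType d) (TB : measurableType dB) (P : probability T R)
    (PB : probability TB R) m (Z : T -> m.-tuple R) (B : TB -> m.-tuple R) A :
  measurable_fun setT Z -> measurable_fun setT B -> measurable A ->
  pr (PB \x P)%E (fun z => vadd (Z z.2) (B z.1)) A =
  Ex PB (fun y => pr P (fun x => vadd (Z x) (B y)) A).
Proof.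
move=> mZ mB mA; rewrite /pr Ex_prod//; apply: (bmf_comp _ (bmf_indic R mA)).
by apply: measurable_vadd; [exact: measurableT_comp mZ measurable_snd|
  exact: measurableT_comp mB measurable_fst].
Qed.

Let bmf_pr d dB (T : measurableType d) (TB : measurableType dB) (P : probability T R)
    (Q : probability TB R) m (Z : T -> m.-tuple R) (B : TB -> m.-tuple R) A :
  measurable_fun setT Z -> measurable_fun setT B -> measurable A ->
  bmf (fun y => pr P (fun x => vadd (Z x) (B y)) A).
Proof.
move=> mZ mB mA; apply: (@bmf_Ex _ _ _ _ _ Q P (fun z => \1_A (vadd (Z z.2) (B z.1)))).
apply: (bmf_comp _ (bmf_indic R mA)).
by apply: measurable_vadd; [exact: measurableT_comp mZ measurable_snd|
  exact: measurableT_comp mB measurable_fst].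
Qed.

Lemma bmf_eq_tuple d (T : measurableType d) m (B : T -> m.-tuple R) b :
  measurable_fun setT B -> bmf (fun y => (B y == b)%R%:R : R).
Proof.
move=> mB; have -> : (fun y => (B y == b)%R%:R : R) = (fun y => \prod_i (tnth (B y) i == tnth b i)%R%:R).
  apply/funext => y; rewrite prodr_bool; congr (_%:R); congr nat_of_bool.
  apply/eqP/forallP => [-> //|h]; apply: eq_from_tnth => i; exact/eqP.
apply: bmf_prod => i; apply: bmf_bool; apply: measurable_fun_eqr => //.
exact: measurable_coord.
Qed.

Let pr_setT d (T : measurableType d) (P : probability T R) m (X : T -> m.-tuple R) : pr P X setT = 1.
Proof. by rewrite /pr -[RHS](Ex_cst P 1); apply: eq_Ex => x; rewrite indicE in_setT. Qed.

Let pr_atom_ge d (T : measurableType d) (P : probability T R) m (Z : T -> m.-tuple R) (r : R)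
    (Q : probability (m.-tuple R) R) (B : m.-tuple R -> m.-tuple R) b :
  measurable_fun setT Z -> measurable_fun setT B ->
  (forall x, \sum_i tnth (Z x) i ^+ 2 = r ^+ 2) ->
  Ex Q (fun y => (B y == b)%R%:R) <= Ex Q (fun y => pr P (fun x => vadd (Z x) (B y)) (Sset b r)).
Proof.
move=> mZ mB Zr; apply: le_Ex.
- exact: bmf_eq_tuple.
- by apply: (bmf_pr P Q) => //; exact: measurable_Sset.
- move=> y; case: eqP => [->|_]; last by apply: Ex_ge0 => x; rewrite indicE.
  by rewrite -[Sset b r]setTI sphere_self// pr_setT.
Qed.

Let pr_atom_eq d (T : measurableType d) (P : probability T R) m (Z : T -> m.-tuple R) (r : R)
    (Q : probability (m.-tuple R) R) (B : m.-tuple R -> m.-tuple R) b A :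
  measurable_fun setT Z -> measurable_fun setT B -> measurable A -> 0 <= r ->
  (forall x, \sum_i tnth (Z x) i ^+ 2 = r ^+ 2) -> null_hyperplanes P Z ->
  Ex Q (fun y => pr P (fun x => vadd (Z x) (B y)) (A `&` Sset b r)) =
  Ex Q (fun y => (B y == b)%R%:R) * pr P (fun x => vadd (Z x) b) A.
Proof.
move=> mZ mB mA r0 Zr N; rewrite -ExZr; last exact: bmf_eq_tuple.
apply: eq_Ex => y; have [->|Bb] := eqVneq (B y) b; first by rewrite mul1r sphere_self.
rewrite mul0r; apply: (@sphere_null _ _ _ _ _ r r _ b) => //.
- by apply: measurableI => //; exact: measurable_Sset.
- by left.
Qed.

(* On the sphere of radius [r] centred at an atom [b] of [B], the other atoms contribute
   nothing to [Z + B]. *)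
Lemma sphere_matching : r1 = r2 /\ forall A, measurable A -> P1 (Z1 @^-1` A) = P2 (Z2 @^-1` A).
Proof.
have [p1 [rho1 [p2 [rho2 [h1 h2 C]]]]] := cross_two_point.
have [Q1 [B1 [mB1 bB1 L1 [b1 w1]]]] := exists_two_point_vector rho1 h1.
have [Q2 [B2 [mB2 bB2 L2 [b2 w2]]]] := exists_two_point_vector rho2 h2.
have bZ1 := sphere_bounded r10 Z1r; have bZ2 := sphere_bounded (ltW r20) Z2r.
(* [Z1 + B2] and [Z2 + B1], with independent summands, have equal Laplace transforms by
   [cross_two_point]. *)
have Law A : measurable A ->
    Ex Q2 (fun y => pr P1 (fun x => vadd (Z1 x) (B2 y)) A) =
    Ex Q1 (fun y => pr P2 (fun x => vadd (Z2 x) (B1 y)) A).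
  move=> mA; rewrite -!pr_mix//; apply: EFin_inj; rewrite !EFin_pr//; last 2 first.
  - by apply: measurable_vadd; [exact: measurableT_comp mZ2 measurable_snd|
  exact: measurableT_comp mB1 measurable_fst].
  - by apply: measurable_vadd; [exact: measurableT_comp mZ1 measurable_snd|
  exact: measurableT_comp mB2 measurable_fst].
  apply: laplace_unique => //.
  - by apply: measurable_vadd; [exact: measurableT_comp mZ1 measurable_snd|
  exact: measurableT_comp mB2 measurable_fst].
  - by apply: measurable_vadd; [exact: measurableT_comp mZ2 measurable_snd|
  exact: measurableT_comp mB1 measurable_fst].
  - have [K KP] := bZ1; have [L LP] := bB2; exists (K + L) => x i.
    by rewrite tnth_mktuple (le_trans (ler_normD _ _))// lerD.
  - have [K KP] := bZ2; have [L LP] := bB1; exists (K + L) => x i.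
    by rewrite tnth_mktuple (le_trans (ler_normD _ _))// lerD.
  move=> s.
  have E d (T : measurableType d) (P : probability T R) (Z : T -> n.+1.-tuple R)
      (Q : probability (n.+1.-tuple R) R) (B : n.+1.-tuple R -> n.+1.-tuple R) :
      measurable_fun setT Z -> measurable_fun setT B -> bounded_tuple Z -> bounded_tuple B ->
      Ex (Q \x P)%E (fun z => expR (dot s (vadd (Z z.2) (B z.1)))) =
      mgf P Z s * Ex Q (fun y => expR (dot s (B y))).
    move=> mZ mB bZ bB; rewrite mulrC -Ex_prodM; [|exact/bmf_expR/bmf_dot..].
    by apply: eq_Ex => z; rewrite dot_vadd expRD mulrC.
  by rewrite !E// L1 L2 C.
(* If [r1 = 0], then [Z1 + B2] has an atom at [b2], while [Z2 + B1] charges no point because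
   [r2 > 0]. *)
have r1gt : 0 < r1.
  rewrite lt_neqAle r10 andbT; apply/eqP => r1E.
  have := Law _ (@measurable_Sset _ b2 0).
  have -> : Ex Q1 (fun y => pr P2 (fun x => vadd (Z2 x) (B1 y)) (Sset b2 0)) = 0.
    rewrite -[RHS](Ex_cst Q1 0); apply: eq_Ex => y.
    apply: (@sphere_null _ _ _ _ _ r2 0 _ b2) => //; try exact: ltW.
      exact: measurable_Sset.
    by right; rewrite gt_eqF.
  move=> E0; have := @pr_atom_ge _ _ P1 _ Z1 0 Q2 B2 b2 mZ1 mB2.
  rewrite E0 leNgt w2 => h; have : false by apply: h => x; rewrite Z1r r1E.
  by [].
(* The sphere of radius [r2] about [b1] has positive mass for [Z2 + B1], and mass zero for [Z1 + B2]
   if the radii differ. *)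
have rE : r1 = r2.
  apply/eqP/negPn/negP => ne.
  have := Law _ (@measurable_Sset _ b1 r2).
  have -> : Ex Q2 (fun y => pr P1 (fun x => vadd (Z1 x) (B2 y)) (Sset b1 r2)) = 0.
    rewrite -[RHS](Ex_cst Q2 0); apply: eq_Ex => y.
    apply: (@sphere_null _ _ _ _ _ r1 r2 _ b1) => //; try exact: ltW.
    - exact: measurable_Sset.
    - exact: N1.
    - by right.
  move=> E0; have := pr_atom_ge P2 Q1 b1 mZ2 mB1 Z2r.
  by rewrite -E0 leNgt w1.
split => // A mA.
have Z1r' x : \sum_i tnth (Z1 x) i ^+ 2 = r2 ^+ 2 by rewrite Z1r rE.
have K A' : measurable A' -> Ex Q2 (fun y => (B2 y == b1)%R%:R) * pr P1 (fun x => vadd (Z1 x) b1) A' =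
    Ex Q1 (fun y => (B1 y == b1)%R%:R) * pr P2 (fun x => vadd (Z2 x) b1) A'.
  move=> mA'; rewrite -!(@pr_atom_eq _ _ _ _ _ r2)//; [|exact: ltW|exact: ltW|exact: N1].
  by apply: Law; apply: measurableI => //; exact: measurable_Sset.
(* Testing on the whole space shows that [B2] charges [b1] as much as [B1] does, so the common
   positive weight cancels. *)
have wE := K _ measurableT; rewrite !pr_setT !mulr1 in wE.
pose nb := vscale (-1) b1.
pose A' := (fun y => vadd y nb) @^-1` A.
have mA' : measurable A'.
  by rewrite -[X in measurable X]setTI; apply: measurable_vadd => //; exact: measurable_cst.
have prA d (T : measurableType d) (P : probability T R) (Z : T -> n.+1.-tuple R) :
    pr P (fun x => vadd (Z x) b1) A' = pr P Z A.
  apply: eq_Ex => x; rewrite /A' !indicE; congr (_%:R); congr nat_of_bool.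
  have zE : vadd (vadd (Z x) b1) nb = Z x.
    by apply: eq_from_tnth => i; rewrite !tnth_mktuple mulN1r addrK.
  by apply/idP/idP; rewrite !inE /= zE.
have := K _ mA'; rewrite wE !prA => /(mulfI (lt0r_neq0 w1)) E.
by rewrite -!EFin_pr// E.
Qed.

End sphere_matching.

(** * Recovering the angles from the sphere *)

Section angle_thresholds.
Context (R : realType).
Implicit Types v a : R.

(* The bounds outside [0, 1] make [lt_thr] hold for every real [a]. *)
Definition thr a : R := if a <= 0 then -1 else if 1 < a then 2 else - cos (pi * a).

Lemma thr_ge a : -1 <= thr a.
Proof.
rewrite /thr; case: ifP => // _; case: ifP => _; first lra.
by rewrite lerN2 cos_le1.
Qed.

Lemma thr_le a : a <= 1 -> thr a <= 1.
Proof.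
rewrite /thr => a1; case: ifP => [_|_]; first lra.
by rewrite ltNge a1 /= lerNl cos_geN1.
Qed.

Lemma lt_thr v a : 0 <= v <= 1 -> (v < a) = (- cos (pi * v) < thr a).
Proof.
move=> /andP[v0 v1]; have p0 := pi_gt0 R; rewrite /thr.
have [a0|a0] := leP a 0.
  rewrite ltNge (le_trans a0 v0)/= ltNge lerN2 cos_le1//.
have [a1|a1] := ltP 1 a.
  by rewrite (le_lt_trans v1 a1); symmetry; have := cos_geN1 (pi * v); lra.
rewrite ltrN2 ltr_cos ?in_itv/= ?mulr_ge0 ?(ltW p0) ?(ltW a0)//=; last 2 first.
- by rewrite ler_piMr// ltW.
- by rewrite ler_piMr// ltW.
by rewrite ltr_pM2l.
Qed.

(* The first angle runs over a full circle: the lower half is moved past the upper one by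
   adding [2] after reflection, so that a single threshold decides [v < a]. *)
Definition thr0 a : R := if a <= 2^-1 then thr (2 * a) else 2 + thr (2 * a - 1).

Lemma sin2pi_sign v : 0 <= v <= 1 -> sin (2 * pi * v) != 0 -> (0 < sin (2 * pi * v)) = (v < 2^-1).
Proof.
move=> /andP[v0 v1] s0; have p0 := pi_gt0 R; have [vh|vh] := ltP v 2^-1.
  rewrite lt_neqAle eq_sym s0 /=; apply: sin_ge0_pi; nra.
apply/negbTE; rewrite -leNgt -oppr_ge0.
have -> : - sin (2 * pi * v) = sin (pi * (2 * v - 1)).
  have -> : 2 * pi * v = pi * (2 * v - 1) + pi by ring.
  by rewrite sinDpi opprK.
by apply: sin_ge0_pi; nra.
Qed.

Lemma lt_thr0 v a : 0 <= v <= 1 -> sin (2 * pi * v) != 0 ->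
  (v < a) = ((if 0 < sin (2 * pi * v) then - cos (2 * pi * v) else 2 + cos (2 * pi * v)) < thr0 a).
Proof.
move=> v01 s0; rewrite sin2pi_sign// /thr0; have /andP[v0 v1] := v01.
(* Strict because the sine is nonzero: values coming from the upper half stay below 1, and
   thresholds for the lower half are at least 1. *)
have c1 : - cos (2 * pi * v) < 1.
  have := cos2Dsin2 (2 * pi * v); have : 0 < sin (2 * pi * v) ^+ 2 by rewrite exprn_even_gt0.
  by move: (cos _) (sin _) => C S; nra.
have [vh|vh] := ltP v 2^-1.
  have [ah|ah] := leP a 2^-1.
    have -> : 2 * pi * v = pi * (2 * v) by ring.
    by rewrite -lt_thr; [apply/idP/idP; lra|lra].
  rewrite (lt_trans vh ah); symmetry; have := thr_ge (2 * a - 1); lra.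
have -> : cos (2 * pi * v) = - cos (pi * (2 * v - 1)).
  have -> : 2 * pi * v = pi * (2 * v - 1) + pi by ring.
  by rewrite cosDpi.
have [ah|ah] := leP a 2^-1.
  rewrite ltNge (le_trans ah vh)/=; apply/esym/negbTE; rewrite -leNgt.
  have a1 : 2 * a <= 1 by lra.
  by have := thr_le a1; have := cos_le1 (pi * (2 * v - 1)); lra.
by rewrite ltrD2l -lt_thr; [apply/idP/idP; lra|lra].
Qed.

End angle_thresholds.

Section Sph_link.
Context (R : realType) (N : nat).
Implicit Types u : N.+1.-tuple R.

Definition ang u l : R := (if l == 0%N then 2 * pi else pi) * nth 0 (val u) l.

Lemma tnth_Sph u (i : 'I_N.+2) : tnth (@Sph R N.+2 u) i = sph N.+1 (ang u) i.
Proof.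
rewrite tnth_mktuple /sph /=; case: i => -[|i] iN /=; first by rewrite big_geq// mul1r.
rewrite [in RHS]big_ltn//; congr (_ * _ * _).
by apply: eq_big_nat => l /andP[l1 _]; rewrite /ang gtn_eqF.
Qed.

Lemma measurable_ang l : measurable_fun setT (fun u => ang u l).
Proof.
apply: measurable_funM => //; have [lN|lN] := ltnP l N.+1.
  rewrite (_ : (fun u => _) = (fun u : N.+1.-tuple R => tnth u (Ordinal lN))); first exact: measurable_tnth.
  by apply/funext => u; rewrite (tnth_nth 0).
rewrite (_ : (fun u => _) = (fun=> 0)) //.
by apply/funext => u; rewrite nth_default// size_tuple.
Qed.

Lemma bmf_sph i : bmf (fun u => sph N.+1 (ang u) i).
Proof.
apply: bmfM; first by apply: bmf_prod => l; apply: bmf_sin; exact: measurable_ang.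
by case: (i < N.+1)%N; [apply: bmf_cos; exact: measurable_ang|exact: bmf_cst].
Qed.

Definition Zvec (r : R) u : N.+2.-tuple R := vscale r (@Sph R N.+2 u).

Lemma tnth_Zvec r u i : tnth (Zvec r u) i = r * sph N.+1 (ang u) i.
Proof. by rewrite tnth_mktuple tnth_Sph. Qed.

Lemma measurable_Zvec r : measurable_fun setT (Zvec r).
Proof.
apply/measurable_fun_tnthP => i.
rewrite (_ : _ \o _ = fun u => r * sph N.+1 (ang u) i); first exact/bmf_meas/bmfZ/bmf_sph.
by apply/funext => u /=; rewrite tnth_Zvec.
Qed.

Lemma Zvec_sphere r u : \sum_i tnth (Zvec r u) i ^+ 2 = r ^+ 2.
Proof.
under eq_bigr do rewrite tnth_Zvec exprMn.
by rewrite -mulr_sumr sum_sph_sq mulr1.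
Qed.

Lemma cube_int_hyperplane (c : 'I_N.+2 -> R) (k : R) : (exists i, c i != 0) ->
  cube_int N.+1 (fun u => (((\sum_i c i * sph N.+1 (ang u) i == k)%R%:R : R)%:E)) = 0%E.
Proof.
move=> [i ci]; pose c' l := if (l < N.+2)%N =P true is ReflectT h then c (Ordinal h) else 0.
have cE (j : 'I_N.+2) : c' j = c j.
  rewrite /c'; case: eqP => [h|]; last by rewrite ltn_ord.
  by congr c; exact: val_inj.
rewrite -[RHS](@hyperplane_null R N (fun l => if l == 0%N then 2 * pi else pi) c' k); last 2 first.
- by move=> [|l]; [right|left].
- by exists i => //; rewrite cE.
rewrite /cube_int; apply: iint_nseq_eq => s sn _; congr (_%:R%:E); congr nat_of_bool.
congr (_ == _); apply: eq_bigr => j _; rewrite cE; congr (_ * sph _ _ _).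
apply/funext => l; rewrite /ang; congr (_ * _).
have [lN|lN] := ltnP l N.+1; last by rewrite !nth_default ?size_tuple ?sn.
by rewrite -(tnth_nth 0 (tup N.+1 s) (Ordinal lN)) tnth_mktuple.
Qed.

Variables (PU : probability (N.+1.-tuple R) R).
Hypotheses (PUcube : PU (cube N.+1) = 1%E)
  (PUnull : forall A, measurable A -> cube_int N.+1 (fun u => (\1_A u)%:E) = 0%E -> PU A = 0%E).

Lemma Zvec_null r : 0 < r -> null_hyperplanes PU (Zvec r).
Proof.
move=> r0 c k cne.
pose A := [set u : N.+1.-tuple R | \sum_i (r * c i) * sph N.+1 (ang u) i == k].
have bA : bmf (fun u => ((\sum_i (r * c i) * sph N.+1 (ang u) i == k)%R%:R : R)).
  apply: bmf_bool; apply: measurable_fun_eqr => //.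
  by apply: bmf_meas; apply: bmf_sum => i; apply: bmfZ; exact: bmf_sph.
have indE u : \1_A u = ((\sum_i (r * c i) * sph N.+1 (ang u) i == k)%R%:R : R).
  by rewrite indicE /A; congr (_%:R); congr nat_of_bool; apply/idP/idP; rewrite inE.
have mA : measurable A.
  have -> : A = setT `&` (fun u => \sum_i (r * c i) * sph N.+1 (ang u) i) @^-1` [set k].
    by rewrite setTI; apply/seteqP; split => u /= /eqP.
  suff : bmf (fun u => \sum_i (r * c i) * sph N.+1 (ang u) i) by move=> /bmf_meas; apply.
  by apply: bmf_sum => i; apply: bmfZ; exact: bmf_sph.
have -> : Ex PU (fun u => (dot c (Zvec r u) == k)%R%:R) = Ex PU \1_A.
  apply: eq_Ex => u; rewrite indE /dot; congr (_%:R); congr nat_of_bool; congr (_ == _).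
  by apply: eq_bigr => i _; rewrite tnth_Zvec mulrCA mulrA.
apply: EFin_inj; rewrite Ex_indic// PUnull//.
have [i ci] := cne; rewrite -[RHS](@cube_int_hyperplane (fun i => r * c i) k).
  by congr cube_int; apply/funext => u; rewrite indE.
by exists i; rewrite mulf_neq0// gt_eqF.
Qed.

(* The tail norm recovers [r |sin (2 pi u_0)| sin (pi u_1) ... sin (pi u_(j-1))]. *)
Definition tailnorm (x : N.+2.-tuple R) (j : nat) : R :=
  Num.sqrt (\sum_(i < N.+2 | (j <= i)%N) tnth x i ^+ 2).

(** Decides [u_j < a j] from the point [x] alone. The sign of the last coordinate is that of
    [sin (2 pi u_0)]: it selects the half circle for the first angle and corrects the sign of [x_j]
    for the others, whose cosine is [x_j] divided by the tail norm, up to that sign. *)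
Definition coord_below (r : R) (a : 'I_N.+1 -> R) (x : N.+2.-tuple R) (j : 'I_N.+1) : bool :=
  if (j : nat) == 0%N then
    (if 0 < tnth x ord_max then - tnth x ord0 else 2 * r + tnth x ord0) < thr0 (a j) * r
  else (if 0 < tnth x ord_max then - tnth x (widen_ord (leqnSn _) j) else tnth x (widen_ord (leqnSn _) j))
       < thr (a j) * tailnorm x j.

Lemma bmf_cond r a j : bmf (fun x => (coord_below r a x j)%:R : R).
Proof.
have mt i : measurable_fun setT (fun x : N.+2.-tuple R => tnth x i) by exact: measurable_tnth.
have mpos : measurable_fun setT (fun x : N.+2.-tuple R => 0 < tnth x ord_max).
  by apply: measurable_fun_ltr.
apply: bmf_bool; rewrite /coord_below; case: (boolP ((j : nat) == 0%N)) => _; apply: measurable_fun_ltr => //.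
- by apply: measurable_fun_ifT => //; [exact: measurableT_comp|exact: measurable_funD].
- by apply: measurable_fun_ifT => //; exact: measurableT_comp.
apply: measurable_funM => //; apply: (measurableT_comp (f := @Num.sqrt R)).
  by apply: continuous_measurable_fun; exact: sqrt_continuous.
rewrite (_ : (fun x => _) = (fun x : N.+2.-tuple R =>
    \sum_(i < N.+2) if (j <= i)%N then tnth x i ^+ 2 else 0)).
  apply: measurable_sum => i; case: (j <= i)%N => //.
  by apply: measurable_funX; exact: mt.
by apply/funext => x; rewrite big_mkcond.
Qed.

(** The last coordinate contains every sine as a factor, so its nonvanishing makes them all nonzero;
    on the cube all but the first are then positive. *)
Lemma condP r a u j : 0 < r -> cube N.+1 u -> tnth (Zvec r u) ord_max != 0 ->
  coord_below r a (Zvec r u) j = (tnth u j < a j).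
Proof.
move=> r0 uc; rewrite tnth_Zvec mulf_eq0 negb_or => /andP[_ last0].
have sne l : (l < N.+1)%N -> sin (ang u l) != 0.
  move=> lN; apply: contra last0 => /eqP s0; rewrite /sph /= ltnn mulr1.
  by rewrite (big_cat_nat (n := l)) ?(ltnW lN)//= [X in _ * X]big_ltn// s0 mul0r mulr0.
have u01 (l : 'I_N.+1) : 0 <= nth 0 (val u) l <= 1 by rewrite -tnth_nth; exact: uc.
have spos l : (0 < l < N.+1)%N -> 0 < sin (ang u l).
  move=> /andP[l0 lN]; rewrite lt_neqAle eq_sym sne//= /ang gtn_eqF//.
  have /andP[h0 h1] := u01 (Ordinal lN); have p0 := pi_gt0 R.
  by apply: sin_ge0_pi; rewrite mulr_ge0 ?(ltW p0)//= ler_piMr// ltW.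
have ppos m : (0 < m <= N.+1)%N ->
    exists2 q : R, 0 < q & \prod_(0 <= l < m) sin (ang u l) = sin (ang u 0) * q.
  move=> /andP[m0 mN]; exists (\prod_(1 <= l < m) sin (ang u l)); last by rewrite big_ltn.
  rewrite big_nat_cond; apply: prodr_gt0 => l /andP[/andP[l1 lm] _]; apply: spos.
  by rewrite l1 (leq_trans lm mN).
have sgn : (0 < tnth (Zvec r u) ord_max) = (0 < sin (ang u 0)).
  have [|q q0 qE] := ppos N.+1; first by rewrite leqnn.
  by rewrite tnth_Zvec pmulr_rgt0// /sph /= ltnn mulr1 qE pmulr_lgt0.
rewrite /coord_below sgn; case: ifP => [/eqP j0|/negbT j0].
  have -> : j = ord0 by exact: val_inj.
  rewrite !tnth_Zvec sph0.
  have a0 : ang u 0 = 2 * pi * nth 0 (val u) 0 by [].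
  rewrite (tnth_nth 0) /=.
  rewrite (@lt_thr0 _ _ (a ord0) (u01 ord0)); last by rewrite -a0; exact: sne.
  rewrite -a0 -(ltr_pM2r r0 _ (thr0 _)); congr (_ < _).
  by case: ifP => _; ring.
have jN : (0 < j < N.+1)%N by rewrite lt0n j0 ltn_ord.
have [|q q0 qE] := ppos j; first by rewrite lt0n j0 ltnW.
have tE : tailnorm (Zvec r u) j = r * (`|sin (ang u 0)| * q).
  rewrite /tailnorm; under eq_bigr do rewrite tnth_Zvec exprMn.
  rewrite -mulr_sumr sum_sph_sq_tail ?(ltnW (ltn_ord j))// -exprMn sqrtr_sqr qE.
  by rewrite !normrM (gtr0_norm r0) (gtr0_norm q0).
have xE : tnth (Zvec r u) (widen_ord (leqnSn _) j) = r * (sin (ang u 0) * q * cos (ang u j)).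
  by rewrite tnth_Zvec /sph /= ltn_ord qE.
rewrite tE xE (tnth_nth 0).
have aj : ang u j = pi * nth 0 (val u) j by rewrite /ang (negbTE j0).
rewrite (@lt_thr _ _ (a j) (u01 j)) -aj.
(* Both sides of the test carry the positive factor [K]; dividing by it leaves the comparison of
   [lt_thr]. *)
pose K : R := r * (`|sin (ang u 0)| * q).
have K0 : 0 < K by rewrite !mulr_gt0// normr_gt0 sne.
rewrite -/K -[RHS](ltr_pM2r K0); congr (_ < _).
rewrite /K; case: ifP => [s0|/negbT]; first by rewrite (gtr0_norm s0); ring.
rewrite -leNgt => s0; rewrite (ler0_norm s0); ring.
Qed.

(** The two integrands differ only outside the cube or where the last coordinate vanishes. The first
    set is null by [PUcube], the second is a hyperplane section. *)
Lemma Ex_box_cond r a : 0 < r ->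
  Ex PU (fun u => \prod_j (tnth u j < a j)%R%:R) = Ex PU (fun u => \prod_j (coord_below r a (Zvec r u) j)%:R).
Proof.
move=> r0.
pose bad u : R := (tnth (Zvec r u) ord_max == 0)%R%:R.
have bbad : bmf bad.
  apply: bmf_bool; apply: measurable_fun_eqr => //.
  by apply: measurable_coord; exact: measurable_Zvec.
have Ebad : Ex PU bad = 0.
  rewrite -(@Zvec_null r r0 (fun i => if i == ord_max then 1 else 0) 0).
    by apply: eq_Ex => u; rewrite dot_basis mul1r.
  by exists ord_max; rewrite eqxx oner_neq0.
have mC : measurable (~` (@cube R N.+1)) by apply: measurableC; exact: measurable_cube.
have EC : Ex PU (\1_(~` (@cube R N.+1))) = 0.
  by apply: EFin_inj; rewrite Ex_indic// probability_setC ?PUcube ?subee//; exact: measurable_cube.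
pose g u : R := \prod_j (tnth u j < a j)%R%:R.
pose h u : R := \prod_j (coord_below r a (Zvec r u) j)%:R.
have bg : bmf g.
  apply: bmf_prod => j; apply: bmf_bool; apply: measurable_fun_ltr => //; exact: measurable_tnth.
have bh : bmf h.
  by apply: bmf_prod => j; exact: (bmf_comp (measurable_Zvec r) (bmf_cond r a j)).
pose w u : R := bad u + \1_(~` (@cube R N.+1)) u.
have bw : bmf w by apply: bmfD => //; exact: bmf_indic.
have Ew0 : Ex PU w = 0 by rewrite ExD// ?Ebad ?EC ?addr0//; exact: bmf_indic.
have gh u : `|g u - h u| <= w u.
  have g01 : 0 <= g u <= 1 by rewrite /g prodr_bool; case: [forall _, _]; rewrite ?lexx ?ler01.
  have h01 : 0 <= h u <= 1 by rewrite /h prodr_bool; case: [forall _, _]; rewrite ?lexx ?ler01.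
  have w0 : 0 <= \1_(~` (@cube R N.+1)) u :> R by rewrite indicE.
  have b0 : 0 <= bad u by [].
  have [uc|uc] := pselect (cube N.+1 u); last first.
    rewrite /w indicE mem_set// ler_norml; move: (bad u) b0 => B B0.
    by rewrite /= ; lra.
  have [e|ne] := eqVneq (tnth (Zvec r u) ord_max) 0.
    rewrite /w /bad e eqxx ler_norml; move: (\1__ u) w0 => W W0; rewrite /=; lra.
  have -> : g u = h u by apply: eq_bigr => j _; rewrite condP.
  by rewrite subrr normr0 addr_ge0.
apply/eqP; rewrite -subr_eq0 -/g -/h -ExB// -normr_le0 -Ew0.
rewrite ler_norml; apply/andP; split.
  rewrite -mulN1r -ExZ//; apply: le_Ex; [exact: bmfZ|exact: bmfB|].
  by move=> u; rewrite mulN1r; have := gh u; rewrite ler_norml => /andP[].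
apply: le_Ex => //; first exact: bmfB.
by move=> u; have := gh u; rewrite ler_norml => /andP[].
Qed.

End Sph_link.

Lemma Zvec_law_inj (R : realType) N (PU PU' : probability (N.+1.-tuple R) R) (r : R) : 0 < r ->
  PU (cube N.+1) = 1%E -> PU' (cube N.+1) = 1%E ->
  (forall A, measurable A -> cube_int N.+1 (fun u => (\1_A u)%:E) = 0%E -> PU A = 0%E) ->
  (forall A, measurable A -> cube_int N.+1 (fun u => (\1_A u)%:E) = 0%E -> PU' A = 0%E) ->
  (forall A, measurable A -> PU (Zvec r @^-1` A) = PU' (Zvec r @^-1` A)) ->
  forall A, measurable A -> PU A = PU' A.
Proof.
move=> r0 c c' n n' H; apply: tuple_measure_unique => a.
have E (P : probability (N.+1.-tuple R) R) :
    P (box a) = (Ex P (fun u => \prod_i (tnth u i < a i)%R%:R))%:E.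
  exact: (@Ex_box _ _ _ P _ id a (@measurable_id _ _ setT)).
rewrite !E (Ex_box_cond c n _ r0) (Ex_box_cond c' n' _ r0); congr EFin.
apply: (law_Ex (g := fun x => \prod_j (coord_below r a x j)%:R) (measurable_Zvec r) (measurable_Zvec r) H).
by apply: bmf_prod => j; exact: bmf_cond.
Qed.

Lemma eq_from_charfun_factor d (T : measurableType d) d1 d2 (T1 : measurableType d1)
    (T2 : measurableType d2) (R : realType) (P : probability T R) (P1 : probability T1 R)
    (P2 : probability T2 R) (W : T -> R) (W1 : T1 -> R) (W2 : T2 -> R) :
  bmf W -> measurable_fun setT W1 -> measurable_fun setT W2 ->
  (forall t, phi P (fun x => t * W x) * phi P1 (fun x => t * W1 x) =
             phi P (fun x => t * W x) * phi P2 (fun x => t * W2 x)) ->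
  forall t b, Ex P1 (fun x => cos (t * W1 x + b)) = Ex P2 (fun x => cos (t * W2 x + b)).
Proof.
move=> bW mW1 mW2 H t0 b.
have mt (e : measure_display) (S : measurableType e) (V : S -> R) t :
    measurable_fun setT V -> measurable_fun setT (fun x => t * V x).
  by move=> mV; apply: measurable_funM.
(* The common factor need not be nonzero at [t0], but it is at points arbitrarily close; the
   identity is cancelled there and carried to [t0] by continuity. *)
have tex (k : nat) : exists t, `|t - t0| < k.+1%:R^-1 /\ phi P (fun x => t * W x) != 0.
  have [|t [tk [c Ec]]] := charfun_neq0 P t0 bW (delta := k.+1%:R^-1); first by rewrite invr_gt0.
  exists t; split => //; apply: contra Ec => /eqP p0.
  have := phi_shift P c (mt _ _ _ t (bmf_meas bW)); rewrite p0 mul0r.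
  by move=> /(congr1 (@complex.Re R)) /= ->.
pose t_ k := projT1 (cid (tex k)).
have t_P k : `|t_ k - t0| < k.+1%:R^-1 /\ phi P (fun x => t_ k * W x) != 0.
  exact: projT2 (cid (tex k)).
have t_cvg : t_ k @[k --> \oo] --> t0.
  apply/subr_cvg0/norm_cvg0P.
  apply: (squeeze_cvgr (f := fun=> 0) (h := fun k => k.+1%:R^-1)); last 2 first.
  - exact: cvg_cst.
  - exact: cvg_harmonic.
  by apply: nearW => k; rewrite normr_ge0 ltW//; case: (t_P k).
have c1 := Ex_cos_cvg (P := P1) (b := b) mW1 t_cvg.
have c2 := Ex_cos_cvg (P := P2) (b := b) mW2 t_cvg.
apply: (cvg_eq_lim _ c1 c2) => k.
by apply: phi_cos; [exact: mt..|]; apply: (mulfI (t_P k).2).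
Qed.

(** * Identification of the model *)

Section model_law.
Context (R : realType) (N : nat).
Let mR := measurableTypeR R.
Implicit Types (C : N.+2.-tuple R) (Q : 'I_N.+2 -> probability mR R).

Definition noise_phi Q C j (t : R) : R[i] := phi (Q j) (fun x => t * (x + tnth C j)).

Lemma noise_phi0 Q C j : noise_phi Q C j 0 = 1.
Proof. by apply: phi0 => x; rewrite mul0r. Qed.

Lemma measurable_shift (c : R) : measurable_fun setT (fun x : mR => x + c : mR).
Proof. by apply: measurable_funD => //; exact: measurable_id. Qed.

Lemma noise_phi_near0 Q C j :
  exists2 delta : R, 0 < delta & forall t, `|t| < delta -> noise_phi Q C j t != 0.
Proof. by apply: charfun_near0; exact: measurable_shift. Qed.

Definition obs C (r : R) (z : N.+1.-tuple R * N.+2.-tuple R) : N.+2.-tuple R :=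
  vadd C (vadd (Zvec r z.1) z.2).

Lemma measurable_obs C r : measurable_fun setT (obs C r).
Proof.
apply: measurable_vadd => //; apply: measurable_vadd => //.
exact: measurableT_comp (measurable_Zvec r) _.
Qed.

(** The definition of [lawP] is the product measure computed by sections: the inner [prodQ] is the
    mass of the section at [u]. *)
Lemma lawP_prob C r f Q (PU : probability (N.+1.-tuple R) R) (PQ : probability (N.+2.-tuple R) R) :
  (forall g : N.+1.-tuple R -> \bar R, measurable_fun setT g -> (forall x, 0 <= g x)%E ->
     cube_int N.+1 (fun u => ((f u)%:E * g u)%E) = (\int[PU]_x g x)%E) ->
  (forall A, measurable A -> prodQ Q A = PQ A) ->
  forall B, measurable B -> @lawP R N.+2 C r f Q B = (PU \x PQ)%E (obs C r @^-1` B).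
Proof.
move=> HU HQ B mB.
have mA : measurable (obs C r @^-1` B).
  by have := measurable_obs C r measurableT mB; rewrite setTI.
have -> : (PU \x PQ)%E (obs C r @^-1` B) =
    (\int[PU]_u PQ (xsection (obs C r @^-1` B) u))%E by [].
rewrite -HU//; last exact: (measurable_fun_xsection PQ mA).
rewrite /lawP; congr cube_int; apply/funext => u; congr (_ * _)%E.
have -> : [set e | B (vadd C (vadd (vscale r (@Sph R N.+2 u)) e))] = xsection (obs C r @^-1` B) u.
  by apply/seteqP; split => e /=; rewrite /xsection /= inE.
by rewrite HQ//; exact: measurable_xsection.
Qed.

Lemma phi_obs C r Q (PU : probability (N.+1.-tuple R) R) (PQ : probability (N.+2.-tuple R) R) t :
  (forall W : 'I_N.+2 -> mR -> R, (forall i, measurable_fun setT (W i)) ->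
      phi PQ (fun x => \sum_i W i (tnth x i)) = \prod_i phi (Q i) (W i)) ->
  phi (PU \x PQ)%E (fun z => dot t (obs C r z)) =
  phi PU (fun u => dot t (Zvec r u)) * \prod_j noise_phi Q C j (t j).
Proof.
move=> HQ; have mW i : measurable_fun setT (fun x : mR => t i * (x + tnth C i)).
  by apply: measurable_funM => //; exact: measurable_shift.
rewrite -(HQ (fun i x => t i * (x + tnth C i)))// -phi_prod.
- apply: eq_phi => z; rewrite !dot_vadd [RHS]addrC addrCA addrC; congr (_ + _).
  by rewrite /dot -big_split /=; apply: eq_bigr => i _; rewrite mulrDr addrC.
- have := bmf_dot (X := @Zvec R N r) t (measurable_Zvec r).
  suff b : bounded_tuple (@Zvec R N r) by move=> /(_ b)/bmf_meas.
  apply: (@sphere_bounded _ _ _ _ _ `|r|) => // u.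
  by rewrite Zvec_sphere real_normK// num_real.
- apply: measurable_sum => i; apply: (measurableT_comp (mW i)); exact: measurable_tnth.
Qed.

Lemma measurable_dot (t : 'I_N.+2 -> R) : measurable_fun setT (fun x : N.+2.-tuple R => dot t x).
Proof. by apply: measurable_sum => i; apply: measurable_funM => //; exact: measurable_tnth. Qed.

(** Noise is compared only after adding the centre: the observation sees [eps_j + C_j], and the two
    terms cannot be separated at this stage. *)
Lemma lawP_identifies C r f Q Cs rs fs Qs :
  is_density N.+1 f -> is_density N.+1 fs -> 0 <= r -> 0 < rs ->
  law_eq (@lawP R N.+2 C r f Q) (@lawP R N.+2 Cs rs fs Qs) ->
  [/\ r = rs, dens_eq N.+1 f fs &
      forall j a, Ex (Q j) (fun x => (x + tnth C j < a)%R%:R) =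
                  Ex (Qs j) (fun x => (x + tnth Cs j < a)%R%:R)].
Proof.
move=> df dfs r0 rs0 L.
have [PU [UE Uc Un]] := exists_density df.
have [PUs [UsE Usc Usn]] := exists_density dfs.
have [PQ [QE [_ QW]]] := exists_prodQ Q.
have [PQs [QsE [_ QsW]]] := exists_prodQ Qs.
have H t : phi PU (fun u => dot t (Zvec r u)) * \prod_j noise_phi Q C j (t j) =
    phi PUs (fun u => dot t (Zvec rs u)) * \prod_j noise_phi Qs Cs j (t j).
  rewrite -(phi_obs _ _ _ _ QW) -(phi_obs _ _ _ _ QsW) /phi.
  have LE (g : N.+2.-tuple R -> R) : bmf g ->
      Ex (PU \x PQ)%E (fun z => g (obs C r z)) = Ex (PUs \x PQs)%E (fun z => g (obs Cs rs z)).
    apply: law_Ex; [exact: measurable_obs..|] => A mA.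
    exact: etrans (etrans (esym (lawP_prob C r UE QE mA)) (L A mA)) (lawP_prob Cs rs UsE QsE mA).
  rewrite (LE (fun x => cos (dot t x))) ?(LE (fun x => sin (dot t x)))//.
  - by apply: bmf_sin; exact: measurable_dot.
  - by apply: bmf_cos; exact: measurable_dot.
have bZ : bounded_tuple (@Zvec R N r) by apply: (sphere_bounded r0) => u; exact: Zvec_sphere.
have bZs : bounded_tuple (@Zvec R N rs) by apply: (sphere_bounded (ltW rs0)) => u; exact: Zvec_sphere.
(* The radius known to be positive, [rs], takes the second place, where [sphere_matching] asks for
   it. *)
have [] := @sphere_matching _ _ _ _ R N.+1 PU PUs (Zvec r) (Zvec rs) r rs.
- exact: measurable_Zvec.
- exact: measurable_Zvec.
- by [].
- by [].
- exact: Zvec_sphere.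
- exact: Zvec_sphere.
- by move=> r1; exact: (Zvec_null Un r1).
- exact: (Zvec_null Usn rs0).
- move=> s; apply: (laplace_cross (measurable_Zvec r) (measurable_Zvec rs) bZ bZs H).
  + exact: noise_phi0.
  + exact: noise_phi0.
  + exact: noise_phi_near0.
  + exact: noise_phi_near0.
move=> rE Zlaw; subst rs.
have UU := Zvec_law_inj rs0 Uc Usc Un Usn Zlaw.
split=> //.
  move=> A mA.
  have mI : measurable_fun setT (fun u => ((\1_A u : R)%:E)).
    exact/measurable_EFinP/measurable_indic.
  have i0 (u : N.+1.-tuple R) : (0 <= (\1_A u : R)%:E)%E by rewrite lee_fin.
  have := UE _ mI i0; have := UsE _ mI i0; rewrite !integral_indic// !setIT => h1 h2.
  exact: etrans h2 (etrans (UU A mA) (esym h1)).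
move=> j; apply: levy_lt; [exact: measurable_shift..|].
have bW := bmf_coord j (measurable_Zvec r) bZ.
(* The [j]-th signal coordinate now has the same law on both sides and plays the common bounded
   factor. *)
apply: (eq_from_charfun_factor (P := PU) bW); [exact: measurable_shift..|] => t.
have := charfun_marginal H (noise_phi0 Q C) (noise_phi0 Qs Cs) j t.
rewrite /noise_phi => ->; congr (_ * _).
have LZ (g : N.+2.-tuple R -> R) : bmf g -> Ex PUs (fun z => g (Zvec r z)) = Ex PU (fun z => g (Zvec r z)).
  by move=> bg; apply/esym; apply: law_Ex => //; exact: measurable_Zvec.
have mj : measurable_fun setT (fun x : N.+2.-tuple R => t * tnth x j).
  by apply: measurable_funM => //; exact: measurable_tnth.
rewrite /phi (LZ (fun x => cos (t * tnth x j))) ?(LZ (fun x => sin (t * tnth x j)))//.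
- exact: bmf_sin.
- exact: bmf_cos.
Qed.

End model_law.

(** * Translations of the noise and centring *)

Section shifts.
Context (R : realType).
Let mR := measurableTypeR R.

Definition vopp n (x : n.-tuple R) : n.-tuple R := [tuple - tnth x i | i < n].

Lemma vaddK n (x m : n.-tuple R) : vadd (vadd x m) (vopp m) = x.
Proof. by apply: eq_from_tnth => i; rewrite !tnth_mktuple addrK. Qed.

Lemma vaddNK n (x m : n.-tuple R) : vadd (vadd x (vopp m)) m = x.
Proof. by apply: eq_from_tnth => i; rewrite !tnth_mktuple subrK. Qed.

(** A translate by [m] becomes a preimage under the opposite translation, which gives its
    measurability and its mass by pushforward. *)
Lemma image_vadd n (m : n.-tuple R) (A : set (n.-tuple R)) :
  [set vadd x m | x in A] = (fun x => vadd x (vopp m)) @^-1` A.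
Proof.
apply/seteqP; split => [_ [x Ax <-]|x Ax] /=; first by rewrite vaddK.
by exists (vadd x (vopp m)) => //; rewrite vaddNK.
Qed.

Lemma prodQ_shift n (Q Qs : 'I_n -> probability mR R) (m : n.-tuple R) :
  (forall j a, Ex (Q j) (fun x => (x < a)%R%:R) = Ex (Qs j) (fun x => (x - tnth m j < a)%R%:R)) ->
  law_eq (prodQ Q) (fun A => prodQ Qs [set vadd x m | x in A]).
Proof.
move=> H A mA; rewrite image_vadd.
have [PQ [QE [QX _]]] := exists_prodQ Q.
have [PQs [QsE [QsX _]]] := exists_prodQ Qs.
have mS : measurable_fun setT (fun x : n.-tuple R => vadd x (vopp m)).
  by apply: measurable_vadd => //; exact: measurable_id.
have mSA : measurable ((fun x : n.-tuple R => vadd x (vopp m)) @^-1` A).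
  by have := mS measurableT A mA; rewrite setTI.
rewrite QE// QsE//; have [PS [SE _]] := exists_pushforward PQs mS.
rewrite -SE//; apply: tuple_measure_unique => // a; rewrite SE; last exact: measurable_box.
rewrite (Ex_box PQs a mS) (@Ex_box _ _ _ PQ _ id a (@measurable_id _ _ setT)); congr EFin.
have bl (c b : R) : bmf (fun x : mR => (x + c < b)%R%:R : R).
  by apply: bmf_bool; apply: measurable_fun_ltr => //; apply: measurable_funD => //; exact: measurable_id.
rewrite (QX (fun i x => (x < a i)%R%:R)); last first.
  by move=> i; apply: bmf_bool; apply: measurable_fun_ltr => //; exact: measurable_id.
under [RHS]eq_Ex do under eq_bigr do rewrite !tnth_mktuple.
rewrite (QsX (fun i x => (x + - tnth m i < a i)%R%:R)); last by move=> i; exact: bl.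
by apply: eq_bigr => i _; exact: H.
Qed.

(** Reals are wrapped as 1-tuples to reuse [tuple_measure_unique], whose boxes are then
    half-lines. *)
Lemma real_law_unique (P1 P2 : probability mR R) (W1 W2 : mR -> R) :
  measurable_fun setT W1 -> measurable_fun setT W2 ->
  (forall a : R, Ex P1 (fun x => (W1 x < a)%R%:R) = Ex P2 (fun x => (W2 x < a)%R%:R)) ->
  forall A, measurable A -> P1 (W1 @^-1` A) = P2 (W2 @^-1` A).
Proof.
move=> mW1 mW2 H A mA.
have mt (W : mR -> R) : measurable_fun setT W -> measurable_fun setT (fun x => [tuple W x] : 1.-tuple R).
  move=> mW; apply/measurable_fun_tnthP => i.
  by rewrite (_ : _ \o _ = W)//; apply/funext => x /=; rewrite (ord1 i).
have [S1 [S1E _]] := exists_pushforward P1 (mt _ mW1).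
have [S2 [S2E _]] := exists_pushforward P2 (mt _ mW2).
have mB : measurable [set t : 1.-tuple R | A (tnth t ord0)].
  by have := @measurable_tnth _ R 1 ord0 measurableT A mA; rewrite setTI.
have <- : S1 [set t : 1.-tuple R | A (tnth t ord0)] = P1 (W1 @^-1` A) by rewrite S1E.
have <- : S2 [set t : 1.-tuple R | A (tnth t ord0)] = P2 (W2 @^-1` A) by rewrite S2E.
apply: tuple_measure_unique mB => a.
rewrite S1E ?S2E; [|exact: measurable_box..].
rewrite (Ex_box P1 a (mt _ mW1)) (Ex_box P2 a (mt _ mW2)); congr EFin.
by under eq_Ex do rewrite big_ord1; under [RHS]eq_Ex do rewrite big_ord1; exact: H.
Qed.

(** The laws of [x + c1] and [x + c2] coincide, hence so do their means, which are [c1] and [c2] by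
    centring. *)
Lemma centered_shift (P1 P2 : probability mR R) (c1 c2 : R) :
  P1.-integrable setT (fun x => x%:E) -> (\int[P1]_x x%:E = 0)%E ->
  P2.-integrable setT (fun x => x%:E) -> (\int[P2]_x x%:E = 0)%E ->
  (forall a, Ex P1 (fun x => (x + c1 < a)%R%:R) = Ex P2 (fun x => (x + c2 < a)%R%:R)) ->
  c1 = c2.
Proof.
move=> i1 e1 i2 e2 H.
have ms (c : R) := @measurable_shift R c.
have L := real_law_unique (ms c1) (ms c2) H.
have E (P : probability mR R) (c : R) : P.-integrable setT (fun x => x%:E) -> (\int[P]_x x%:E = 0)%E ->
    (\int[pushforward P (fun x : mR => (x + c)%R : R)]_y y%:E = c%:E)%E.
  move=> iP eP; have ic : P.-integrable setT (fun=> c%:E) by exact: finite_measure_integrable_cst.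
  have iD : P.-integrable setT (EFin \o (fun x : mR => x + c)).
    exact: (integrableD measurableT iP ic).
  rewrite integral_pushforward//; last exact: ms.
  rewrite preimage_setT; under eq_integral do rewrite /= EFinD.
  rewrite integralD// eP add0e integral_cst//.
  exact: etrans (congr1 (mule c%:E) (probability_setT P)) (mule1 _).
apply: EFin_inj; rewrite -(E P1 c1)// -(E P2 c2)//.
by apply: eq_measure_integral; [exact: ms|exact: ms|move=> ? ? A mA _; exact: L].
Qed.

End shifts.

Theorem theorem2p3 (R : realType) (d : nat) (hd : (2 <= d)%N)
    (Cs : d.-tuple R) (Rs : R) (hRs : 0 < Rs)
    (fs : (d.-1).-tuple R -> R) (hfs : is_density (d.-1) fs)
    (H2 : (2 < d)%N -> exists gamma : R, 0 < gamma /\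
            forall u : (d.-1).-tuple R,
              (forall i, 0 < tnth u i < gamma) -> 0 < fs u)
    (Qs : 'I_d -> probability (measurableTypeR R) R) :
  (forall (Q : 'I_d -> probability (measurableTypeR R) R)
          (f : (d.-1).-tuple R -> R) (C : d.-tuple R) (Rad : R),
     is_density (d.-1) f -> 0 <= Rad ->
     (law_eq (lawP C Rad f Q) (lawP Cs Rs fs Qs) <->
      [/\ Rad = Rs, dens_eq (d.-1) f fs &
          exists m : d.-tuple R, C = vadd Cs m /\
            law_eq (prodQ Q) (fun A => prodQ Qs [set vadd x m | x in A])]))
  /\
  (forall (Q : 'I_d -> probability (measurableTypeR R) R)
          (f : (d.-1).-tuple R -> R) (C : d.-tuple R) (Rad : R),
     is_density (d.-1) f -> 0 <= Rad ->
     centered Q -> centered Qs ->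
     law_eq (lawP C Rad f Q) (lawP Cs Rs fs Qs) ->
     C = Cs /\ law_eq (prodQ Q) (prodQ Qs)).
Proof.
case: d hd Cs fs hfs H2 Qs => [//|[//|N]] _ Cs fs hfs _ Qs.
have fwd Q f C Rad (m := [tuple tnth C i - tnth Cs i | i < N.+2]) : is_density N.+1 f -> 0 <= Rad ->
    law_eq (lawP C Rad f Q) (lawP Cs Rs fs Qs) ->
    [/\ Rad = Rs, dens_eq N.+1 f fs, C = vadd Cs m &
        law_eq (prodQ Q) (fun A => prodQ Qs [set vadd x m | x in A])].
  move=> df r0 L; have [rE fE QE] := lawP_identifies df hfs r0 hRs L; split => //.
    by apply: eq_from_tnth => i; rewrite !tnth_mktuple addrC subrK.
  apply: prodQ_shift => j a.
  (* The threshold [a + C_j] absorbs the centre on the left and leaves [x - m_j < a] on the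
     right. *)
  have := QE j (a + tnth C j); under eq_Ex do rewrite ltrD2r; move=> ->.
  apply: eq_Ex => x; congr (_%:R); congr nat_of_bool; rewrite tnth_mktuple.
  by apply/idP/idP; lra.
split=> [Q f C Rad df r0|Q f C Rad df r0 cQ cQs L]; last first.
  have [_ _ QE] := lawP_identifies df hfs r0 hRs L.
  have CE : C = Cs.
    apply: eq_from_tnth => j; have [i1 e1] := cQ j; have [i2 e2] := cQs j.
    exact: (centered_shift i1 e1 i2 e2 (QE j)).
  split=> // A mA; have [_ _ _ ->//] := fwd Q f C Rad df r0 L.
  rewrite CE; congr prodQ; have v0 x : vadd x [tuple tnth Cs i - tnth Cs i | i < N.+2] = x.
    by apply: eq_from_tnth => i; rewrite !tnth_mktuple subrr addr0.
  by under eq_imagel do rewrite v0; exact: image_id.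
split=> [L|[-> fE [m [CE QE]]] B mB].
  by have [rE fE CE QE] := fwd Q f C Rad df r0 L; split => //; eexists; split; [exact: CE|exact: QE].
have [PU [UE Uc Un]] := exists_density df.
have [PUs [UsE Usc Usn]] := exists_density hfs.
have [PQ [PQE _]] := exists_prodQ Q.
have [PQs [PQsE _]] := exists_prodQ Qs.
rewrite (lawP_prob _ _ UE PQE)// (lawP_prob _ _ UsE PQsE)//.
have mX C' : measurable (obs C' Rs @^-1` B).
  by have := measurable_obs C' Rs measurableT mB; rewrite setTI.
have -> : (PU \x PQ)%E (obs C Rs @^-1` B) =
  (\int[PU]_u PQ (xsection (obs C Rs @^-1` B) u))%E by [].
have -> : (PUs \x PQs)%E (obs Cs Rs @^-1` B) =
  (\int[PUs]_u PQs (xsection (obs Cs Rs @^-1` B) u))%E by [].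
(* Adding [m] to the noise turns the section for the centre [C = Cs + m] into the section for [Cs],
   which is exactly the translation in [QE]. *)
have -> : (\int[PU]_u PQ (xsection (obs C Rs @^-1` B) u) =
           \int[PU]_u PQs (xsection (obs Cs Rs @^-1` B) u))%E.
  apply: eq_integral => u _.
  have mx C' := measurable_xsection u (mX C').
  rewrite -PQE// QE//.
  rewrite (_ : [set _ | _ in _] = xsection (obs Cs Rs @^-1` B) u) ?PQsE//.
  rewrite image_vadd; apply/seteqP; split => e /=; rewrite /xsection /= !inE /obs /=;
    rewrite CE; congr B; apply: eq_from_tnth => i; rewrite !tnth_mktuple; ring.
(* The integrands now agree, and [fE] tested on indicators identifies the two laws of the angles. *)
apply: eq_measure_integral => A mA _.
have mI : measurable_fun setT (fun u : N.+1.-tuple R => ((\1_A u : R)%:E)).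
  exact/measurable_EFinP/measurable_indic.
have := UE _ mI; have := UsE _ mI; rewrite !integral_indic// !setIT => h1 h2.
by rewrite -h1// -h2//; exact: fE.
Qed.
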